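(* For all $(\mathbf u_{h,\gamma},\lambda_{h,\gamma})\in\mathbf V_{h,\gamma}\times M_{h,\gamma}$, $$\frac{1}{6(1+\tau\alpha_\gamma)^2}\,\|(\mathbf u_{h,\gamma},\lambda_{h,\gamma})\|_{1,\tau,\star}\le\sup_{(\mathbf v_{h,\gamma},\mu_{h,\gamma})\in\mathbf V_{h,\gamma}\times M_{h,\gamma}}\frac{\mathcal A_\gamma((\mathbf u_{h,\gamma},\lambda_{h,\gamma}),(\mathbf v_{h,\gamma},\mu_{h,\gamma}))+s_\gamma(\lambda_{h,\gamma},\mu_{h,\gamma})}{\|(\mathbf v_{h,\gamma},\mu_{h,\gamma})\|_{1,\tau,\star}}$$ (supremum over nonzero pairs). If $\alpha_\gamma\to\infty$ (the case of continuous pressure across $\gamma$), then $$\frac{1}{6\left(1+C_{\mathrm{dTr}}^2c_{\mathbf K}^{-1}\frac{\tau}{h}\right)^2}\,\|(\mathbf u_{h,\gamma},\lambda_{h,\gamma})\|_{1,\tau,\star}\le\sup_{(\mathbf v_{h,\gamma},\mu_{h,\gamma})\in\mathbf V_{h,\gamma}\times M_{h,\gamma}}\frac{\mathcal A_\gamma((\mathbf u_{h,\gamma},\lambda_{h,\gamma}),(\mathbf v_{h,\gamma},\mu_{h,\gamma}))+s_\gamma(\lambda_{h,\gamma},\mu_{h,\gamma})}{\|(\mathbf v_{h,\gamma},\mu_{h,\gamma})\|_{1,\tau,\star}}.$$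
   Context: Geometry: $\Omega\subset\mathbb R^d$, $d\in\{2,3\}$, is a bounded domain with Lipschitz boundary; $\gamma\subset\Omega$ is a $(d-1)$-dimensional non self-intersecting surface of class $C^2$ (the fracture) dividing $\Omega$ into two subdomains, $\Omega=\Omega_1\cup\Omega_2\cup\gamma$, $\gamma=\partial\Omega_1\cap\partial\Omega_2$; $\mathbf n_i$ is the outward unit normal to $\partial\Omega_i$; $\nabla_\tau\cdot$ is the tangential divergence on $\gamma$. $(\cdot,\cdot)_D$ and $\|\cdot\|_D$ are the $L^2(D)$ scalar product and norm. Data: the conductivity tensors $\mathbf K$ on $\Omega_1\cup\Omega_2$ and $\mathbf K_\gamma$ on $\gamma$ are time independent and satisfy $\zeta^{T}\mathbf K^{-1}\zeta\ge c_{\mathbf K}|\zeta|^2$, $|\mathbf K^{-1}\zeta|\le C_{\mathbf K}|\zeta|$ ($\zeta\in\mathbb R^d$) and $\zeta^{T}\mathbf K_\gamma^{-1}\zeta\ge c_{\mathbf K,\gamma}|\zeta|^2$, $|\mathbf K_\gamma^{-1}\zeta|\le C_{\mathbf K,\gamma}|\zeta|$ ($\zeta\in\mathbb R^{d-1}$) a.e., with $c_{\mathbf K},c_{\mathbf K,\gamma}>0$. The Robin parameter $\alpha_\gamma>0$ is a constant. $\tau>0$ is the time step and $L_\gamma>0$ a stabilization parameter. Discretization: $\mathcal T_{h,i}$ is a partition of $\Omega_i$ into simplices or rectangular elements such that $\mathcal T_h=\mathcal T_{h,1}\cup\mathcal T_{h,2}$ is a conforming mesh of $\Omega$; $\mathcal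 T_{h,\gamma}$ is a partition of $\gamma$ induced by $\mathcal T_h$ or slightly coarser; $h$ is the maximal mesh size of both. $M_{h,i}$, $M_{h,\gamma}$ are the piecewise constant functions on $\mathcal T_{h,i}$, $\mathcal T_{h,\gamma}$; $\mathbf V_{h,i}$, $\mathbf V_{h,\gamma}\subset\mathbf H(\mathrm{div}_\tau,\gamma)$ are the lowest-order Raviart–Thomas–Nédélec spaces on $\mathcal T_{h,i}$, $\mathcal T_{h,\gamma}$. With $\mathcal Q_{h,i}$ the $L^2$-projection onto $\mathbf V_{h,i}\cdot\mathbf n_i$, the meshes are such that $\|\lambda\|_\gamma\lesssim\|\mathcal Q_{h,1}\lambda\|_\gamma+\|\mathcal Q_{h,2}\lambda\|_\gamma$ for all $\lambda\in M_{h,\gamma}$. $C_{\mathrm{dTr}}>0$ depends only on mesh shape regularity and is the constant in $\|\mathbf u_h\cdot\mathbf n\|_{\partial\Omega_i}\le C_{\mathrm{dTr}}h^{-1/2}\|\mathbf u_h\|_{\Omega_i}$ for $\mathbf u_h\in\mathbf V_{h,i}$. Forms: $a_i(\mathbf u,\mathbf v)=(\mathbf K^{-1}\mathbf u,\mathbf v)_{\Omega_i}+\alpha_\gamma^{-1}(\mathbf u\cdot\mathbf n_i,\mathbf v\cdot\mathbf n_i)_\gamma$, $b_i(\mathbf u,q)=(\nabla\cdot\mathbf u,q)_{\Omega_i}$, $c_i(p,q)=(p,q)_{\Omega_i}$; $a_\gamma(\mathbf u,\mathbf v)=(\mathbf K_\gamma^{-1}\mathbf u,\mathbf v)_\gamma$,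 $b_\gamma(\mathbf u,\mu)=(\nabla_\tau\cdot\mathbf u,\mu)_\gamma$. The case ''$\alpha_\gamma\to\infty$'' (continuous pressure) means $a_i(\mathbf u,\mathbf v)=(\mathbf K^{-1}\mathbf u,\mathbf v)_{\Omega_i}$. Interface form: for $\lambda\in M_{h,\gamma}$ let $(\mathbf u^*_{h,i}(\lambda),p^*_{h,i}(\lambda))\in\mathbf V_{h,i}\times M_{h,i}$ solve $a_i(\mathbf u^*_{h,i}(\lambda),\mathbf v)-b_i(\mathbf v,p^*_{h,i}(\lambda))=-(\lambda,\mathbf v\cdot\mathbf n_i)_\gamma$ for all $\mathbf v\in\mathbf V_{h,i}$ and $c_i(p^*_{h,i}(\lambda),q)+\tau\, b_i(\mathbf u^*_{h,i}(\lambda),q)=0$ for all $q\in M_{h,i}$. Then $s_\gamma(\lambda,\mu)=-\sum_{i=1}^2(\mathbf u^*_{h,i}(\lambda)\cdot\mathbf n_i,\mu)_\gamma$, and $\|\mu\|_{s,\gamma}=s_\gamma(\mu,\mu)^{1/2}$. Linearized fracture form: $\mathcal A_\gamma((\mathbf u,\lambda),(\mathbf v,\mu))=a_\gamma(\mathbf u,\mathbf v)+L_\gamma(\mathbf u,\mathbf v)_\gamma+\tau^{-1}(\lambda,\mu)_\gamma+b_\gamma(\mathbf u,\mu)-b_\gamma(\mathbf v,\lambda)$. Norm: $\|(\mathbf v,\mu)\|_{1,\tau,\star}^2=\|\mathbf K_\gamma^{-1/2}\mathbf v\|_\gamma^2+\|L_\gamma^{1/2}\mathbf v\|_\gamma^2+\|\tau^{1/2}\nabla_\tau\cdot\mathbf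 v\|_\gamma^2+\|\mu\|_{s,\gamma}^2+\|\tau^{-1/2}\mu\|_\gamma^2$. *)

(* Defs.v *)
From HB Require Import structures.
From mathcomp Require Import all_boot all_order all_algebra.
From mathcomp Require Import all_classical all_reals all_analysis.

Set Implicit Arguments.
Unset Strict Implicit.
Unset Printing Implicit Defensive.
Import Order.TTheory GRing.Theory Num.Theory.
Import numFieldNormedType.Exports.

Local Open Scope classical_set_scope.
Local Open Scope ring_scope.

(* The norm of MathComp-Analysis on row vectors is the sup norm; it induces the
   same topology, but lengths below are Euclidean. *)
Definition dot {R : realType} {m : nat} (x y : 'rV[R]_m) : R :=
  \sum_(i < m) x 0 i * y 0 i.

Definition enorm {R : realType} {m : nat} (x : 'rV[R]_m) : R :=
  Num.sqrt (dot x x).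

(* The product A x of a matrix and a vector, for vectors stored as rows. *)
Definition mulmv {R : realType} {m : nat} (A : 'M[R]_m) (x : 'rV[R]_m) :
  'rV[R]_m := x *m A^T.

Definition ediam {R : realType} {m : nat} (A : set 'rV[R]_m) : \bar R :=
  ereal_sup [set (enorm (z.1 - z.2))%:E | z in A `*` A].

(* Hausdorff measures. Normalized as below, H^m is the Lebesgue measure of R^m
   (isodiametric inequality) and H^(m-1) is the surface measure on
   hypersurfaces of R^m. *)

Fixpoint unit_ball_volume (R : realType) (k : nat) : R :=
  match k with
  | 0 => 1
  | 1 => 2
  | j.+2 => 2 * pi / j.+2%:R * unit_ball_volume R j
  end.

Section hausdorff_measure.
Context {R : realType} {m : nat}.
Local Open Scope ereal_scope.

Definition hgauge (k : nat) (U : set 'rV[R]_m) : \bar R :=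
  if `[< U = set0 >] then 0
  else (unit_ball_volume R k / 2 ^+ k)%:E * ediam U ^+ k.

Definition hausdorff_pre (k : nat) (delta : R) (A : set 'rV[R]_m) : \bar R :=
  ereal_inf [set \sum_(i <oo) hgauge k (U i) | U in
    [set U : (set 'rV[R]_m)^nat |
      A `<=` \bigcup_i U i /\ forall i, ediam (U i) <= delta%:E]].

Definition hausdorff (k : nat) (A : set 'rV[R]_m) : \bar R :=
  ereal_sup [set hausdorff_pre k delta A | delta in [set d : R | (0 < d)%R]].

End hausdorff_measure.

(* hausdorff_pre is the outer measure mu_ext of hgauge, made infinite on sets of
   diameter larger than delta, for the semiring of all sets. *)
Definition allsets (T : Type) : Type := T.

Section allsets_semiring.
Context (T : pointedType).
HB.instance Definition _ := Pointed.on (allsets T).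
HB.instance Definition _ := @isMeasurable.Build default_measure_display
  (allsets T) setT I (fun _ _ => I) (fun _ _ => I).
End allsets_semiring.

Section hausdorff_outer_measure.
Context {R : realType} {m : nat}.
Local Open Scope ereal_scope.
Implicit Types (k : nat) (A U : set 'rV[R]_m) (delta : R).

Lemma unit_ball_volume_ge0 k : (0 <= unit_ball_volume R k)%R.
Proof.
suff [] : (0 <= unit_ball_volume R k)%R /\ (0 <= unit_ball_volume R k.+1)%R by [].
elim: k => [|k [k0 k1]]; first by split => //=.
split=> //.
rewrite [unit_ball_volume R k.+2]/=.
by rewrite mulr_ge0// mulr_ge0 ?invr_ge0// mulr_ge0// pi_ge0.
Qed.

Lemma ediam_ge0 U : U !=set0 -> 0 <= ediam U.
Proof.
move=> [x Ux]; apply: ereal_sup_ubound; exists (x, x) => //=.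
rewrite subrr /enorm /dot big1 ?sqrtr0// => i _.
by rewrite mxE mul0r.
Qed.

Lemma hgauge_ge0 k U : 0 <= hgauge k U.
Proof.
rewrite /hgauge; case: asboolP => // /eqP/set0P U0.
rewrite mule_ge0 ?lee_fin ?divr_ge0 ?unit_ball_volume_ge0 ?exprn_ge0//.
by rewrite expe_ge0// ediam_ge0.
Qed.

Definition hgauge_le k delta (U : set (allsets 'rV[R]_m)) : \bar R :=
  if ediam (U : set 'rV[R]_m) <= delta%:E then hgauge k U else +oo.

Lemma hgauge_le_ge0 k delta U : 0 <= hgauge_le k delta U.
Proof. by rewrite /hgauge_le; case: ifP => // _; exact: hgauge_ge0. Qed.

Lemma hgauge_le0 k delta : hgauge_le k delta set0 = 0.
Proof.
rewrite /hgauge_le /hgauge asboolT// /ediam.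
by rewrite set0X image_set0 ereal_sup0 leNye.
Qed.

Lemma hausdorff_preE k delta A :
  hausdorff_pre k delta A = mu_ext (hgauge_le k delta) A.
Proof.
apply/eqP; rewrite eq_le; apply/andP; split.
- apply: le_ereal_inf_tmp => _ [U [_ AU] <-].
  have [Ud|] := pselect (forall i, ediam (U i : set 'rV[R]_m) <= delta%:E).
    apply: ereal_inf_lbound; exists U => //.
    by apply: eq_eseriesr => i _; rewrite /hgauge_le Ud.
  move=> /existsNP[i /negP Ui].
  rewrite (@eseries_pinfty _ _ xpredT i) ?leey//.
  + by move=> j _; rewrite -ltNye (lt_le_trans _ (hgauge_le_ge0 _ _ _)).
  + by rewrite /hgauge_le (negbTE Ui).
- apply: le_ereal_inf_tmp => _ [U [AU Ud] <-].
  apply: ereal_inf_lbound; exists U; first by split.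
  by apply: eq_eseriesr => i _; rewrite /hgauge_le Ud.
Qed.

Lemma hausdorff_pre_le k delta A : (0 < delta)%R ->
  hausdorff_pre k delta A <= hausdorff k A.
Proof. by move=> d0; apply: ereal_sup_ubound; exists delta. Qed.

Lemma hausdorff_pre_ge0 k delta A : 0 <= hausdorff_pre k delta A.
Proof. by rewrite hausdorff_preE; apply: mu_ext_ge0 => U; exact: hgauge_le_ge0. Qed.

Lemma hausdorff0 k : hausdorff k (set0 : set 'rV[R]_m) = 0.
Proof.
rewrite /hausdorff; apply/eqP; rewrite eq_le; apply/andP; split.
  apply: ge_ereal_sup => _ [d _ <-].
  rewrite hausdorff_preE mu_ext0//; first exact: hgauge_le0.
  by move=> U; exact: hgauge_le_ge0.
by rewrite (le_trans (hausdorff_pre_ge0 k 1 (set0 : set 'rV[R]_m)))// hausdorff_pre_le.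
Qed.

Lemma hausdorff_ge0 k A : 0 <= hausdorff k A.
Proof. by rewrite (le_trans (hausdorff_pre_ge0 k 1 A))// hausdorff_pre_le. Qed.

Lemma le_hausdorff k : {homo @hausdorff R m k : A B / A `<=` B >-> A <= B}.
Proof.
move=> A B AB; apply: ge_ereal_sup => _ [d d0 <-].
apply: le_trans (hausdorff_pre_le k B d0).
by rewrite !hausdorff_preE; exact: le_mu_ext.
Qed.

Lemma hausdorff_sigma_subadditive k : sigma_subadditive (@hausdorff R m k).
Proof.
move=> F; apply: ge_ereal_sup => _ [d d0 <-].
apply: (@le_trans _ _ (\sum_(i <oo) hausdorff_pre k d (F i))).
  rewrite hausdorff_preE; under eq_eseriesr do rewrite hausdorff_preE.
  by apply: mu_ext_sigma_subadditive => U; exact: hgauge_le_ge0.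
apply: lee_nneseries => i *; first exact: hausdorff_pre_ge0.
exact: hausdorff_pre_le.
Qed.

HB.instance Definition _ k := isOuterMeasure.Build R 'rV[R]_m (@hausdorff R m k)
  (hausdorff0 k) (hausdorff_ge0 k) (@le_hausdorff k)
  (@hausdorff_sigma_subadditive k).

End hausdorff_outer_measure.

(* R^m with the sigma-algebra of Caratheodory measurable sets for H^k *)
Notation hspace R m k := (caratheodory_type (@hausdorff R m k)).

Definition Hmeasure (R : realType) (m k : nat) :
    {measure set (hspace R m k) -> \bar R} :=
  let mu : {outer_measure set 'rV[R]_m -> \bar R} := @hausdorff R m k in
  (mu : set (caratheodory_type mu) -> \bar R).

Section L2.
Context {R : realType} {m : nat}.
Implicit Types (k : nat) (D : set 'rV[R]_m) (f g : 'rV[R]_m -> R).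

Definition l2dot k D f g : R :=
  \int[Hmeasure R m k]_(x in (D : set (hspace R m k))) (f x * g x).

Definition l2norm k D f : R := Num.sqrt (l2dot k D f f).

Definition l2vdot k D {p} (u v : 'rV[R]_m -> 'rV[R]_p) : R :=
  \int[Hmeasure R m k]_(x in (D : set (hspace R m k))) dot (u x) (v x).

Definition l2vnorm k D {p} (u : 'rV[R]_m -> 'rV[R]_p) : R :=
  Num.sqrt (l2vdot k D u u).

Definition in_L2 k D f : Prop :=
  measurable_fun (D : set (hspace R m k)) (f : hspace R m k -> R) /\
  (Hmeasure R m k).-integrable (D : set (hspace R m k))
    (fun x : hspace R m k => (f x ^+ 2)%:E).

End L2.

Section geometry.
Context {R : realType} {n : nat}.
Notation pt := 'rV[R]_n.+1.

Definition frontier (A : set pt) : set pt := closure A `\` A°.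

Definition euclid_bounded (A : set pt) : Prop :=
  exists M : R, forall x, A x -> enorm x <= M.

Definition domain (A : set pt) : Prop := [/\ open A, connected A & A !=set0].

(* Near each boundary point, A is the region above the graph, in some direction
   e, of a Lipschitz function of the component orthogonal to e. *)
Definition lipschitz_boundary (A : set pt) : Prop :=
  forall x, frontier A x -> exists (e : pt) (r L : R) (g : pt -> R),
    [/\ enorm e = 1, 0 < r,
        forall y z, `|g y - g z| <= L * enorm (y - z) &
        forall y, enorm (y - x) < r ->
          (A y <-> g (y - dot y e *: e) < dot y e)].

Fixpoint Ck (k : nat) (U : set pt) (f : pt -> R) : Prop :=
  (forall x, U x -> {for x, continuous f}) /\
  match k with
  | 0 => True
  | j.+1 => forall v : pt,
      (forall x, U x -> derivable f x v) /\ Ck j U (fun x => 'D_v f x)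
  end.

Definition grad (f : pt -> R) (x : pt) : pt :=
  \row_(j < n.+1) 'D_('e_j) f x.

Definition C2_hypersurface (S : set pt) : Prop :=
  forall x, S x -> exists (U : set pt) (phi : pt -> R),
    [/\ open U, U x, Ck 2 U phi, grad phi x != 0 &
        forall y, U y -> (S y <-> phi y = 0)].

(* For A with C^1 boundary near x, the vector nu satisfying this is unique and
   is the outward unit normal: straight segments leaving x are initially inside
   (outside) A when they make an acute angle with - nu (with nu). *)
Definition is_outward_unit_normal (A : set pt) (x nu : pt) : Prop :=
  enorm nu = 1 /\
  forall w : pt,
    (dot w nu < 0 ->
      exists2 e : R, 0 < e & forall t, 0 < t < e -> A (x + t *: w)) /\
    (0 < dot w nu ->
      exists2 e : R, 0 < e & forall t, 0 < t < e -> ~ A (x + t *: w)).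

(* The value is 0 where there is no normal (corners and edges of polytopes). *)
Definition normal (A : set pt) (x : pt) : pt :=
  xget 0 [set nu | is_outward_unit_normal A x nu].

(* v . n on the boundary of A: the trace of v is taken from inside A, along the
   normal direction. *)
Definition normal_trace (A : set pt) (v : pt -> pt) (x : pt) : R :=
  lim (dot (v (x - t *: normal A x)) (normal A x) @[t --> (0 : R)^'+]).

Record fractured_domain (Omega : set pt) (Om : 'I_2 -> set pt) (gam : set pt) :
  Prop := FracturedDomain {
  fd_domain : domain Omega ;
  fd_bounded : euclid_bounded Omega ;
  fd_lipschitz : lipschitz_boundary Omega ;
  fd_subdomain : forall i, domain (Om i) ;
  fd_disjoint : Om 0 `&` Om 1 = set0 ;
  fd_gamma_disjoint : forall i, Om i `&` gam = set0 ;
  fd_union : Omega = Om 0 `|` Om 1 `|` gam ;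
  (* gam is a subset of the open set Omega: points common to the three
     boundaries (the end points or rim of gam) are not part of it *)
  fd_interface : gam = frontier (Om 0) `&` frontier (Om 1) `&` Omega ;
  fd_surface : C2_hypersurface gam ;
  fd_nonempty : gam !=set0 }.

Definition div (u : pt -> pt) (x : pt) : R :=
  \sum_(j < n.+1) ('D_('e_j) u x) 0 j.

(* Orthonormal bases (the rows of Fr x) of the tangent spaces of gam; they
   identify the tangent spaces with R^n, so that K_gamma is an n x n matrix. *)
Definition tangent_frame (Om : 'I_2 -> set pt) (gam : set pt)
    (Fr : pt -> 'M[R]_(n, n.+1)) : Prop :=
  (forall x, gam x -> Fr x *m (Fr x)^T = 1%:M /\
     forall i, Fr x *m (normal (Om i) x)^T = 0) /\
  forall i j, measurable_fun (gam : set (hspace R n.+1 n))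
    (fun x : hspace R n.+1 n => Fr x i j).

Definition tcoord (Fr : pt -> 'M[R]_(n, n.+1)) (v : pt -> pt) (x : pt) :
  'rV[R]_n := v x *m (Fr x)^T.

(* Only the values of u along gam matter at the points near which gam is flat,
   in particular in the interior of the elements of a mesh of gam. *)
Definition tdiv (Fr : pt -> 'M[R]_(n, n.+1)) (u : pt -> pt) (x : pt) : R :=
  \sum_(j < n) dot ('D_(row j (Fr x)) u x) (row j (Fr x)).

Definition test_function (O : set pt) (phi : pt -> R) : Prop :=
  (forall k, Ck k setT phi) /\
  exists C, [/\ compact C, C `<=` O & forall x, ~ C x -> phi x = 0].

(* H(div, D) for D = O open and k the dimension of the space; H(div_tau, D) for
   D a hypersurface that is relatively closed in the open set O, k its dimension,
   and u tangential: the tangential divergence in the sense of distributions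
   is w. *)
Definition in_Hdiv (k : nat) (D O : set pt) (u : pt -> pt) : Prop :=
  (forall j, in_L2 k D (fun x => u x 0 j)) /\
  exists2 w : pt -> R, in_L2 k D w &
    forall phi, test_function O phi ->
      l2vdot k D u (grad phi) = - l2dot k D w phi.

End geometry.

Arguments Ck {R n} k U f : simpl never.

(* The bounds assumed on a conductivity tensor, a.e. on D. *)
Definition conductivity_tensor {R : realType} {m p : nat} (k : nat)
    (D : set 'rV[R]_m) (K : 'rV[R]_m -> 'M[R]_p) (c C : R) : Prop :=
  (forall i j, measurable_fun (D : set (hspace R m k))
     (fun x : hspace R m k => K x i j)) /\
  {ae Hmeasure R m k, forall x, D x ->
     K x \in unitmx /\
     forall z : 'rV[R]_p,
       c * enorm z ^+ 2 <= dot z (mulmv (invmx (K x)) z) /\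
       enorm (mulmv (invmx (K x)) z) <= C * enorm z}.

(* B = A^{-1/2}, the symmetric positive semidefinite square root *)
Definition is_inv_sqrt {R : realType} {p : nat} (A B : 'M[R]_p) : Prop :=
  [/\ B^T = B, forall z, 0 <= dot z (mulmv B z) & B *m B = invmx A].

Section meshes.
Context {R : realType} {n : nat}.
Notation pt := 'rV[R]_n.+1.

Inductive shape := Simplex | Box.

(* A flat k-dimensional element: image, under t |-> origin + t *m edges, of the
   unit simplex or of the unit cube of R^k. *)
Record cell (k : nat) := Cell {
  origin : pt ;
  edges : 'M[R]_(k, n.+1) ;
  cshape : shape }.

Definition cell_wf k (c : cell k) : Prop :=
  row_free (edges c) /\
  (cshape c = Box ->
     forall i j, i != j -> dot (row i (edges c)) (row j (edges c)) = 0).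

Definition param k (c : cell k) (t : 'rV[R]_k) : pt := origin c + t *m edges c.

Definition ref_open k (s : shape) : set 'rV[R]_k :=
  match s with
  | Simplex => [set t | (forall j, 0 < t 0 j) /\ \sum_j t 0 j < 1]
  | Box => [set t | forall j, 0 < t 0 j < 1]
  end.

Definition ref_closed k (s : shape) : set 'rV[R]_k :=
  match s with
  | Simplex => [set t | (forall j, 0 <= t 0 j) /\ \sum_j t 0 j <= 1]
  | Box => [set t | forall j, 0 <= t 0 j <= 1]
  end.

Definition open_cell k (c : cell k) : set pt := param c @` ref_open (cshape c).

Definition closed_cell k (c : cell k) : set pt :=
  param c @` ref_closed (cshape c).

Definition cell_size k (c : cell k) : R := fine (ediam (closed_cell c)).

Definition is_partition k (I : finType) (T : I -> cell k) (D : set pt) : Prop :=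
  [/\ forall i, cell_wf (T i),
      forall i, open_cell (T i) `<=` D,
      forall i j, i != j -> open_cell (T i) `&` open_cell (T j) = set0 &
      D `<=` \bigcup_(i in [set: I]) closed_cell (T i)].

Definition is_face (F P : set pt) : Prop :=
  [/\ F `<=` P,
      forall x y (t : R), 0 <= t <= 1 -> F x -> F y ->
        F (t *: x + (1 - t) *: y) &
      forall x y (t : R), 0 < t < 1 -> P x -> P y ->
        F (t *: x + (1 - t) *: y) -> F x /\ F y].

Definition conforming k (I : finType) (T : I -> cell k) : Prop :=
  forall i j, is_face (closed_cell (T i) `&` closed_cell (T j)) (closed_cell (T i)).

(* The mesh G of gam consists of unions of the faces of T lying on gam. *)
Definition coarsens_trace k l (I J : finType) (T : I -> cell k)
    (G : J -> cell l) (gam : set pt) : Prop :=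
  forall i F, is_face F (closed_cell (T i)) -> F `<=` closure gam ->
    exists j, F `<=` closed_cell (G j).

(* Lowest-order Raviart-Thomas-Nedelec fields on an element, as Piola
   transforms (up to the constant Jacobian factor) of those of the reference
   element: a + b t on the simplex, (a_j + b_j t_j)_j on the cube. *)
Definition rt0_local k (c : cell k) (u : pt -> pt) : Prop :=
  match cshape c with
  | Simplex => exists (a : 'rV[R]_k) (b : R), forall t,
      ref_open Simplex t -> u (param c t) = (a + b *: t) *m edges c
  | Box => exists a b : 'rV[R]_k, forall t,
      ref_open Box t ->
      u (param c t) = (\row_j (a 0 j + b 0 j * t 0 j)) *m edges c
  end.

(* Finite element functions are made canonical representatives of their L^2
   class by taking the value 0 off the (open) elements, a null set. *)
Definition null_off_cells k (I : finType) (T : I -> cell k) {V : nmodType}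
    (f : pt -> V) : Prop :=
  forall x, (forall i, ~ open_cell (T i) x) -> f x = 0.

Definition P0_space k (I : finType) (T : I -> cell k) : set (pt -> R) :=
  [set q | null_off_cells T q /\
    forall i, exists c, forall x, open_cell (T i) x -> q x = c].

Definition RT0_space k (I : finType) (T : I -> cell k) (D O : set pt) :
    set (pt -> pt) :=
  [set u | [/\ null_off_cells T u, forall i, rt0_local (T i) u &
               in_Hdiv k D O u]].

End meshes.

Section forms.
Context {R : realType} {n : nat}.
Notation pt := 'rV[R]_n.+1.
Variables (Om : 'I_2 -> set pt) (gam : set pt).
Variables (K : pt -> 'M[R]_n.+1) (Fr : pt -> 'M[R]_(n, n.+1)).
Variables (Kg Kgmh : pt -> 'M[R]_n) (tau Lg : R).

(* beta is the inverse of the Robin parameter alpha_gamma; beta = 0 gives the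
   form of the case alpha_gamma -> oo. *)
Definition a_bulk (beta : R) (i : 'I_2) (u v : pt -> pt) : R :=
  l2vdot n.+1 (Om i) (fun x => mulmv (invmx (K x)) (u x)) v +
  beta * l2dot n gam (normal_trace (Om i) u) (normal_trace (Om i) v).

Definition b_bulk (i : 'I_2) (u : pt -> pt) (q : pt -> R) : R :=
  l2dot n.+1 (Om i) (div u) q.

Definition c_bulk (i : 'I_2) (p q : pt -> R) : R := l2dot n.+1 (Om i) p q.

Definition a_frac (u v : pt -> pt) : R :=
  l2vdot n gam (fun x => mulmv (invmx (Kg x)) (tcoord Fr u x)) (tcoord Fr v).

Definition b_frac (u : pt -> pt) (mu : pt -> R) : R := l2dot n gam (tdiv Fr u) mu.

Definition A_frac (u : pt -> pt) (lam : pt -> R) (v : pt -> pt) (mu : pt -> R) :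
    R :=
  a_frac u v + Lg * l2vdot n gam u v + tau^-1 * l2dot n gam lam mu
  + b_frac u mu - b_frac v lam.

Definition local_solution (beta : R) (V : 'I_2 -> set (pt -> pt))
    (M : 'I_2 -> set (pt -> R)) (i : 'I_2) (lam : pt -> R)
    (u : pt -> pt) (p : pt -> R) : Prop :=
  [/\ V i u, M i p,
      forall v, V i v ->
        a_bulk beta i u v - b_bulk i v p =
        - l2dot n gam lam (normal_trace (Om i) v) &
      forall q, M i q -> c_bulk i p q + tau * b_bulk i u q = 0].

(* us i lam stands for u*_{h,i}(lam). *)
Definition s_frac (us : 'I_2 -> (pt -> R) -> (pt -> pt)) (lam mu : pt -> R) : R :=
  - \sum_(i < 2) l2dot n gam (normal_trace (Om i) (us i lam)) mu.

Definition s_norm us (mu : pt -> R) : R := Num.sqrt (s_frac us mu mu).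

Definition star_norm us (v : pt -> pt) (mu : pt -> R) : R :=
  Num.sqrt (l2vnorm n gam (fun x => mulmv (Kgmh x) (tcoord Fr v x)) ^+ 2
    + l2vnorm n gam (fun x => Num.sqrt Lg *: v x) ^+ 2
    + l2norm n gam (fun x => Num.sqrt tau * tdiv Fr v x) ^+ 2
    + s_norm us mu ^+ 2
    + l2norm n gam (fun x => (Num.sqrt tau)^-1 * mu x) ^+ 2).

(* supremum, in the extended reals, over the nonzero pairs of Vg x Mg *)
Definition inf_sup_quotient us (Vg : set (pt -> pt)) (Mg : set (pt -> R))
    (u : pt -> pt) (lam : pt -> R) : \bar R :=
  ereal_sup [set ((A_frac u lam w.1 w.2 + s_frac us lam w.2)
                  / star_norm us w.1 w.2)%:E |
             w in [set w | [/\ Vg w.1, Mg w.2 &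
                               ~ (w.1 = cst 0 /\ w.2 = cst 0)]]].

(* q is the L^2(gam)-projection of lam onto the space V i . n_i *)
Definition is_normal_projection (V : 'I_2 -> set (pt -> pt)) (i : 'I_2)
    (lam q : pt -> R) : Prop :=
  (exists2 w, V i w & q = normal_trace (Om i) w) /\
  forall v, V i v -> l2dot n gam q (normal_trace (Om i) v) =
                     l2dot n gam lam (normal_trace (Om i) v).

End forms.

Definition mesh_size {R : realType} {n : nat} (I : 'I_2 -> finType)
    (T : forall i, I i -> @cell R n n.+1) (J : finType) (G : J -> @cell R n n) : R :=
  Num.max (\big[Num.max/0]_(i < 2) \big[Num.max/0]_(c : I i) cell_size (T i c))
          (\big[Num.max/0]_(j : J) cell_size (G j)).

(* Main.v *)
Require Import Defs.
From mathcomp Require Import all_boot all_order all_algebra.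
From mathcomp Require Import all_classical all_reals all_analysis.
From mathcomp Require Import measurable_realfun ring lra.

Set Implicit Arguments.
Unset Strict Implicit.
Unset Printing Implicit Defensive.
Import Order.TTheory GRing.Theory Num.Theory.
Import numFieldNormedType.Exports.

Local Open Scope classical_set_scope.
Local Open Scope ring_scope.


(** The bilinear form is tested with a single pair. Write [|.|] for the L2 norm on
    the fracture and [s] for the interface form, and put [a = tau * c], where [c]
    is a constant such that
      [sum_i |u*_i(lam) . n_i|^2 <= c * s (lam, lam)].
    Taking the solution of a local problem as its own test function gives
      [s (lam, lam) = sum_i ((K^-1 u*_i, u*_i) + beta |u*_i . n_i|^2
                             + tau^-1 |p*_i|^2)],
    so that [c = alpha] will do when [beta = alpha^-1]; when [beta = 0] the
    discrete trace inequality bounds the flux by the first term, with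
    [c = CdTr^2 / (cK h)]. Since [s (lam, mu) = - sum_i (u*_i(lam) . n_i, mu)]
    depends on [lam] through the fluxes only, Cauchy-Schwarz yields
      [s (lam, mu)^2 <= 2 c s (lam, lam) |mu|^2].

    With [v = u] and [mu = lam + delta * tau * div u], where
    [delta = 1 / (2 (1 + a))], the form becomes the sum of the squares of all the
    terms of the norm except the divergence, of [delta * tau |div u|^2], and of
    two cross terms which Young's inequality absorbs; the norm of the test pair is
    bounded by the same inequality. This is [quotient_bound], a statement on real
    numbers, and [inf_sup_bound] deduces the estimate from it.

    For the test pair to be admissible and the integrals to be linear, several
    facts of geometry and of measure theory have to be established.
    - Borel sets are measurable for the Hausdorff measure, by Caratheodory's
      criterion ([closed_caratheodory]); a set with [p] Lipschitz-invertible
      coordinates in a cube has finite Hausdorff measure of dimension [p] and null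
      measure in higher dimension, by counting small cubes
      ([hausdorff_boxes_fin], [hausdorff_boxes_null]). Hence the fracture and the
      boundaries of the subdomains have finite measure, and the boundaries of the
      elements of the fracture are null.
    - The fracture is locally the zero set of a C1 function whose sign tells the
      two subdomains apart, so its normals exist and vary continuously
      ([normal_is_outward], [normal_continuous_on]). By convexity of the elements,
      a discrete field has a limit along every ray, so its normal trace is a
      bounded measurable function ([normal_trace_measurable],
      [normal_trace_bounded]).
    - On a flat element of the fracture the tangent frame spans the directions of
      the edges, and the tangential divergence of a Raviart-Thomas field is the
      trace of its linear part: it is constant ([tdiv_constant]), so that it is
      almost everywhere equal to a piecewise constant multiplier ([tdiv_P0]). *)

(** * Euclidean space *)

(** Cauchy-Schwarz for any positive semidefinite quadratic form: the
    discriminant of [s |-> A s^2 - 2 B s + C] is nonpositive. *)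
Lemma discriminant_le0 (R : realFieldType) (A B C : R) : 0 <= A ->
  (forall s, 0 <= s ^+ 2 * A - 2 * s * B + C) -> B ^+ 2 <= A * C.
Proof.
rewrite le_eqVlt => /predU1P[<-|A0] H.
  rewrite mul0r; have [->|B0] := eqVneq B 0; first by rewrite expr0n.
  have := H ((C + 1) / (2 * B)).
  suff -> : ((C + 1) / (2 * B)) ^+ 2 * 0 - 2 * ((C + 1) / (2 * B)) * B + C = -1.
    lra.
  by field.
have := H (B / A).
have -> : (B / A) ^+ 2 * A - 2 * (B / A) * B + C = C - B ^+ 2 / A.
  by field; rewrite gt_eqF.
by rewrite subr_ge0 ler_pdivrMr// mulrC.
Qed.

Section euclid.
Context {R : realType} {m : nat}.
Implicit Types (x y z : 'rV[R]_m) (a : R).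

Lemma dotC x y : dot x y = dot y x.
Proof. by apply: eq_bigr => i _; rewrite mulrC. Qed.

Lemma dotDl x y z : dot (x + y) z = dot x z + dot y z.
Proof. by rewrite /dot -big_split; apply: eq_bigr => i _; rewrite mxE mulrDl. Qed.

Lemma dotZl a x y : dot (a *: x) y = a * dot x y.
Proof. by rewrite /dot mulr_sumr; apply: eq_bigr => i _; rewrite mxE mulrA. Qed.

Lemma dotNl x y : dot (- x) y = - dot x y.
Proof. by rewrite -scaleN1r dotZl mulN1r. Qed.

Lemma dotDr x y z : dot x (y + z) = dot x y + dot x z.
Proof. by rewrite dotC dotDl !(dotC _ x). Qed.

Lemma dotZr a x y : dot x (a *: y) = a * dot x y.
Proof. by rewrite dotC dotZl dotC. Qed.

Lemma dotNr x y : dot x (- y) = - dot x y.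
Proof. by rewrite dotC dotNl dotC. Qed.

Lemma dot0l y : dot 0 y = 0.
Proof. by rewrite -(scale0r 0) dotZl mul0r. Qed.

Lemma dot_ge0 x : 0 <= dot x x.
Proof. by apply: sumr_ge0 => i _; rewrite -expr2 sqr_ge0. Qed.

Lemma dotE x y : dot x y = (x *m y^T) 0 0.
Proof. by rewrite mxE; apply: eq_bigr => i _; rewrite mxE. Qed.

Lemma dot_eq0 x : (dot x x == 0) = (x == 0).
Proof.
apply/eqP/eqP => [/eqP|->]; last by rewrite dot0l.
rewrite psumr_eq0 => [/allP h|i _]; last by rewrite -expr2 sqr_ge0.
apply/rowP => i; rewrite mxE; apply/eqP.
by have := h i (mem_index_enum _); rewrite mulf_eq0 orbb.
Qed.

Lemma enorm_ge0 x : 0 <= enorm x. Proof. exact: sqrtr_ge0. Qed.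

Lemma enorm_sqr x : enorm x ^+ 2 = dot x x.
Proof. by rewrite sqr_sqrtr// dot_ge0. Qed.

Lemma enorm_eq0 x : (enorm x == 0) = (x == 0).
Proof. by rewrite -dot_eq0 -enorm_sqr sqrf_eq0. Qed.

Lemma enorm0 : enorm (0 : 'rV[R]_m) = 0.
Proof. by apply/eqP; rewrite enorm_eq0. Qed.

Lemma enormZ a x : enorm (a *: x) = `|a| * enorm x.
Proof. by rewrite /enorm dotZl dotZr mulrA -expr2 sqrtrM ?sqr_ge0// sqrtr_sqr. Qed.

Lemma enormN x : enorm (- x) = enorm x.
Proof. by rewrite -scaleN1r enormZ normrN1 mul1r. Qed.

Lemma dot_le x y : `|dot x y| <= enorm x * enorm y.
Proof.
rewrite -(@ler_pXn2r _ 2)// ?nnegrE ?mulr_ge0 ?enorm_ge0//.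
rewrite real_normK ?num_real// exprMn !enorm_sqr.
apply: discriminant_le0; first exact: dot_ge0.
move=> s; have := dot_ge0 (s *: x - y).
by rewrite !(dotDl, dotDr, dotNl, dotNr, dotZl, dotZr) (dotC y x); lra.
Qed.

Lemma enormD x y : enorm (x + y) <= enorm x + enorm y.
Proof.
rewrite -(@ler_pXn2r _ 2)// ?nnegrE ?addr_ge0 ?enorm_ge0//.
rewrite enorm_sqr sqrrD !enorm_sqr !(dotDl, dotDr) (dotC y x).
by have := le_trans (ler_norm _) (dot_le x y); lra.
Qed.

Lemma enorm_triangle z x y : enorm (x - y) <= enorm (x - z) + enorm (z - y).
Proof. by rewrite -[x - y](subrKA z) enormD. Qed.

Lemma coord_le_enorm x i : `|x 0 i| <= enorm x.
Proof.
rewrite -(@ler_pXn2r _ 2)// ?nnegrE ?enorm_ge0// enorm_sqr real_normK ?num_real//.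
rewrite /dot (bigD1 i)//= -expr2 lerDl.
by apply: sumr_ge0 => j _; rewrite -expr2 sqr_ge0.
Qed.

Lemma normr_le_enorm x : `|x| <= enorm x.
Proof.
rewrite [leLHS]/Num.norm /= mx_normrE; apply/bigmax_leP; split.
  exact: enorm_ge0.
by case=> i j _ /=; rewrite ord1 coord_le_enorm.
Qed.

Lemma enorm_le_sum x : enorm x <= \sum_i `|x 0 i|.
Proof.
have s0 : 0 <= \sum_i `|x 0 i| by apply: sumr_ge0.
rewrite -(@ler_pXn2r _ 2)// ?nnegrE ?enorm_ge0// enorm_sqr /dot expr2 mulr_suml.
apply: ler_sum => i _; rewrite (le_trans (ler_norm _))// normrM ler_wpM2l//.
by rewrite (bigD1 i)//= lerDl sumr_ge0.
Qed.

Lemma enorm_le_normr x : enorm x <= m%:R * `|x|.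
Proof.
apply: le_trans (enorm_le_sum x) _.
apply: (@le_trans _ _ (\sum_(i < m) `|x|)).
  apply: ler_sum => i _; rewrite [leRHS]/Num.norm /= mx_normrE.
  by apply/bigmax_geP; right; exists (0, i).
by rewrite sumr_const card_ord mulr_natl.
Qed.

End euclid.

(** * Hausdorff measures *)

(** ** Borel sets are measurable *)

Section metric_outer_measure.
Context {R : realType} {m : nat}.
Local Open Scope ereal_scope.
Variable mu : {outer_measure set 'rV[R]_m -> \bar R}.
Hypothesis mu_separated : forall (A B : set 'rV[R]_m) (e : R), (0 < e)%R ->
  (forall x y, A x -> B y -> (e <= enorm (x - y))%R) ->
  mu A + mu B <= mu (A `|` B).

(** Caratheodory's criterion. The points of [X] outside a closed set [F] are
    exhausted by the sets [A j] of points at distance at least [1 / (j + 1)] of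
    [F], for which additivity is the hypothesis. The layers [A j.+1 `\` A j] of
    equal parity are separated from one another, so their measures are summable
    and [A j] carries almost all of [X `\` F]. *)
Lemma closed_caratheodory (F : set 'rV[R]_m) : closed F -> mu.-caratheodory F.
Proof.
move=> cF; apply: le_caratheodory_measurable => X.
have [Xoo|] := ltP (mu X) +oo; last by rewrite leye_eq => /eqP ->; rewrite leey.
pose A j := [set x | X x /\ forall y, F y -> (j.+1%:R^-1 <= enorm (x - y))%R].
pose L j := A j.+1 `\` A j.
have AX j : A j `<=` X by move=> x [].
have subA i j : (i <= j)%N -> A i `<=` A j.
  move=> ij x [Xx Fx]; split=> // y Fy; apply: le_trans (Fx _ Fy).
  by rewrite lef_pV2 ?posrE// ler_nat.
have sepA j (B C : set 'rV[R]_m) : B `<=` A j -> C `&` A j.+1 = set0 ->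
    C `<=` X -> mu B + mu C <= mu (B `|` C).
  move=> BA CA CX; apply: (@mu_separated _ _ (j.+1%:R^-1 - j.+2%:R^-1)%R).
    by rewrite subr_gt0 ltf_pV2 ?posrE// ltr_nat.
  move=> x y /BA [_ Fx] Cy.
  have : ~ A j.+1 y by move=> Ay; have : (C `&` A j.+1) y by []; rewrite CA.
  move=> /not_andP[/(_ (CX _ Cy))//|/existsNP[z /not_implyP[Fz]]].
  move=> /negP; rewrite -ltNge => yz.
  move: (enorm_triangle y x z) (Fx z Fz) yz.
  move: (j.+1%:R^-1)%R (j.+2%:R^-1)%R => a b; lra.
have subLA j : L j `<=` A j.+1 by move=> x [].
have disjLA j : L j `&` A j = set0 by rewrite -subset0 => x [[]].
pose G p n := \big[setU/set0]_(i < n) L (i.*2 + p)%N.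
have GA p n : G p n.+1 `<=` A (n.*2 + p).+1.
  elim: n => [|n IH]; rewrite /G big_ord_recr/=.
    by rewrite big_ord0 set0U; exact: subLA.
  rewrite subUset; split; last exact: subLA.
  by apply: subset_trans IH _; apply: subA; rewrite doubleS !addSn ltnW// ltnS ltnW.
have sumG p n : \sum_(i < n) mu (L (i.*2 + p)%N) <= mu (G p n).
  elim: n => [|n IH]; first by rewrite /G !big_ord0 outer_measure0.
  rewrite big_ord_recr/= /G [in leRHS]big_ord_recr/= -/(G p n).
  apply: le_trans (leeD2r _ IH) _.
  case: n {IH} => [|n].
    by rewrite /G big_ord0 outer_measure0 add0e set0U.
  apply: (sepA (n.*2 + p).+1); first exact: GA.
    by rewrite doubleS !addSn; exact: disjLA.
  by apply: subset_trans (@AX _); exact: subLA.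
have GX p n : mu (G p n) <= mu X.
  apply: le_outer_measure; case: n => [|n]; first by rewrite /G big_ord0.
  by apply: subset_trans (@AX _); exact: GA.
have Lfin : \sum_(0 <= i <oo) mu (L i) < +oo.
  apply: (@le_lt_trans _ _ (mu X + mu X)); last by rewrite lte_add_pinfty.
  apply: lime_le; first by apply: is_cvg_nneseries => ? _ _; exact: outer_measure_ge0.
  apply: nearW => n; apply: (@le_trans _ _ (\sum_(0 <= i < n.*2) mu (L i))).
    apply: lee_sum_nneg_natr => [? _ _|]; last by rewrite -addnn leq_addr.
    exact: outer_measure_ge0.
  have -> : \sum_(0 <= i < n.*2) mu (L i) =
      \sum_(i < n) mu (L (i.*2 + 0)%N) + \sum_(i < n) mu (L (i.*2 + 1)%N).
    rewrite big_mkord -big_split/=; elim: n => [|n IH]; first by rewrite !big_ord0.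
    rewrite doubleS 2!big_ord_recr IH [RHS]big_ord_recr/= addn0 addn1.
    by rewrite addeA.
  by apply: leeD; exact: le_trans (sumG _ _) (GX _ _).
have tail0 : \sum_(N <= i <oo) mu (L i) @[N --> \oo] --> 0.
  by apply: nneseries_tail_cvg => // *; exact: outer_measure_ge0.
have cover j : X `&` ~` F `<=` A j `|` \bigcup_(n in ~` `I_j) L n.
  move=> x [Xx nFx].
  have [k Ak] : exists k, A k x.
    have /nbhs_ballP[r /= r0 rF] : nbhs x (~` F).
      by apply: open_nbhs_nbhs; split=> //; exact: closed_openC.
    exists (Num.truncn r^-1); split=> // y Fy; rewrite leNgt; apply/negP => xy.
    apply: (rF y) => //; rewrite -ball_normE/=.
    apply: le_lt_trans (normr_le_enorm _) (lt_le_trans xy _).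
    rewrite -[leRHS]invrK lef_pV2 ?posrE ?invr_gt0// ltW// truncnS_gt//.
  have [|jk] := leqP k j; first by move=> /subA/(_ _ Ak); left.
  have : exists i, `[< A i x >] by exists k; apply/asboolP.
  move=> /ex_minnP[i /asboolP Ai imin].
  have [/subA/(_ _ Ai)|ji] := leqP i j; first by left.
  case: i => // i in Ai imin ji *; right; exists i => /=.
    by apply/negP; rewrite -leqNgt.
  split=> // Aix; have : (i.+1 <= i)%N by apply: imin; apply/asboolP.
  by rewrite ltnn.
have main j : mu (X `&` F) + mu (X `&` ~` F) <=
    mu X + \sum_(j <= i <oo) mu (L i).
  have h1 : mu (X `&` ~` F) <= mu (A j) + \sum_(j <= i <oo) mu (L i).
    apply: le_trans (le_outer_measure mu _ _ (cover j)) _.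
    apply: le_trans (outer_measureU2 _ _ _) _; apply: leeD2l.
    exact: outer_measure_sigma_subadditive_tail.
  apply: le_trans (leeD2l _ h1) _; rewrite addeA; apply: leeD2r.
  rewrite addeC; apply: le_trans (sepA j _ _ _ _ _) _ => //.
  - rewrite -subset0 => x [[Xx Fx] [_ /(_ x Fx)]].
    by rewrite subrr enorm0 leNgt invr_gt0 ltr0Sn.
  - by apply: le_outer_measure; rewrite subUset; split=> [|x []//]; exact: AX.
have cvgX : mu X + \sum_(j <= i <oo) mu (L i) @[j --> \oo] --> mu X.
  rewrite -[X in _ --> X]adde0; apply: cvgeD => //; last exact: cvg_cst.
  by rewrite fin_num_adde_defl.
by apply: cvge_ge cvgX; apply: nearW => j; exact: main.
Qed.

End metric_outer_measure.

Lemma ler_dist_itv (R : realDomainType) (a b x y : R) :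
  a <= x <= a + b -> a <= y <= a + b -> `|x - y| <= b.
Proof. by rewrite ler_norml => /andP[? ?] /andP[? ?]; apply/andP; split; lra. Qed.

Section hausdorff_measurable.
Context {R : realType} {m : nat}.
Local Open Scope ereal_scope.
Implicit Types (A B U : set 'rV[R]_m) (k : nat) (delta : R).

Lemma ediam_le A B : A `<=` B -> ediam A <= ediam B.
Proof.
move=> AB; apply: ge_ereal_sup => _ [[x y] [/= Ax Ay] <-].
by apply: ereal_sup_ubound; exists (x, y) => //; split; exact: AB.
Qed.

Lemma lee_expe2 (x y : \bar R) k : 0 <= x -> x <= y -> x ^+ k <= y ^+ k.
Proof.
move=> x0 xy; elim: k => [|k IH]; first by rewrite !expe0.
by rewrite !expeS; apply: lee_pmul => //; exact: expe_ge0.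
Qed.

Lemma hgauge_set0 k : hgauge k (set0 : set 'rV[R]_m) = 0.
Proof. by rewrite /hgauge asboolT. Qed.

Lemma le_hgauge k A B : A `<=` B -> hgauge k A <= hgauge k B.
Proof.
move=> AB; have [->|A0] := eqVneq A set0; first by rewrite hgauge_set0 hgauge_ge0.
rewrite /hgauge !asboolF; last 2 first.
- by move=> B0; move/eqP: A0; apply; rewrite -subset0 -B0.
- exact/eqP.
apply: lee_wpmul2l; first by rewrite lee_fin divr_ge0 ?unit_ball_volume_ge0.
apply: lee_expe2; last exact: ediam_le.
by apply: ediam_ge0; exact/set0P.
Qed.

Lemma hgauge_le_ediam k A (r : R) : (0 <= r)%R -> ediam A <= r%:E ->
  hgauge k A <= (unit_ball_volume R k / 2 ^+ k * r ^+ k)%:E.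
Proof.
move=> r0 Ar; rewrite /hgauge; case: asboolP => [_|/eqP/set0P A0].
  by rewrite lee_fin mulr_ge0 ?exprn_ge0// divr_ge0 ?unit_ball_volume_ge0.
rewrite [leRHS]EFinM; apply: lee_wpmul2l.
  by rewrite lee_fin divr_ge0 ?unit_ball_volume_ge0.
by rewrite EFin_expe; apply: lee_expe2 => //; exact: ediam_ge0.
Qed.

(** A set of diameter smaller than the distance of [A] to [B] meets only one of
    them, so that a cover by small sets splits into a cover of each. *)
Lemma hausdorff_separated k A B (e : R) : (0 < e)%R ->
  (forall x y, A x -> B y -> (e <= enorm (x - y))%R) ->
  hausdorff k A + hausdorff k B <= hausdorff k (A `|` B).
Proof.
move=> e0 ABe.
have pre_le delta : (delta < e)%R ->
    hausdorff_pre k delta A + hausdorff_pre k delta B <= hausdorff_pre k delta (A `|` B).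
  move=> de; apply: le_ereal_inf_tmp => _ [U [ABU Ud] <-].
  have pre_cover C : C `<=` A `|` B ->
      hausdorff_pre k delta C <= \sum_(i <oo) hgauge k (U i `&` C).
    move=> CAB; apply: ereal_inf_lbound; exists (fun i => U i `&` C) => //; split.
      by move=> x Cx; have [i _ Ui] := ABU _ (CAB _ Cx); exists i.
    by move=> i; apply: le_trans (Ud i); exact: ediam_le.
  apply: le_trans (leeD (pre_cover A _) (pre_cover B _)) _; [by left|by right|].
  rewrite -nneseriesD//; [|by move=> *; exact: hgauge_ge0..].
  apply: lee_nneseries => i _ *; first by rewrite adde_ge0// hgauge_ge0.
  have [->|/set0P[x [Ux Ax]]] := eqVneq (U i `&` A) set0.
    by rewrite hgauge_set0 add0e le_hgauge.
  have [->|/set0P[y [Uy By]]] := eqVneq (U i `&` B) set0.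
    by rewrite hgauge_set0 adde0 le_hgauge.
  have : (enorm (x - y))%:E <= delta%:E.
    by apply: le_trans (Ud i); apply: ereal_sup_ubound; exists (x, y).
  by rewrite lee_fin => /le_lt_trans/(_ de); rewrite ltNge ABe.
have pre_anti delta delta' (C : set 'rV[R]_m) : (delta <= delta')%R ->
    hausdorff_pre k delta' C <= hausdorff_pre k delta C.
  move=> dd; apply: le_ereal_inf_tmp => _ [U [CU Ud] <-].
  by apply: ereal_inf_lbound; exists U => //; split=> // i; rewrite (le_trans (Ud i)).
have pre2 d1 d2 : (0 < d1)%R -> (0 < d2)%R ->
    hausdorff_pre k d1 A + hausdorff_pre k d2 B <= hausdorff k (A `|` B).
  move=> d10 d20; pose d : R := Num.min (e / 2)%R (Num.min d1 d2).
  have d0 : (0 < d)%R by rewrite !lt_min d10 d20 divr_gt0.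
  apply: le_trans (hausdorff_pre_le _ _ d0).
  apply: le_trans (pre_le d _); last first.
    by rewrite /d gt_min; apply/orP; left; lra.
  by apply: leeD; apply: pre_anti; rewrite !ge_min lexx ?orbT.
have [|] := ltP (hausdorff k (A `|` B)) +oo; last first.
  by rewrite leye_eq => /eqP ->; rewrite leey.
move=> ABoo.
have fin C : C `<=` A `|` B -> hausdorff k C \is a fin_num.
  by move=> CAB; rewrite ge0_fin_numE ?hausdorff_ge0// (le_lt_trans (le_hausdorff k CAB)).
have finA := fin A (@subsetUl _ _ _); have finB := fin B (@subsetUr _ _ _).
rewrite -leeBrDr//; apply: ge_ereal_sup => _ [d1 d10 <-].
rewrite leeBrDr// addeC.
have finp : hausdorff_pre k d1 A \is a fin_num.
  rewrite ge0_fin_numE ?hausdorff_pre_ge0//.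
  by rewrite (le_lt_trans (hausdorff_pre_le _ _ d10))// ltey_eq finA.
rewrite -leeBrDr//; apply: ge_ereal_sup => _ [d2 d20 <-].
by rewrite leeBrDr// addeC; exact: pre2.
Qed.

Lemma closed_hmeasurable k A : closed A -> measurable (A : set (hspace R m k)).
Proof.
by move=> cA; apply: closed_caratheodory => // B C e e0; exact: hausdorff_separated.
Qed.

Lemma open_hmeasurable k A : open A -> measurable (A : set (hspace R m k)).
Proof.
move=> oA; rewrite -(setCK A); apply: measurableC; apply: closed_hmeasurable.
exact: open_closedC.
Qed.

Lemma null_hmeasurable k A : hausdorff k A = 0 -> measurable (A : set (hspace R m k)).
Proof.
move=> A0; apply: le_caratheodory_measurable => X.
rewrite [X in X + _](_ : _ = 0) ?add0e.
  by apply: le_outer_measure => x [].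
apply/eqP; rewrite eq_le outer_measure_ge0 andbT -[leRHS]A0.
by apply: le_outer_measure => x [].
Qed.

(** ** Covers by small boxes *)

Lemma hausdorff_pre_fin_cover k delta (J : finType) (U : J -> set 'rV[R]_m) A (c : R) :
  A `<=` \bigcup_(j in [set: J]) U j ->
  (forall j, ediam (U j) <= delta%:E) ->
  (forall j, hgauge k (U j) <= c%:E) ->
  hausdorff_pre k delta A <= (#|J|%:R * c)%:E.
Proof.
move=> AU Ud Uc; pose s := [seq U j | j <- enum J].
pose F n := nth set0 s n.
have sizes : size s = #|J| by rewrite size_map cardE.
have FU n : (n < #|J|)%N -> exists j, F n = U j.
  move=> nJ; have : F n \in s by apply: mem_nth; rewrite sizes.
  by move=> /mapP[j _ ->]; exists j.
apply: (@le_trans _ _ (\sum_(n <oo) hgauge k (F n))).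
  apply: ereal_inf_lbound; exists F => //; split.
    move=> x /AU[j _ Ux]; exists (enum_rank j) => //; rewrite /F.
    by rewrite (nth_map j) ?nth_enum_rank// -cardE ltn_ord.
  move=> n; have [/FU[j ->]//|Jn] := ltnP n #|J|.
  by rewrite /F nth_default ?sizes// /ediam set0X image_set0 ereal_sup0 leNye.
rewrite (nneseries_split _ #|J|); last by move=> *; exact: hgauge_ge0.
rewrite add0n [X in _ + X]eseries0 ?adde0; last first.
  by move=> n Jn _; rewrite /F nth_default ?sizes// hgauge_set0.
rewrite big_mkord mulr_natl -[X in (_ *+ X)%:E]card_ord -sumr_const -sumEFin.
by apply: lee_sum => n _; have [j ->] := FU _ (ltn_ord n).
Qed.

Section boxes.
Variables (I : finType) (A : set 'rV[R]_m) (c : 'rV[R]_m -> I -> R) (L : R).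
Hypothesis L0 : (0 <= L)%R.
Hypothesis c01 : forall x i, A x -> (0 <= c x i <= 1)%R.
Hypothesis cL : forall x y, A x -> A y ->
  (enorm (x - y) <= L * \sum_i `|c x i - c y i|)%R.

(** [A] carries Lipschitz-invertible coordinates in a cube of dimension [#|I|],
    which is divided into [N.+1 ^ #|I|] cubes. *)
Lemma hausdorff_pre_boxes k delta N : (L * #|I|%:R / N.+1%:R <= delta)%R ->
  hausdorff_pre k delta A <= ((N.+1 ^ #|I|)%:R *
    (unit_ball_volume R k / 2 ^+ k * (L * #|I|%:R / N.+1%:R) ^+ k))%:E.
Proof.
move=> Nd.
pose U (f : {ffun I -> 'I_N.+1}) := [set x | A x /\ forall i,
  ((f i)%:R / N.+1%:R <= c x i <= (f i).+1%:R / N.+1%:R)%R].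
have N0 : (0 < N.+1%:R :> R)%R by [].
have dU f : ediam (U f) <= (L * #|I|%:R / N.+1%:R)%:E.
  apply: ge_ereal_sup => _ [[x y] [/= [Ax Ux] [Ay Uy]] <-].
  rewrite lee_fin (le_trans (cL Ax Ay))// -mulrA ler_wpM2l//.
  have -> : (#|I|%:R / N.+1%:R = \sum_(i : I) N.+1%:R^-1 :> R)%R.
    by rewrite sumr_const mulr_natl.
  apply: ler_sum => i _; move: (Ux i) (Uy i).
  by rewrite -[(f i).+1%:R]natr1 mulrDl mul1r; exact: ler_dist_itv.
have cardF : (N.+1 ^ #|I|)%N = #|{ffun I -> 'I_N.+1}| by rewrite card_ffun card_ord.
rewrite cardF; apply: (@hausdorff_pre_fin_cover _ _ _ U).
- move=> x Ax; exists [ffun i => inord (minn (Num.truncn (c x i * N.+1%:R)) N)] => //.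
  split=> // i; rewrite ffunE inordK ?ltnS ?geq_minr//.
  have /andP[c0 c1] := c01 i Ax.
  have cN0 : (0 <= c x i * N.+1%:R)%R by rewrite mulr_ge0.
  rewrite ler_pdivrMr// ler_pdivlMr//; apply/andP; split.
    apply: le_trans (_ : (Num.truncn (c x i * N.+1%:R))%:R <= _)%R.
      by rewrite ler_nat geq_minl.
    by rewrite truncn_le.
  have [tN|Nt] := leqP (Num.truncn (c x i * N.+1%:R)) N.
    by rewrite ltW// truncnS_gt.
  by rewrite -[leRHS]mul1r ler_wpM2r.
- by move=> f; apply: le_trans (dU f) _; rewrite lee_fin.
- move=> f; apply: hgauge_le_ediam; last exact: dU.
  by apply: mulr_ge0; [exact: mulr_ge0|rewrite invr_ge0].
Qed.

Let M k : R := (unit_ball_volume R k / 2 ^+ k * (L * #|I|%:R) ^+ k)%R.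

Let M_ge0 k : (0 <= M k)%R.
Proof.
apply: mulr_ge0; last by rewrite exprn_ge0// mulr_ge0.
by rewrite divr_ge0 ?unit_ball_volume_ge0.
Qed.

Let small (e : R) : (0 < e)%R -> forall C : R, (0 <= C)%R ->
  exists N, forall N', (N <= N')%N -> (C / N'.+1%:R <= e)%R.
Proof.
move=> e0 C C0; exists (Num.truncn (C / e)) => N' NN'.
rewrite ler_pdivrMr// mulrC -ler_pdivrMr// ltW// (lt_le_trans (truncnS_gt _))//.
by rewrite ler_nat ltnS.
Qed.

Let boxesE k N : (#|I| <= k)%N ->
  ((N.+1 ^ #|I|)%:R * (unit_ball_volume R k / 2 ^+ k * (L * #|I|%:R / N.+1%:R) ^+ k) =
   M k / N.+1%:R ^+ (k - #|I|))%R.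
Proof.
move=> Ik; rewrite /M expr_div_n natrX.
have -> : (N.+1%:R ^+ k = N.+1%:R ^+ (k - #|I|) * N.+1%:R ^+ #|I| :> R)%R.
  by rewrite -exprD subnK.
have aux (a b x y : R) : (a != 0)%R -> (b != 0)%R ->
    (b * (x * (y / (a * b))) = x * y / a)%R.
  by move=> a0 b0; field; rewrite a0 b0.
by apply: aux; rewrite expf_neq0// pnatr_eq0.
Qed.

Lemma hausdorff_boxes_fin k : (#|I| <= k)%N -> hausdorff k A < +oo.
Proof.
move=> Ik; apply: (@le_lt_trans _ _ (M k)%:E); last exact: ltry.
apply: ge_ereal_sup => _ [delta d0 <-].
have [N /(_ N (leqnn _)) NP] := small d0 (mulr_ge0 L0 (ler0n R #|I|)).
apply: le_trans (hausdorff_pre_boxes k NP) _; rewrite lee_fin boxesE//.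
by rewrite ler_piMr// invf_le1 ?exprn_gt0// exprn_ege1// ler1n.
Qed.

Lemma hausdorff_boxes_null k : (#|I| < k)%N -> hausdorff k A = 0.
Proof.
move=> Ik; apply/eqP; rewrite eq_le hausdorff_ge0 andbT.
apply: ge_ereal_sup => _ [delta d0 <-]; apply/lee_addgt0Pr => e e0; rewrite add0e.
have [N NP] := small d0 (mulr_ge0 L0 (ler0n R #|I|)).
have [N' NP'] := small e0 (M_ge0 k).
pose K := maxn N N'.
apply: le_trans (hausdorff_pre_boxes k (NP K (leq_maxl _ _))) _.
rewrite lee_fin boxesE ?(ltnW Ik)// (le_trans _ (NP' K (leq_maxr _ _)))//.
rewrite ler_wpM2l// lef_pV2 ?posrE ?exprn_gt0//.
by rewrite -[leLHS]expr1 ler_weXn2l ?ler1n// subn_gt0.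
Qed.

End boxes.
End hausdorff_measurable.

(** * Almost everywhere comparison of integrals *)

Section ae_monotone.
Context d (T : measurableType d) (R : realType).
Variable mu : {measure set T -> \bar R}.
Local Open Scope ereal_scope.
Import HBNNSimple.

(** The integral is a difference of suprema of integrals of simple functions,
    and a simple function may be set to zero on a null set. An inequality almost
    everywhere between arbitrary functions therefore passes to the suprema. *)
Lemma ge0_ae_le_integral (D : set T) (f g : T -> \bar R) :
  (forall x, 0 <= f x) -> (forall x, 0 <= g x) ->
  {ae mu, forall x, D x -> f x <= g x} ->
  \int[mu]_(x in D) f x <= \int[mu]_(x in D) g x.
Proof.
move=> f0 g0 [N [mN N0 fgN]]; rewrite integral_mkcond [leRHS]integral_mkcond.
have fg x : ~ N x -> (f \_ D) x <= (g \_ D) x.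
  move=> nN; rewrite !patchE; case: ifPn => // /set_mem Dx.
  have : ~ ~ (D x -> f x <= g x) by move=> /fgN.
  by move=> /contrapT/(_ Dx).
rewrite ge0_integralTE; last by move=> x; exact: erestrict_ge0.
rewrite ge0_integralTE; last by move=> x; exact: erestrict_ge0.
apply: ge_ereal_sup => _ [h hf <-].
pose h' := mul_nnsfun h (indic_nnsfun R (measurableC mN)).
have -> : sintegral mu h = sintegral mu h'.
  rewrite -!integralT_nnsfun; apply: ge0_ae_eq_integral => //.
  - by apply/measurable_EFinP; exact: measurable_funTS.
  - by apply/measurable_EFinP; exact: measurable_funTS.
  - by move=> x _; rewrite lee_fin.
  - by move=> x _; rewrite lee_fin.
  exists N; split=> // x /=; apply: contra_notP => nN _.
  by rewrite mindicE mem_set// mulr1.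
apply: ereal_sup_ubound; exists h' => // x.
rewrite /= mindicE; have [Nx|nNx] := pselect (N x).
  by rewrite memNset ?mulr0//; exact: erestrict_ge0.
by rewrite mem_set// mulr1; exact: le_trans (hf x) (fg x nNx).
Qed.

(** The negative parts compare the other way round. *)
Lemma ae_le_integral (D : set T) (f g : T -> \bar R) :
  {ae mu, forall x, D x -> f x <= g x} ->
  \int[mu]_(x in D) f x <= \int[mu]_(x in D) g x.
Proof.
move=> [N [mN N0 fgN]]; rewrite integralE [leRHS]integralE.
apply: leeB; apply: ge0_ae_le_integral.
- by move=> x; exact: funepos_ge0.
- by move=> x; exact: funepos_ge0.
- exists N; split=> // x h; apply: fgN; apply: contra_not h => fgx /fgx {}fgx.
  by rewrite !funeposE ge_max !le_max fgx lexx orbT.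
- by move=> x; exact: funeneg_ge0.
- by move=> x; exact: funeneg_ge0.
- exists N; split=> // x h; apply: fgN; apply: contra_not h => fgx /fgx {}fgx.
  by rewrite !funenegE ge_max !le_max leeN2 fgx lexx orbT.
Qed.

Lemma ae_eq_Rintegral (D : set T) (f g : T -> R) :
  {ae mu, forall x, D x -> f x = g x} ->
  (\int[mu]_(x in D) f x = \int[mu]_(x in D) g x)%R.
Proof.
move=> [N [mN N0 fgN]]; rewrite /Rintegral; congr fine; apply/eqP; rewrite eq_le.
apply/andP; split; apply: ae_le_integral; exists N; split=> // x h; apply: fgN;
  by apply: contra_not h => fgx Dx; rewrite fgx.
Qed.

Lemma ae_le_Rintegral (D : set T) (f g : T -> R) :
  \int[mu]_(x in D) (f x)%:E \is a fin_num ->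
  \int[mu]_(x in D) (g x)%:E \is a fin_num ->
  {ae mu, forall x, D x -> (f x <= g x)%R} ->
  (\int[mu]_(x in D) f x <= \int[mu]_(x in D) g x)%R.
Proof. by move=> ? ? fg; apply: fine_le => //; exact: ae_le_integral. Qed.

Lemma ge0_subset_Rintegral (D E : set T) (f : T -> R) : D `<=` E ->
  (forall x, (0 <= f x)%R) -> \int[mu]_(x in E) (f x)%:E < +oo ->
  (\int[mu]_(x in D) f x <= \int[mu]_(x in E) f x)%R.
Proof.
move=> DE f0 Efin.
have le : \int[mu]_(x in D) (f x)%:E <= \int[mu]_(x in E) (f x)%:E.
  rewrite integral_mkcond [leRHS]integral_mkcond; apply: ae_le_integral.
  apply: aeW => x _; rewrite !patchE.
  case: ifPn => [/set_mem/DE/mem_set ->//|_]; case: ifP => // _.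
  by rewrite lee_fin.
apply: fine_le => //; rewrite ge0_fin_numE//; first 2 last.
- by apply: integral_ge0 => *; rewrite lee_fin.
- exact: le_lt_trans le Efin.
- by apply: integral_ge0 => *; rewrite lee_fin.
Qed.

End ae_monotone.

(** * Square integrals over a set of finite Hausdorff measure *)

Section bounded_measurable.
Context {R : realType} {m k : nat} (D : set 'rV[R]_m).
Hypothesis mD : measurable (D : set (hspace R m k)).
Hypothesis Dfin : (hausdorff k D < +oo)%E.
Implicit Types f g h : 'rV[R]_m -> R.

Definition bounded_measurable f :=
  measurable_fun (D : set (hspace R m k)) (f : hspace R m k -> R) /\
  exists M, forall x, D x -> `|f x| <= M.

Lemma bounded_measurableD f g : bounded_measurable f -> bounded_measurable g ->
  bounded_measurable (fun x => f x + g x).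
Proof.
move=> [mf [Mf fM]] [mg [Mg gM]]; split; first exact: measurable_funD.
exists (Mf + Mg) => x Dx.
by rewrite (le_trans (ler_normD _ _))// lerD ?fM ?gM.
Qed.

Lemma bounded_measurableM f g : bounded_measurable f -> bounded_measurable g ->
  bounded_measurable (fun x => f x * g x).
Proof.
move=> [mf [Mf fM]] [mg [Mg gM]]; split; first exact: measurable_funM.
by exists (Mf * Mg) => x Dx; rewrite normrM ler_pM ?fM ?gM.
Qed.

Lemma bounded_measurable_cst c : bounded_measurable (fun=> c).
Proof. by split; [exact: measurable_cst|exists `|c|]. Qed.

Lemma bounded_measurableZ c f : bounded_measurable f ->
  bounded_measurable (fun x => c * f x).
Proof. by apply: bounded_measurableM; exact: bounded_measurable_cst. Qed.

Lemma bounded_measurable_integrable f : bounded_measurable f ->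
  (Hmeasure R m k).-integrable D (EFin \o f).
Proof.
move=> [mf [M fM]]; apply: measurable_bounded_integrable => //.
exists M; split; first exact: num_real.
by move=> y My x Dx; exact: le_trans (fM x Dx) (ltW My).
Qed.

Lemma l2dotC f g : l2dot k D f g = l2dot k D g f.
Proof. by apply: eq_Rintegral => x _; rewrite mulrC. Qed.

Lemma l2dot_ge0 f : 0 <= l2dot k D f f.
Proof. by apply: Rintegral_ge0 => x _; rewrite -expr2 sqr_ge0. Qed.

Lemma l2norm_sqr f : l2norm k D f ^+ 2 = l2dot k D f f.
Proof. by rewrite sqr_sqrtr// l2dot_ge0. Qed.

Lemma l2dotDr f g h : bounded_measurable f -> bounded_measurable g ->
  bounded_measurable h ->
  l2dot k D f (fun x => g x + h x) = l2dot k D f g + l2dot k D f h.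
Proof.
move=> bf bg bh; rewrite /l2dot -RintegralD//; last 2 first.
- exact/bounded_measurable_integrable/bounded_measurableM.
- exact/bounded_measurable_integrable/bounded_measurableM.
by apply: eq_Rintegral => x _; rewrite mulrDr.
Qed.

Lemma l2dotZr c f g : bounded_measurable f -> bounded_measurable g ->
  l2dot k D f (fun x => c * g x) = c * l2dot k D f g.
Proof.
move=> bf bg; rewrite /l2dot -RintegralZl//; last first.
  exact/bounded_measurable_integrable/bounded_measurableM.
by apply: eq_Rintegral => x _; rewrite mulrCA.
Qed.

Lemma l2dot_cauchy_schwarz f g : bounded_measurable f -> bounded_measurable g ->
  l2dot k D f g ^+ 2 <= l2dot k D f f * l2dot k D g g.
Proof.
move=> bf bg; apply: discriminant_le0; first exact: l2dot_ge0.
move=> s; have bsf := bounded_measurableZ s bf; have bNg := bounded_measurableZ (-1) bg.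
have bsum := bounded_measurableD bsf bNg.
have := l2dot_ge0 (fun x => s * f x + -1 * g x).
rewrite l2dotDr// !l2dotZr// (l2dotC _ f) (l2dotC _ g) !l2dotDr// !l2dotZr//.
by rewrite (l2dotC g f); lra.
Qed.

Lemma l2dot_ae_eql f g h :
  {ae Hmeasure R m k, forall x, D x -> f x = g x} ->
  l2dot k D f h = l2dot k D g h.
Proof.
move=> [N [mN N0 fgN]]; apply: ae_eq_Rintegral; exists N; split=> // x /=.
by move=> nfg; apply: fgN; apply: contra_not nfg => fg Dx; rewrite fg.
Qed.

End bounded_measurable.

(** * Functions of class C1 *)

Section euclid_topology.
Context {R : realType} {m : nat}.
Implicit Types (x y v w : 'rV[R]_m) (A : set 'rV[R]_m).

Lemma nbhs_enormP x A :
  nbhs x A <-> exists2 r : R, 0 < r & forall y, enorm (y - x) < r -> A y.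
Proof.
split=> [/nbhs_ballP[r /= r0 rA]|[r r0 rA]].
  exists r => // y yx; apply: rA; rewrite -ball_normE/= distrC.
  exact: le_lt_trans (normr_le_enorm _) yx.
apply/nbhs_ballP; exists (r / m.+1%:R); first exact: divr_gt0.
move=> y; rewrite -ball_normE/= distrC => yx; apply: rA.
apply: le_lt_trans (enorm_le_normr _) _.
have : `|y - x| * m.+1%:R < r by rewrite -ltr_pdivlMr.
apply: le_lt_trans; rewrite mulrC ler_wpM2l// ler_nat//.
Qed.

Lemma continuous_enormP (f : 'rV[R]_m -> R) x :
  {for x, continuous f} <->
  forall e : R, 0 < e -> exists2 r : R, 0 < r &
    forall y, enorm (y - x) < r -> `|f y - f x| < e.
Proof.
split=> [cf e e0|cf].
  have /cvgrPdist_lt/(_ e e0)/nbhs_enormP[r r0 rf] : f y @[y --> x] --> f x := cf.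
  by exists r => // y /rf; rewrite distrC.
apply: (proj2 (@cvgrPdist_lt R R _ (nbhs x) (nbhs_filter x) f (f x))) => e e0.
apply/nbhs_enormP.
by have [r r0 rf] := cf e e0; exists r => // y /rf; rewrite distrC.
Qed.

Lemma line_continuous x v : continuous (fun t : R => x + t *: v).
Proof. by move=> t; apply: cvgD; [exact: cvg_cst|exact: scalel_continuous]. Qed.

(** By connectedness of segments. *)
Lemma segment_open_cover (O O' : set 'rV[R]_m) x v : open O -> open O' ->
  O `&` O' = set0 -> (forall t, 0 <= t <= 1 -> (O `|` O') (x + t *: v)) ->
  O x -> O (x + v).
Proof.
move=> oO oO' OO' cov Ox; pose l t := x + t *: v.
have seg (t : R) : `[0, 1]%classic t -> 0 <= t <= 1 by rewrite /= in_itv.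
have : (`[0, 1] `&` l @^-1` O)%classic = `[0, 1]%classic :> set R.
  apply: (@segment_connected R 0 1).
  - by exists 0; split; rewrite /= ?in_itv/= ?lexx ?ler01// /l scale0r addr0.
  - exists (l @^-1` O) => //; apply: open_comp => // t _; exact: line_continuous.
  - exists (~` (l @^-1` O')).
      apply: open_closedC; apply: open_comp => // t _; exact: line_continuous.
    apply/seteqP; split=> t [t01 Ot]; split=> //.
      by move=> O't; have : (O `&` O') (l t) by []; rewrite OO'.
    by have [//|/Ot] := cov t (seg t t01).
move=> /seteqP[_ /(_ 1)]; rewrite /= in_itv/= ler01 lexx => /(_ isT)[_].
by rewrite /l scale1r.
Qed.

End euclid_topology.

Section C1_functions.
Context {R : realType} {m : nat} (U : set 'rV[R]_m) (phi : 'rV[R]_m -> R).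
Implicit Types (x y v w : 'rV[R]_m).
Hypothesis dphi : forall x v, U x -> derivable phi x v.

Lemma derivable_epsilon x v : U x -> forall e : R, 0 < e ->
  exists2 d : R, 0 < d & forall h, `|h| < d ->
    `|phi (x + h *: v) - phi x - h * 'D_v phi x| <= e * `|h|.
Proof.
move=> Ux e e0.
have /cvgrPdist_le/(_ e e0) : h^-1 *: ((phi \o shift x) (h *: v) - phi x)
    @[h --> (0:R)^'] --> 'D_v phi x by exact: dphi.
move=> /nbhs_ballP[d /= d0 dP]; exists d => // h hd.
have [->|h0] := eqVneq h 0.
  by rewrite scale0r addr0 subrr mul0r subr0 normr0 mulr0.
have := dP h; rewrite -ball_normE/= sub0r normrN => /(_ hd h0).
rewrite /= (addrC (h *: v)) => he.
have -> : phi (x + h *: v) - phi x - h * 'D_v phi x =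
    - (h * ('D_v phi x - h^-1 *: (phi (x + h *: v) - phi x))).
  by rewrite /GRing.scale/=; field.
by rewrite normrN normrM mulrC ler_wpM2r.
Qed.

Lemma MVT_line x v (s : R) : 0 <= s ->
  (forall r, 0 <= r <= s -> U (x + r *: v)) ->
  exists2 r, 0 <= r <= s & phi (x + s *: v) - phi x = 'D_v phi (x + r *: v) * s.
Proof.
move=> s0 segU; pose g r := phi (x + r *: v).
have dg r : 0 <= r <= s -> is_derive r 1 g ('D_v phi (x + r *: v)).
  move=> rs.
  have E : (fun h : R => h^-1 *: ((g \o shift r) (h *: (1 : R)) - g r)) =
      (fun h => h^-1 *: ((phi \o shift (x + r *: v)) (h *: v) - phi (x + r *: v))).
    apply/funext => h; rewrite /g /=; congr (_ *: (phi _ - _)).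
    by rewrite [h *: 1]mulr1 scalerDl addrCA.
  have dphir : derivable phi (x + r *: v) v by apply: dphi; exact: segU.
  by split; [rewrite /derivable E|rewrite /derive E].
have [||r rs grs] := @MVT_segment R g (fun r => 'D_v phi (x + r *: v)) 0 s s0.
- move=> r; rewrite in_itv/= => /andP[r0 rs]; apply: dg.
  by rewrite !ltW.
- suff dgs : {in `[0, s], forall r, derivable g r 1}.
    exact: derivable_within_continuous dgs.
  by move=> r; rewrite in_itv/= => /dg[].
- exists r; first by move: rs; rewrite in_itv.
  by move: grs; rewrite subr0 /g scale0r addr0.
Qed.

Hypothesis oU : open U.
Hypothesis cdphi : forall x v, U x -> {for x, continuous (fun y => 'D_v phi y)}.

Lemma open_enorm x : U x -> exists2 r : R, 0 < r & forall y, enorm (y - x) < r -> U y.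
Proof. by move=> Ux; apply/nbhs_enormP; exact: open_nbhs_nbhs. Qed.

(** By the mean value theorem and the continuity of the derivative the first order
    expansion is uniform in the base point [y], as its use for a sum of two
    directions requires. *)
Lemma derive_uniform x w (e : R) : U x -> 0 < e ->
  exists2 d : R, 0 < d & forall y (s : R), enorm (y - x) < d -> `|s| < d ->
    `|phi (y + s *: w) - phi y - s * 'D_w phi x| <= e * `|s|.
Proof.
move=> Ux e0.
have [r r0 rU] := open_enorm Ux.
have [q q0 qD] := (continuous_enormP _ _).1 (@cdphi x w Ux) _ e0.
pose c := Num.min r q; have c0 : 0 < c by rewrite lt_min r0.
have w1 : 0 < 1 + enorm w by rewrite ltr_wpDr ?enorm_ge0.
pose d := c / (1 + (1 + enorm w)).
have d0 : 0 < d by rewrite divr_gt0// addr_gt0.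
exists d => // y s yx sd.
have near t : `|t| <= `|s| -> forall z, enorm (z - x) < d ->
    enorm (z + t *: w - x) < d * (1 + enorm w).
  move=> ts z zx; rewrite addrAC (le_lt_trans (enormD _ _))// enormZ mulrDr mulr1.
  by rewrite ltr_leD// ler_wpM2r ?enorm_ge0// (le_trans ts)// ltW.
have dc : d * (1 + enorm w) + d = c by rewrite /d; field; rewrite gt_eqF// addr_gt0.
have dw : d <= d * (1 + enorm w).
  by rewrite mulrDr mulr1 lerDl mulr_ge0 ?enorm_ge0// ltW.
have main z t : 0 <= t -> `|t| <= `|s| -> enorm (z - x) < d * (1 + enorm w) ->
   enorm (z + t *: w - x) < d * (1 + enorm w) ->
   `|phi (z + t *: w) - phi z - t * 'D_w phi x| <= e * `|t|.
  move=> t0 ts zx ztx.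
  have seg r' : 0 <= r' <= t -> enorm (z + r' *: w - x) < c.
    move=> /andP[r'0 r't].
    have [t00|tn0] := eqVneq t 0.
      have -> : r' = 0 by lra.
      by rewrite scale0r addr0 (lt_le_trans zx)// -dc lerDl ltW.
    have tp : 0 < t by rewrite lt_neqAle eq_sym tn0.
    have -> : z + r' *: w - x =
        (1 - r' / t) *: (z - x) + (r' / t) *: (z + t *: w - x).
      by apply/rowP => j; rewrite !mxE; field.
    have rt0 : 0 <= r' / t by rewrite divr_ge0.
    have rt1 : r' / t <= 1 by rewrite ler_pdivrMr// mul1r.
    apply: le_lt_trans (enormD _ _) _; rewrite !enormZ !ger0_norm ?subr_ge0//.
    apply: (@le_lt_trans _ _ (d * (1 + enorm w))); last by rewrite -dc ltrDl.
    move: (ltW zx) (ltW ztx) rt0 rt1.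
    by move: (enorm _) (enorm _) (d * _) (r' / t) => A B C D; nra.
  have [|r' r't ->] := @MVT_line z w t t0.
    by move=> r' /seg h; apply: rU; rewrite (lt_le_trans h)// ge_min lexx.
  rewrite mulrC -mulrBr normrM mulrC ler_wpM2r// ltW// qD//.
  by rewrite (lt_le_trans (seg _ r't))// ge_min lexx orbT.
have [s0|s0] := leP 0 s.
  apply: main => //; last exact: near.
  exact: lt_le_trans yx dw.
have := main (y + s *: w) (- s); rewrite normrN scaleNr addrK => /(_ _ (lexx _)).
have -> : phi y - phi (y + s *: w) - - s * 'D_w phi x =
  - (phi (y + s *: w) - phi y - s * 'D_w phi x) by ring.
rewrite normrN; apply; first by rewrite oppr_ge0 ltW.
- exact: near.
- exact: lt_le_trans yx dw.
Qed.

(** The increment along [v + c w] is the increment along [v] followed by one along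
    [w] from a nearby point, for which the uniform estimate is needed. *)
Lemma deriveD_direction x v w (c : R) : U x ->
  'D_(v + c *: w) phi x = 'D_v phi x + c * 'D_w phi x.
Proof.
move=> Ux; apply/eqP; rewrite -subr_eq0 -normr_le0; apply/ler_addgt0Pr => e e0.
rewrite add0r.
have e3 : 0 < e / (2 + `|c|) by rewrite divr_gt0// ltr_wpDr.
have [d1 d10 H1] := derivable_epsilon (v + c *: w) Ux e3.
have [d2 d20 H2] := derivable_epsilon v Ux e3.
have [d3 d30 H3] := derive_uniform w Ux e3.
pose d := Num.min (Num.min d1 d2) (Num.min (d3 / (1 + enorm v)) (d3 / (1 + `|c|))).
have v1 : 0 < 1 + enorm v by rewrite ltr_wpDr ?enorm_ge0.
have c1 : 0 < 1 + `|c| by rewrite ltr_wpDr.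
have d0 : 0 < d by rewrite !lt_min d10 d20/= !divr_gt0.
pose h := d / 2.
have h0 : 0 < h by rewrite divr_gt0.
have hd : h < d by rewrite /h; lra.
move: (hd); rewrite {1}/d !lt_min => /andP[/andP[hd1 hd2] /andP[hd3 hd4]].
have nh : `|h| = h by rewrite gtr0_norm.
have := H1 h; rewrite nh => /(_ hd1) {}H1.
have := H2 h; rewrite nh => /(_ hd2) {}H2.
have ev : x + h *: v + (h * c) *: w = x + h *: (v + c *: w).
  by rewrite scalerDr scalerA addrA.
have := H3 (x + h *: v) (h * c).
rewrite ev normrM nh addrAC subrr add0r enormZ nh => H3'.
have {}H3 : `|phi (x + h *: (v + c *: w)) - phi (x + h *: v) - h * c * 'D_w phi x|
    <= e / (2 + `|c|) * (h * `|c|).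
  apply: H3'.
    rewrite ltr_pdivlMr// in hd3; apply: le_lt_trans hd3.
    by rewrite ler_pM2l// lerDr.
  rewrite ltr_pdivlMr// in hd4; apply: le_lt_trans hd4.
  by rewrite ler_pM2l// lerDr.
rewrite -(ler_pM2l h0).
have -> : h * e = e / (2 + `|c|) * (h * `|c|) + (e / (2 + `|c|) * h + e / (2 + `|c|) * h).
  by field; rewrite gt_eqF// ltr_wpDr.
rewrite -{1}nh -normrM.
set a := 'D_(v + _) _ _ in H1 *; set b := 'D_v _ _ in H2 *.
set k := 'D_w _ _ in H3 *.
set p1 := phi (x + _ *: (v + _)) in H1 H3; set p2 := phi (x + _) in H2 H3.
have -> : h * (a - (b + c * k)) =
  (p1 - p2 - h * c * k) + ((p2 - phi x - h * b) - (p1 - phi x - h * a)) by ring.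
apply: le_trans (ler_normD _ _) _; apply: lerD => //.
by apply: le_trans (ler_normB _ _) _; apply: lerD.
Qed.

Lemma derive_dir0 x : 'D_0 phi x = 0.
Proof.
rewrite /derive; apply: lim_near_cst => //; apply: nearW => h.
by rewrite /= scaler0 add0r subrr scaler0.
Qed.

End C1_functions.

Lemma derive_grad {R : realType} {n : nat} (U : set 'rV[R]_n.+1) phi :
  (forall x v, U x -> derivable phi x v) -> open U ->
  (forall x v, U x -> {for x, continuous (fun y => 'D_v phi y)}) ->
  forall x w, U x -> 'D_w phi x = dot w (grad phi x).
Proof.
move=> dphi oU cdphi x w Ux.
rewrite {1}[w]row_sum_delta /dot.
under [in RHS]eq_bigr do rewrite mxE.
elim/big_rec2 : _ => [|j a v _ <-]; first exact: derive_dir0.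
by rewrite addrC (deriveD_direction dphi oU cdphi)// addrC.
Qed.

Lemma ord2P (i : 'I_2) : i = 0 \/ i = 1.
Proof. by case: i => -[|[|//]] p; [left|right]; exact/val_inj. Qed.

Lemma cvg_sumr {R : realType} {T : Type} {F : set_system T} {FF : Filter F}
  (I : finType) (f : I -> T -> R) (l : I -> R) :
  (forall i, f i x @[x --> F] --> l i) -> \sum_i f i x @[x --> F] --> \sum_i l i.
Proof.
by move=> fl; apply: cvg_big => [|i _]; [exact: add_continuous|exact: fl].
Qed.

(** * The fracture as a two-sided interface *)

Section relative_continuity.
Context {R : realType} {m : nat}.
Implicit Types (D : set 'rV[R]_m) (f : 'rV[R]_m -> R).

Definition continuous_on D f := forall x, D x -> forall e : R, 0 < e ->
  exists2 r : R, 0 < r & forall y, D y -> enorm (y - x) < r -> `|f y - f x| < e.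

Lemma relatively_open_measurable k D (P : set 'rV[R]_m) :
  measurable (D : set (hspace R m k)) ->
  (forall x, D x -> P x -> \forall y \near within D (nbhs x), P y) ->
  measurable (D `&` P : set (hspace R m k)).
Proof.
move=> mD hP; pose W := [set y | D y -> P y].
have -> : D `&` P = D `&` W°.
  apply/seteqP; split=> x [Dx xP]; split=> //; last exact: interior_subset xP Dx.
  by have := hP x Dx xP; rewrite near_withinE.
by apply: measurableI => //; exact/open_hmeasurable/open_interior.
Qed.

Lemma continuous_on_measurable k D f : measurable (D : set (hspace R m k)) ->
  continuous_on D f -> measurable_fun (D : set (hspace R m k)) (f : hspace R m k -> R).
Proof.
move=> mD cf _; apply: (measurability _ (RGenOInfty.measurableE R)) => //.
move=> _ [_ [a ->] <-]; apply: relatively_open_measurable => // x Dx.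
rewrite /= in_itv/= andbT => ax; have [|r r0 rf] := cf x Dx (f x - a).
  by rewrite subr_gt0.
rewrite near_withinE; apply/nbhs_enormP; exists r => // y yx Dy.
rewrite /= in_itv/= andbT; have := rf y Dy yx; rewrite ltr_norml => /andP[]; lra.
Qed.

End relative_continuity.

Section fracture.
Context {R : realType} {n : nat}.
Notation pt := 'rV[R]_n.+1.
Implicit Types (x y v w nu : pt).

(** The difference of two distinct outward unit normals would point into the
    set for one and out of it for the other. *)
Lemma outward_unit_normal_unique (A : set pt) x nu nu' :
  is_outward_unit_normal A x nu -> is_outward_unit_normal A x nu' -> nu = nu'.
Proof.
move=> [u1 h] [u1' h'].
have d1 : dot nu nu = 1 by rewrite -enorm_sqr u1 expr1n.
have d1' : dot nu' nu' = 1 by rewrite -enorm_sqr u1' expr1n.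
apply/eqP; rewrite eq_sym -subr_eq0 -dot_eq0; apply/negP => /negP nz.
have : 0 < dot (nu' - nu) (nu' - nu) by rewrite lt_neqAle eq_sym nz dot_ge0.
rewrite !(dotDl, dotDr, dotNl, dotNr) d1 d1' (dotC nu') => lt1.
have [|e e0 eA] := (h (nu' - nu)).1.
  by rewrite dotDl dotNl d1 (dotC nu'); lra.
have [|e' e'0 eA'] := (h' (nu' - nu)).2.
  by rewrite dotDl dotNl d1'; lra.
have m0 : 0 < Num.min e e' / 2 by rewrite divr_gt0// lt_min e0.
have mlt : Num.min e e' / 2 < Num.min e e' by move: m0; lra.
move: (mlt); rewrite lt_min => /andP[me me'].
by apply: (eA' (Num.min e e' / 2)); rewrite ?m0//; apply: eA; rewrite m0.
Qed.

Lemma normalE (A : set pt) x nu : is_outward_unit_normal A x nu -> normal A x = nu.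
Proof.
move=> h; apply: (@outward_unit_normal_unique A x) => //.
exact: (@xgetPex _ 0 [set nu | is_outward_unit_normal A x nu] (ex_intro _ nu h)).
Qed.

Lemma enorm_normal_le1 (A : set pt) x : enorm (normal A x) <= 1.
Proof.
rewrite /normal; case: xgetP => [nu _ [-> _]//|_].
by rewrite enorm0.
Qed.

Variables (Omega : set pt) (Om : 'I_2 -> set pt) (gam : set pt).
Hypothesis hOmega : fractured_domain Omega Om gam.

Lemma open_Om i : open (Om i).
Proof. by have [] := fd_subdomain hOmega i. Qed.

Lemma open_Omega : open Omega.
Proof. by have [] := fd_domain hOmega. Qed.

Lemma gam_Omega : gam `<=` Omega.
Proof. by rewrite (fd_interface hOmega) => x []. Qed.

Lemma gam_frontier i : gam `<=` frontier (Om i).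
Proof.
rewrite (fd_interface hOmega) => x [[h0 h1] _].
by case: (ord2P i) => ->.
Qed.

Lemma Om_disjoint i j : i != j -> Om i `&` Om j = set0.
Proof.
have := fd_disjoint hOmega.
by case: (ord2P i) => ->; case: (ord2P j) => -> //; rewrite setIC.
Qed.

Lemma Om_unique i j x : Om i x -> Om j x -> i = j.
Proof.
move=> Oi Oj; apply/eqP; apply: contraT => ij.
by have : (Om i `&` Om j) x by []; rewrite Om_disjoint.
Qed.

Lemma Omega_split x : Omega x -> ~ gam x -> exists i, Om i x.
Proof. by rewrite {1}(fd_union hOmega) => -[[]|] // ? _; eexists; eassumption. Qed.

Lemma Om_notgam i x : Om i x -> ~ gam x.
Proof. by move=> Oi gx; have : (Om i `&` gam) x by []; rewrite (fd_gamma_disjoint hOmega). Qed.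

Lemma gam_hmeasurable k : measurable (gam : set (hspace R n.+1 k)).
Proof.
rewrite (fd_interface hOmega); apply: measurableI; last exact/open_hmeasurable/open_Omega.
by apply: measurableI; apply: measurableD;
  try exact/closed_hmeasurable/closed_closure; exact/open_hmeasurable/open_interior.
Qed.

Lemma ball_convex x y v (r t : R) : enorm (y - x) < r -> enorm (y + v - x) < r ->
  0 <= t <= 1 -> enorm (y + t *: v - x) < r.
Proof.
move=> yr yvr /andP[t0 t1].
have -> : y + t *: v - x = (1 - t) *: (y - x) + t *: (y + v - x).
  by apply/rowP => j; rewrite !mxE; ring.
apply: le_lt_trans (enormD _ _) _; rewrite !enormZ !ger0_norm ?subr_ge0//.
have [->|tn0] := eqVneq t 0; first by rewrite mul0r addr0 subr0 mul1r.
have tp : 0 < t by rewrite lt_neqAle eq_sym tn0.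
have := mulr_gt0 tp (_ : 0 < r - enorm (y + v - x)); rewrite subr_gt0 => /(_ yvr).
have : 0 <= (1 - t) * (r - enorm (y - x)) by rewrite mulr_ge0 ?subr_ge0// ltW.
lra.
Qed.

(** Off the fracture, [Omega] is the disjoint union of two open sets. *)
Lemma segment_same_side i x v : (forall t, 0 <= t <= 1 -> Omega (x + t *: v)) ->
  (forall t, 0 <= t <= 1 -> ~ gam (x + t *: v)) -> Om i x -> Om i (x + v).
Proof.
move=> sO sg Oi.
pose O' := \bigcup_(j in [set j | j != i]) Om j.
apply: (@segment_open_cover _ _ (Om i) O') => //; first exact: open_Om.
- by apply: bigcup_open => j _; exact: open_Om.
- rewrite -subset0 => y [Oy [j /= ji Ojy]].
  by have : (Om j `&` Om i) y by []; rewrite Om_disjoint.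
- move=> t t01; have [j Oj] := Omega_split (sO t t01) (sg t t01).
  have [<-|ji] := eqVneq j i; first by left.
  by right; exists j.
Qed.

(** A function vanishing exactly on the fracture and increasing along [g]: the
    points near [x] where it is positive are joined, first along [g] and then
    close to [x + delta g], without meeting the fracture. They lie on one side. *)
Lemma one_side (f : pt -> R) (g x : pt) (r : R) : 0 < r -> gam x ->
  (forall y, enorm (y - x) < r ->
    [/\ Omega y, gam y <-> f y = 0 & {for y, continuous f}]) ->
  (forall y s, 0 < s -> enorm (y - x) < r -> enorm (y + s *: g - x) < r ->
    f y < f (y + s *: g)) ->
  exists2 rho : R, 0 < rho & exists a, forall y, enorm (y - x) < rho -> 0 < f y -> Om a y.
Proof.
move=> r0 gx Bf mono.
have xB : enorm (x - x) < r by rewrite subrr enorm0.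
have fx : f x = 0 by have [_ /proj1-> //] := Bf x xB.
have g1 : 0 < 1 + enorm g by rewrite ltr_wpDr ?enorm_ge0.
(* the points z and y + delta g stay in the ball of radius r when y is within r / 2 *)
pose delta := r / (2 * (1 + enorm g)).
have delta0 : 0 < delta by rewrite divr_gt0// mulr_gt0.
have deltag : delta * enorm g < r / 2.
  have -> : r / 2 = delta * (1 + enorm g) by rewrite /delta; field; rewrite gt_eqF.
  by rewrite ltr_pM2l// ltrDr.
have edg : enorm (delta *: g) < r / 2 by rewrite enormZ gtr0_norm.
pose z := x + delta *: g.
have zB : enorm (z - x) < r by rewrite /z addrAC subrr add0r; lra.
have fz : 0 < f z by rewrite -fx mono.
have [_ _ cz] := Bf z zB.
have [q q0 qf] := (continuous_enormP _ _).1 cz (f z) fz.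
have fpos y : enorm (y - z) < q -> 0 < f y.
  by move=> /qf; rewrite ltr_norml => /andP[]; lra.
have not_gam y : enorm (y - x) < r -> 0 < f y -> ~ gam y.
  by move=> yB fy gy; have [_ /proj1/(_ gy) fy0 _] := Bf y yB; rewrite fy0 ltxx in fy.
have OmB y : enorm (y - x) < r -> Omega y by case/Bf.
have [a Oaz] := Omega_split (OmB z zB) (not_gam z zB fz).
exists (Num.min (r / 2) q); first by rewrite lt_min q0 divr_gt0.
exists a => y; rewrite lt_min => /andP[yr yq] fy.
have yB : enorm (y - x) < r by lra.
have ygB : enorm (y + delta *: g - x) < r.
  by rewrite addrAC (le_lt_trans (enormD _ _))//; lra.
have ygz : enorm (y + delta *: g - z) < q.
  by rewrite (_ : _ - z = y - x)// /z; apply/rowP => j; rewrite !mxE; ring.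
have [j Oj] := Omega_split (OmB y yB) (not_gam y yB fy).
have segB t : 0 <= t <= 1 -> enorm (y + t *: (delta *: g) - x) < r by exact: ball_convex.
have Oj1 : Om j (y + delta *: g).
  apply: segment_same_side Oj => t t01; first exact/OmB/segB.
  apply: not_gam; first exact: segB.
  have [->|t0] := eqVneq t 0; first by rewrite scale0r addr0.
  apply: lt_trans fy _; rewrite scalerA; apply: mono => //.
    by rewrite mulr_gt0// lt_neqAle eq_sym t0; case/andP: t01.
  by rewrite -scalerA segB.
have Oj2 : Om j z.
  have -> : z = y + delta *: g + (x - y).
    by rewrite /z; apply/rowP => i; rewrite !mxE; ring.
  have eqz : y + delta *: g + (x - y) = z.
    by rewrite /z; apply/rowP => i; rewrite !mxE; ring.
  apply: segment_same_side Oj1 => t t01.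
    by apply: OmB; apply: ball_convex => //; rewrite eqz.
  apply: not_gam; first by apply: ball_convex => //; rewrite eqz.
  by apply: fpos; apply: ball_convex => //; rewrite eqz subrr enorm0.
by rewrite -(Om_unique Oj2 Oaz).
Qed.

(** Near a point of the fracture the function [phi] defining it is positive on one
    subdomain and negative on the other, by [one_side] applied to [phi] and to
    [- phi]; both subdomains do occur because the point belongs to their
    frontiers. The sign of [phi] along a ray is that of the scalar product with
    the gradient [G], whose normalization is therefore an outward normal, up to a
    sign [s] which does not vary locally. *)
Lemma normal_local i x : gam x -> exists (r s : R) (G : pt -> pt),
  [/\ 0 < r, forall j, {for x, continuous (fun y => G y 0 j)}, G x != 0 &
      forall y, gam y -> enorm (y - x) < r ->
        is_outward_unit_normal (Om i) y (s *: ((enorm (G y))^-1 *: G y))].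
Proof.
move=> gx; have [U [phi [oU Ux Cphi g0 hg]]] := fd_surface hOmega gx.
have cphi y : U y -> {for y, continuous phi} by case: Cphi => h _; exact: h.
have dphi y v : U y -> derivable phi y v by case: Cphi => _ /(_ v)[h _]; exact: h.
have cdphi y v : U y -> {for y, continuous (fun y => 'D_v phi y)}.
  by case: Cphi => _ /(_ v)[_ []] h _; exact: h.
have Dgrad y v : U y -> 'D_v phi y = dot v (grad phi y).
  by move=> Uy; exact: (derive_grad dphi oU cdphi).
pose g := grad phi x.
have dg0 : 0 < 'D_g phi x by rewrite Dgrad// lt_neqAle dot_ge0 eq_sym dot_eq0 g0.
have [r1 r10 r1U] := open_enorm oU Ux.
have [r2 r20 r2O] := open_enorm open_Omega (gam_Omega gx).
have [r3 r30 r3D] := (continuous_enormP _ _).1 (@cdphi x g Ux) _ dg0.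
pose r := Num.min r1 (Num.min r2 r3).
have r0 : 0 < r by rewrite !lt_min r10 r20.
have rB y : enorm (y - x) < r -> [/\ U y, Omega y & 0 < 'D_g phi y].
  rewrite !lt_min => /and3P[/r1U yU /r2O yO /r3D yD]; split=> //.
  by move: yD; rewrite ltr_norml => /andP[]; lra.
clearbody r.
have mono y s : 0 < s -> enorm (y - x) < r -> enorm (y + s *: g - x) < r ->
    phi y < phi (y + s *: g).
  move=> s0 yB ysB.
  have seg t : 0 <= t <= s -> enorm (y + t *: g - x) < r.
    move=> /andP[t0 ts].
    have -> : t *: g = (t / s) *: (s *: g) by rewrite scalerA divfK// gt_eqF.
    by apply: ball_convex => //; rewrite divr_ge0 ?(ltW s0)//= ler_pdivrMr// mul1r.
  have [|t /seg tB] := MVT_line dphi (ltW s0) (x := y) (v := g).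
    by move=> t /seg/rB[].
  have [_ _ Dt] := rB _ tB.
  by move=> E; rewrite -subr_gt0 E mulr_gt0.
have [rho1 rho10 [a1 side1]] : exists2 rho : R, 0 < rho &
    exists a, forall y, enorm (y - x) < rho -> 0 < phi y -> Om a y.
  apply: (@one_side phi g x r) => // y /rB[Uy Oy _]; split=> //; first exact: hg.
  exact: cphi.
have [rho2 rho20 [a2 side2]] : exists2 rho : R, 0 < rho &
    exists a, forall y, enorm (y - x) < rho -> 0 < - phi y -> Om a y.
  apply: (@one_side (fun y => - phi y) (- g) x r) => //.
    move=> y /rB[Uy Oy _]; split=> //.
      by split=> [/(hg y Uy).1 ->|/eqP]; rewrite ?oppr0// oppr_eq0 => /eqP/(hg y Uy).2.
    by apply: continuousN; exact: cphi.
  move=> y s s0 yB ysB; rewrite ltrN2.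
  by have := mono (y + s *: (- g)) s s0 ysB; rewrite scalerN subrK; apply.
pose rho := Num.min r (Num.min rho1 rho2).
have rho0 : 0 < rho by rewrite !lt_min r0 rho10.
have meet j : j = a1 \/ j = a2.
  have [/(_ [set y | enorm (y - x) < rho])[]] := gam_frontier j gx.
    by apply/nbhs_enormP; exists rho.
  move=> y [Ojy /= yx] _; move: yx; rewrite !lt_min => /and3P[/rB[Uy _ _] y1 y2].
  have [p0|p0|p0] := ltgtP 0 (phi y).
  - by left; apply: Om_unique Ojy (side1 y y1 p0).
  - by right; apply: Om_unique Ojy (side2 y y2 _); rewrite oppr_gt0.
  - by have /(Om_notgam Ojy) := (hg y Uy).2 (esym p0).
have a12 : a1 != a2.
  apply/eqP => a12; have : (0 : 'I_2) = 1; last by [].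
  by case: (meet 0) (meet 1) => -> [] ->; rewrite ?a12.
have sgn y w : gam y -> enorm (y - x) < rho -> exists2 e : R, 0 < e &
    forall t, 0 < t < e -> enorm (y + t *: w - x) < rho /\
     (0 < dot w (grad phi y) -> 0 < phi (y + t *: w)) /\
     (dot w (grad phi y) < 0 -> phi (y + t *: w) < 0).
  move=> gy yx.
  have [Uy _ _] : [/\ U y, Omega y & 0 < 'D_g phi y].
    by apply: rB; move: yx; rewrite lt_min => /andP[].
  have py : phi y = 0 by apply/(hg y Uy).1.
  pose e1 := (rho - enorm (y - x)) / (1 + enorm w).
  have w1 : 0 < 1 + enorm w by rewrite ltr_wpDr ?enorm_ge0.
  have e10 : 0 < e1 by rewrite divr_gt0// subr_gt0.
  have inB t : 0 < t < e1 -> enorm (y + t *: w - x) < rho.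
    move=> /andP[t0]; rewrite ltr_pdivlMr// => te.
    rewrite addrAC (le_lt_trans (enormD _ _))// enormZ gtr0_norm// -ltrBrDl.
    by apply: le_lt_trans te; rewrite ler_pM2l// lerDr.
  have [D0|D0] := eqVneq (dot w (grad phi y)) 0.
    by exists e1 => // t /inB tB; rewrite D0 ltxx.
  have eps : 0 < `|dot w (grad phi y)| / 2 by rewrite divr_gt0// normr_gt0.
  have [e2 e20 H] := derivable_epsilon dphi w Uy eps.
  exists (Num.min e1 e2); first by rewrite lt_min e10.
  move=> t /andP[t0]; rewrite lt_min => /andP[te1 te2].
  split; first by apply: inB; rewrite t0.
  have := H t; rewrite gtr0_norm// Dgrad// => /(_ te2).
  rewrite py subr0 => {}H; split=> Dw.
    move: H; rewrite (gtr0_norm Dw) ler_norml => /andP[H _]; move: H Dw t0.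
    by move: (dot _ _) (phi _) => D p; nra.
  move: H; rewrite (ltr0_norm Dw) ler_norml => /andP[_ H]; move: H Dw t0.
  by move: (dot _ _) (phi _) => D p; nra.
have cG j : {for x, continuous (fun y => grad phi y 0 j)}.
  rewrite (_ : (fun y => _) = (fun y => 'D_('e_j) phi y)); first exact: cdphi.
  by apply/funext => y; rewrite mxE.
have Gn0 y : enorm (y - x) < rho -> grad phi y != 0.
  rewrite lt_min => /andP[/rB[Uy _]]; rewrite Dgrad// => h _.
  by apply: contraTneq h => ->; rewrite dotC dot0l ltxx.
have unit (s : R) y : `|s| = 1 -> enorm (y - x) < rho ->
    enorm (s *: ((enorm (grad phi y))^-1 *: grad phi y)) = 1.
  move=> s1 /Gn0 G0; rewrite !enormZ s1 mul1r ger0_norm ?invr_ge0 ?enorm_ge0//.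
  by rewrite mulVf// enorm_eq0.
have not_in b c y : b != c -> Om b y -> ~ Om c y.
  by move=> /eqP bc Ob Oc; exact: bc (Om_unique Ob Oc).
have dotG (s : R) w y : enorm (y - x) < rho ->
    dot w (s *: ((enorm (grad phi y))^-1 *: grad phi y)) =
    s * ((enorm (grad phi y))^-1 * dot w (grad phi y)) /\ 0 < (enorm (grad phi y))^-1.
  move=> /Gn0 G0; rewrite !dotZr; split=> //.
  by rewrite invr_gt0 lt_neqAle enorm_ge0 eq_sym enorm_eq0 G0.
exists rho.
have [->|->] := meet i; [have dG := dotG (-1); exists (-1)|have dG := dotG 1; exists 1];
  exists (grad phi); split=> // y gy yx;
  (split; first by apply: unit; rewrite ?normrN1 ?normr1);
  move=> w; have [-> iG] := dG w y yx; have [e e0 es] := sgn y w gy yx;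
  rewrite ?mulN1r ?mul1r ?oppr_lt0 ?oppr_gt0 ?(pmulr_rlt0 _ iG) ?(pmulr_rgt0 _ iG);
  split=> Dw; exists e => // t /es[].
- by rewrite !lt_min => /and3P[_ b1 _] [/(_ Dw) p _]; exact: side1.
- rewrite !lt_min => /and3P[_ _ b2] [_ /(_ Dw) p].
  by apply: (@not_in a2 a1 _) (side2 _ b2 _); rewrite 1?eq_sym// oppr_gt0.
- rewrite !lt_min => /and3P[_ _ b2] [_ /(_ Dw) p].
  by apply: side2; rewrite ?oppr_gt0.
- rewrite !lt_min => /and3P[_ b1 _] [/(_ Dw) p _].
  by exact: (@not_in a1 a2 _ a12 (side1 _ b1 p)).
Qed.

Lemma normal_is_outward i x : gam x ->
  is_outward_unit_normal (Om i) x (normal (Om i) x).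
Proof.
move=> gx; have [r [s [G [r0 _ _ h]]]] := normal_local i gx.
have := h x gx; rewrite subrr enorm0 => /(_ r0) hx.
by rewrite (normalE hx).
Qed.

Lemma enorm_normal i x : gam x -> enorm (normal (Om i) x) = 1.
Proof. by case/(normal_is_outward i). Qed.

(** The choice made by [normal] agrees with the local formula by uniqueness. *)
Lemma normal_continuous_on i j : continuous_on gam (fun x => normal (Om i) x 0 j).
Proof.
move=> x gx e e0; have [r [s [G [r0 cG G0 h]]]] := normal_local i gx.
pose f y := (s *: ((enorm (G y))^-1 *: G y)) 0 j.
have cf : {for x, continuous f}.
  rewrite /f (_ : (fun y => _) = (fun y => s * ((enorm (G y))^-1 * G y 0 j))); last first.
    by apply/funext => y; rewrite !mxE.
  have cGk k : G y 0 k @[y --> x] --> G x 0 k by exact: cG.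
  have cd : dot (G y) (G y) @[y --> x] --> dot (G x) (G x).
    by rewrite /dot; apply: (@cvg_sumr _ _ (nbhs x) _) => k; apply: (@cvgM _ _ (nbhs x) _).
  have cn : enorm (G y) @[y --> x] --> enorm (G x).
    exact: (continuous_comp cd (@sqrt_continuous _ _)).
  have n0 : enorm (G x) != 0 by rewrite enorm_eq0.
  exact: (cvgM (cvg_cst s) (cvgM (cvgV n0 cn) (cGk j))).
have [q q0 qf] := (continuous_enormP _ _).1 cf e e0.
exists (Num.min r q); first by rewrite lt_min r0.
move=> y gy; rewrite lt_min => /andP[yr yq].
have hx : enorm (x - x) < r by rewrite subrr enorm0.
by rewrite (normalE (h y gy yr)) (normalE (h x gx hx)); exact: qf.
Qed.

(** If [v] or [- v] made an obtuse angle with the outward normal, the segment would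
    enter the subdomain, which does not meet the fracture. *)
Lemma normal_tangent i x v : gam x ->
  (exists2 e : R, 0 < e & forall t, `|t| < e -> gam (x + t *: v)) ->
  dot v (normal (Om i) x) = 0.
Proof.
move=> gx [e e0 gv]; have [_ hn] := normal_is_outward i gx.
have main (w : pt) : (forall t, `|t| < e -> gam (x + t *: w)) ->
    ~~ (dot w (normal (Om i) x) < 0).
  move=> gw; apply/negP => /(hn w).1[e' e'0 Ow].
  pose t := Num.min e e' / 2.
  have t0 : 0 < t by rewrite divr_gt0// lt_min e0.
  have : t < Num.min e e' by move: t0; rewrite /t; lra.
  rewrite lt_min => /andP[te te'].
  by apply: (@Om_notgam i (x + t *: w)); [apply: Ow; rewrite t0|apply: gw; rewrite gtr0_norm].
have := main v gv; rewrite -leNgt => h1.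
have : ~~ (dot (- v) (normal (Om i) x) < 0).
  by apply: main => t te; rewrite scalerN -scaleNr; apply: gv; rewrite normrN.
by rewrite -leNgt dotNl; lra.
Qed.

End fracture.

(** * Cells *)

Lemma hausdorff_fin_cover {R : realType} {m k : nat} (J : finType)
    (U : J -> set 'rV[R]_m) (A : set 'rV[R]_m) :
  A `<=` \bigcup_(j in [set: J]) U j ->
  (hausdorff k A <= \sum_j hausdorff k (U j))%E.
Proof.
move=> AU; have mono := @le_hausdorff R m k _ _ AU; apply: le_trans mono _.
have -> : \bigcup_(j in [set: J]) U j = [set x | exists2 j, j \in index_enum J & U j x].
  by apply/seteqP; split=> [x [j _ Ux]|x [j _ Ux]]; exists j => //; exact: mem_index_enum.
elim: (index_enum J) => [|j s IH].
  rewrite big_nil (_ : mkset _ = set0) ?hausdorff0//.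
  by rewrite -subset0 => x [].
rewrite big_cons.
pose B := [set x | exists2 j, j \in s & U j x].
apply: le_trans (leeD2l _ IH); apply: le_trans (outer_measureU2 _ (U j) B).
apply: le_outer_measure => x [i]; rewrite inE => /predU1P[->|is_] Ux; first by left.
by right; exists i.
Qed.

(** ** Faces *)

Section cells.
Context {R : realType} {n k : nat}.
Implicit Types (t s : 'rV[R]_k) (y : 'rV[R]_n.+1).

Lemma ref_closed_itv (sh : Defs.shape) t : ref_closed sh t -> forall i, 0 <= t 0 i <= 1.
Proof.
case: sh => //= -[t0 t1] i; rewrite t0 (le_trans _ t1)// (bigD1 i)//= lerDl.
by apply: sumr_ge0.
Qed.

Lemma ref_open_closed (sh : Defs.shape) : (ref_open sh : set 'rV[R]_k) `<=` ref_closed sh.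
Proof.
case: sh => [t [t0 t1]|t /= t01]; first by split=> [j|]; exact: ltW.
by move=> j; have /andP[? ?] := t01 j; rewrite !ltW.
Qed.

Lemma ref_open_convex (sh : Defs.shape) t s (a : R) : 0 <= a <= 1 ->
  ref_open sh t -> ref_open sh s -> ref_open sh ((1 - a) *: t + a *: s).
Proof.
move=> /andP[a0 a1].
have conv (b x z : R) : x < b -> z < b -> (1 - a) * x + a * z < b.
  move=> xb zb; have [->|an0] := eqVneq a 0; first by rewrite mul0r addr0 subr0 mul1r.
  have ap : 0 < a by rewrite lt_neqAle eq_sym an0.
  have := mulr_gt0 ap (_ : 0 < b - z); rewrite subr_gt0 => /(_ zb).
  have : 0 <= (1 - a) * (b - x) by rewrite mulr_ge0 ?subr_ge0// ltW.
  lra.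
have conv0 (x z : R) : 0 < x -> 0 < z -> 0 < (1 - a) * x + a * z.
  move=> x0 z0; have := conv 0 (- x) (- z); rewrite !oppr_lt0 => /(_ x0 z0); lra.
case: sh => /= [[t0 t1] [s0 s1]|ht hs].
  split=> [j|]; first by rewrite !mxE; exact: conv0.
  under eq_bigr do rewrite !mxE.
  by rewrite big_split/= -!mulr_sumr; exact: conv.
move=> j; rewrite !mxE; have /andP[? ?] := ht j; have /andP[? ?] := hs j.
by rewrite conv0// conv.
Qed.

Lemma ref_open_nonempty (sh : Defs.shape) : exists t : 'rV[R]_k, ref_open sh t.
Proof.
exists (const_mx (k.+2%:R^-1)).
have k0 : 0 < k.+2%:R^-1 :> R by rewrite invr_gt0.
have k1 : k.+2%:R^-1 < 1 :> R by rewrite invf_lt1// ltr1n.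
case: sh => /= [|j]; last by rewrite mxE k0.
split=> [j|]; first by rewrite mxE.
under eq_bigr do rewrite mxE.
rewrite sumr_const card_ord -[_ *+ k]mulr_natl ltr_pdivrMr// mul1r ltr_nat.
by rewrite ltnW.
Qed.

Variable c : @cell R n k.
Hypothesis wf : cell_wf c.

(** Coordinates on the affine span of the cell. *)
Lemma cell_coordinates : exists E' : 'M[R]_(n.+1, k), edges c *m E' = 1%:M.
Proof. by apply/row_freeP; case: wf. Qed.

Let E' := projT1 (cid cell_coordinates).

Let E'E : edges c *m E' = 1%:M. Proof. exact: projT2 (cid cell_coordinates). Qed.

Definition cell_coord y : 'rV[R]_k := (y - origin c) *m E'.

Lemma paramK : cancel (param c) cell_coord.
Proof. by move=> t; rewrite /cell_coord /param addrC addKr -mulmxA E'E mulmx1. Qed.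

Lemma paramB t s : param c t - param c s = (t - s) *m edges c.
Proof. by rewrite /param opprD addrACA subrr add0r mulmxBl. Qed.

Let L : R := \sum_i enorm (row i (edges c)).

Let L0 : 0 <= L. Proof. by apply: sumr_ge0 => i _; exact: enorm_ge0. Qed.

Lemma enorm_paramB t s :
  enorm (param c t - param c s) <= L * \sum_i `|t 0 i - s 0 i|.
Proof.
rewrite paramB mulmx_sum_row.
apply: (@le_trans _ _ (\sum_i `|t 0 i - s 0 i| * L)); last by rewrite -mulr_suml mulrC.
elim/big_ind2 : _ => [|x a z b xa zb|i _]; first by rewrite enorm0.
  by rewrite (le_trans (enormD _ _))// lerD.
rewrite !mxE enormZ ler_wpM2l// /L (bigD1 i)//= lerDl.
by apply: sumr_ge0 => j _; exact: enorm_ge0.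
Qed.

Lemma hausdorff_closed_cell l : (k <= l)%N -> (hausdorff l (closed_cell c) < +oo)%E.
Proof.
move=> kl.
apply: (@hausdorff_boxes_fin _ _ 'I_k (closed_cell c) (fun y i => cell_coord y 0 i) L L0);
  rewrite ?card_ord//.
  by move=> _ i [t ht <-]; rewrite paramK; exact: ref_closed_itv ht i.
by move=> _ _ [t _ <-] [s _ <-]; rewrite !paramK; exact: enorm_paramB.
Qed.

(** A part of the closed cell on which one coordinate is controlled by the
    others has one dimension less. *)
Section face.
Variables (j : 'I_k) (F : set 'rV[R]_k).
Hypothesis Fcl : F `<=` ref_closed (cshape c).
Hypothesis Fj : forall t s, F t -> F s ->
  `|t 0 j - s 0 j| <= \sum_(i | i != j) `|t 0 i - s 0 i|.

Let I := {i : 'I_k | i != j}.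

Let cardI : #|{: I}| = k.-1.
Proof. by rewrite card_sig cardC1 card_ord. Qed.

Let faceL : forall x y, (param c @` F) x -> (param c @` F) y ->
  enorm (x - y) <= (2 * L) * \sum_(i : I) `|cell_coord x 0 (val i) - cell_coord y 0 (val i)|.
Proof.
move=> _ _ [t Ft <-] [s Fs <-]; rewrite !paramK; apply: le_trans (enorm_paramB _ _) _.
rewrite -mulrA mulrCA ler_wpM2l//.
have -> : \sum_(i : I) `|t 0 (val i) - s 0 (val i)| = \sum_(i | i != j) `|t 0 i - s 0 i|.
  by rewrite [RHS](reindex_omap (val : I -> 'I_k) insub)//=;
    [apply: eq_bigl => -[i ij]; rewrite /= ij insubT eqxx|move=> i ij; rewrite insubT].
rewrite (bigD1 j)//= mulr_natl mulr2n lerD2r.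
exact: Fj.
Qed.

Let L20 : 0 <= 2 * L. Proof. by rewrite mulr_ge0. Qed.

Let c01 : forall x (i : I), (param c @` F) x -> 0 <= cell_coord x 0 (val i) <= 1.
Proof. by move=> _ i [t /Fcl ht <-]; rewrite paramK; exact: ref_closed_itv ht _. Qed.

Lemma hausdorff_face_fin l : (k.-1 <= l)%N -> (hausdorff l (param c @` F) < +oo)%E.
Proof. by move=> kl; apply: (hausdorff_boxes_fin L20 c01 faceL); rewrite cardI. Qed.

Lemma hausdorff_face_null l : (k.-1 < l)%N -> hausdorff l (param c @` F) = 0.
Proof. by move=> kl; apply: (hausdorff_boxes_null L20 c01 faceL); rewrite cardI. Qed.

End face.

Let face (p : 'I_k * 'I_3) : set 'rV[R]_k := ref_closed (cshape c) `&`
  [set t | match val p.2 with 0%N => t 0 p.1 = 0 | 1%N => t 0 p.1 = 1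
           | _ => \sum_i t 0 i = 1 end].

Let faceP p : forall t s, face p t -> face p s ->
  `|t 0 p.1 - s 0 p.1| <= \sum_(i | i != p.1) `|t 0 i - s 0 i|.
Proof.
case: p => j [[|[|i]] ip] t s; rewrite /face/= => -[_ tp] [_ sp].
- by rewrite tp sp subrr normr0 sumr_ge0.
- by rewrite tp sp subrr normr0 sumr_ge0.
- have -> : t 0 j - s 0 j = - \sum_(i | i != j) (t 0 i - s 0 i).
    move: tp sp; rewrite (bigD1 j)//= => tp; rewrite (bigD1 j)//= => sp.
    by rewrite sumrB; move: tp sp; move: (\sum_(i | _) _) (\sum_(i | _) _) => a b; lra.
  by rewrite normrN ler_norm_sum.
Qed.

(** A point of the boundary attains one of the bounds of the reference cell. On the
    slanted face of the simplex any coordinate may be dropped. *)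
Lemma cell_boundary : closed_cell c `\` open_cell c `<=`
  \bigcup_(p in [set: 'I_k * 'I_3]) (param c @` face p).
Proof.
move=> _ [[t tc <-] nopen].
have {}nopen : ~ ref_open (cshape c) t by move=> to; apply: nopen; exists t.
suff [p fp] : exists p, face p t by exists p => //; exists t.
pose i0 : 'I_3 := inord 0; pose i1 : 'I_3 := inord 1; pose i2 : 'I_3 := inord 2.
have e0 : val i0 = 0%N by rewrite /= inordK.
have e1 : val i1 = 1%N by rewrite /= inordK.
have e2 : val i2 = 2%N by rewrite /= inordK.
move: tc nopen; rewrite /face; case: (cshape c) => /= [[t0 t1] | t01].
  move=> /not_andP[/existsNP[j /negP]|/negP].
    rewrite -leNgt => tj; exists (j, i0); split=> //=; rewrite e0.
    by apply/eqP; rewrite eq_le tj t0.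
  rewrite -leNgt => t1'; have st : \sum_j t 0 j = 1 by apply/eqP; rewrite eq_le t1 t1'.
  have [j _] : exists j : 'I_k, true.
    case: (pickP [pred j : 'I_k | true]) => [j _|none]; first by exists j.
    by move: st; rewrite big_pred0// => /esym/eqP; rewrite oner_eq0.
  by exists (j, i2); split=> //=; rewrite e2.
move=> /existsNP[j /negP]; have /andP[tj0 tj1] := t01 j.
rewrite negb_and -!leNgt => /orP[tj|tj].
  by exists (j, i0); split=> //=; rewrite e0; apply/eqP; rewrite eq_le tj tj0.
by exists (j, i1); split=> //=; rewrite e1; apply/eqP; rewrite eq_le tj tj1.
Qed.

Lemma hausdorff_cell_boundary_fin l : (k.-1 <= l)%N ->
  (hausdorff l (closed_cell c `\` open_cell c) < +oo)%E.
Proof.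
move=> kl; apply: le_lt_trans (hausdorff_fin_cover cell_boundary) _.
apply: lte_sum_pinfty => p _; apply: (@hausdorff_face_fin p.1) => //; last exact: faceP.
by move=> t [].
Qed.

Lemma hausdorff_cell_boundary_null l : (k.-1 < l)%N ->
  hausdorff l (closed_cell c `\` open_cell c) = 0.
Proof.
move=> kl; apply/eqP; rewrite eq_le hausdorff_ge0 andbT.
apply: le_trans (hausdorff_fin_cover cell_boundary) _.
rewrite big1// => p _; apply: (@hausdorff_face_null p.1) => //; last exact: faceP.
by move=> t [].
Qed.

Lemma open_cell_convex x v (a : R) : 0 <= a <= 1 -> open_cell c x ->
  open_cell c (x + v) -> open_cell c (x + a *: v).
Proof.
move=> a01 [t ht tx] [s hs sx]; exists ((1 - a) *: t + a *: s).
  exact: ref_open_convex.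
have -> : v = param c s - param c t by rewrite sx tx addrC addKr.
rewrite -tx paramB /param mulmxDl -!scalemxAl mulmxBl.
by apply/rowP => j; rewrite !mxE; ring.
Qed.

Lemma open_cell_nonempty : exists x, open_cell c x.
Proof. by have [t ht] := ref_open_nonempty (cshape c); exists (param c t), t. Qed.

Lemma open_cell_closed_cell : open_cell c `<=` closed_cell c.
Proof. by move=> _ [t /ref_open_closed ht <-]; exists t. Qed.

Lemma cell_coord_continuous i : continuous (fun y => cell_coord y 0 i).
Proof.
move=> y; rewrite /cell_coord.
rewrite (_ : (fun y => _) = fun y => \sum_j (y 0 j - origin c 0 j) * E' j i); last first.
  by apply/funext => z; rewrite mxE; apply: eq_bigr => j _; rewrite !mxE.
apply: (@cvg_sumr _ _ (nbhs y) _) => j; apply: (@cvgM _ _ (nbhs y) _); last exact: cvg_cst.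
by apply: (@cvgB _ _ _ (nbhs y) _); [exact: coord_continuous|exact: cvg_cst].
Qed.

End cells.

(** ** Topology of cells *)

Section topology_of_cells.
Context {R : realType} {m : nat}.
Implicit Types (y : 'rV[R]_m).

Lemma closed_forall_ge0 (I : Type) (f : I -> 'rV[R]_m -> R) :
  (forall i, continuous (f i)) -> closed [set y | forall i, 0 <= f i y].
Proof.
move=> cf.
have -> : [set y | forall i, 0 <= f i y] =
    \bigcap_(i in [set: I]) f i @^-1` [set z | 0 <= z].
  by apply/seteqP; split=> [y h i _|y h i]; exact: h.
apply: closed_bigI => i _; apply: preimage_closed; last exact: closed_ge.
by move=> y _; exact: cf.
Qed.

Lemma open_forall_gt0 (I : finType) (f : I -> 'rV[R]_m -> R) :
  (forall i, continuous (f i)) -> open [set y | forall i, 0 < f i y].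
Proof.
move=> cf; rewrite openE => y fy; apply: (@filter_forall _ _ _ (nbhs y)) => i.
have : open (f i @^-1` [set z | 0 < z]).
  by apply: open_comp; [move=> z _; exact: cf|exact: open_gt].
by rewrite openE => /(_ y (fy i)).
Qed.

Lemma continuous_sumr (I : finType) (f : I -> 'rV[R]_m -> R) :
  (forall i, continuous (f i)) -> continuous (fun y => \sum_i f i y).
Proof. by move=> cf y; apply: (@cvg_sumr _ _ (nbhs y) _) => i; exact: cf. Qed.

Lemma continuousBr (f g : 'rV[R]_m -> R) :
  continuous f -> continuous g -> continuous (fun y => f y - g y).
Proof. by move=> cf cg y; apply: (@cvgB _ _ _ (nbhs y) _); [exact: cf|exact: cg]. Qed.

Lemma continuousDr (f g : 'rV[R]_m -> R) :
  continuous f -> continuous g -> continuous (fun y => f y + g y).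
Proof. by move=> cf cg y; apply: (@cvgD _ _ _ (nbhs y) _); [exact: cf|exact: cg]. Qed.

Lemma continuousMr (f g : 'rV[R]_m -> R) :
  continuous f -> continuous g -> continuous (fun y => f y * g y).
Proof. by move=> cf cg y; apply: (@cvgM _ _ (nbhs y) _); [exact: cf|exact: cg]. Qed.

Lemma continuous_cstr (a : R) : continuous (fun _ : 'rV[R]_m => a).
Proof. by move=> y; exact: (@cvg_cst _ _ _ (nbhs y) _). Qed.

End topology_of_cells.

Section closed_cells.
Context {R : realType} {n k : nat} (c : @cell R n k).
Hypothesis wf : cell_wf c.

Lemma closed_cellE y : closed_cell c y <->
  ref_closed (cshape c) (cell_coord wf y) /\ param c (cell_coord wf y) = y.
Proof.
split=> [[t ht <-]|[ht py]]; first by rewrite paramK.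
by exists (cell_coord wf y).
Qed.

Lemma closed_closed_cell : closed (closed_cell c).
Proof.
pose f := cell_coord wf.
have cf i : continuous (fun y => f y 0 i) by exact: cell_coord_continuous.
pose A1 := [set y | forall i, 0 <= f y 0 i].
pose A2 := match cshape c with
  | Simplex => [set y | forall i : unit, 0 <= 1 - \sum_j f y 0 j]
  | Box => [set y | forall i, 0 <= 1 - f y 0 i] end.
pose A3 := [set y | forall j, 0 <= 0 - (param c (f y) 0 j - y 0 j) * (param c (f y) 0 j - y 0 j)].
have -> : closed_cell c = A1 `&` A2 `&` A3.
  apply/seteqP; split=> y.
    move=> /closed_cellE[]; rewrite -/f => rc py; split; last first.
      by move=> j; rewrite py subrr mulr0 subr0.
    split=> [i|]; first by have /andP[] := ref_closed_itv rc i.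
    move: rc; rewrite /A2; case: (cshape c) => /= [[_ t1] _|h i].
      by rewrite subr_ge0.
    by rewrite subr_ge0; have /andP[] := h i.
  move=> [[y1 y2] y3]; apply/closed_cellE; rewrite -/f; split.
    move: y2; rewrite /A2; case: (cshape c) => /= [/(_ tt)|h].
      by rewrite subr_ge0.
    by move=> j; rewrite y1/= -subr_ge0.
  apply/rowP => j; apply/eqP; rewrite -subr_eq0 -sqrf_eq0 eq_le sqr_ge0 andbT.
  by have := y3 j; rewrite sub0r oppr_ge0 -expr2.
have cparam j : continuous (fun y => param c (f y) 0 j - y 0 j).
  apply: continuousBr; last exact: coord_continuous.
  rewrite (_ : (fun y => _) = fun y => origin c 0 j + \sum_i f y 0 i * edges c i j); last first.
    by apply/funext => y; rewrite !mxE.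
  apply: continuousDr; first exact: continuous_cstr.
  by apply: continuous_sumr => i; apply: continuousMr => //; exact: continuous_cstr.
apply: closedI; first apply: closedI.
- exact: closed_forall_ge0.
- rewrite /A2; case: (cshape c); apply: closed_forall_ge0 => i; apply: continuousBr => //;
    try exact: continuous_cstr.
  exact: continuous_sumr.
- apply: closed_forall_ge0 => j; apply: continuousBr; first exact: continuous_cstr.
  exact: continuousMr.
Qed.

Lemma closed_cell_hmeasurable l : measurable (closed_cell c : set (hspace R n.+1 l)).
Proof. exact/closed_hmeasurable/closed_closed_cell. Qed.

(** The boundary of a cell is null for the measure of the dimension of the cell,
    and null sets are measurable. *)
Lemma open_cell_hmeasurable : (0 < k)%N -> measurable (open_cell c : set (hspace R n.+1 k)).
Proof.
move=> k0; have -> : open_cell c = closed_cell c `\` (closed_cell c `\` open_cell c).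
  rewrite setDD; apply/seteqP; split=> [y oy|y []//].
  by split=> //; exact: open_cell_closed_cell.
apply: measurableD; first exact: closed_cell_hmeasurable.
by apply: null_hmeasurable; apply: hausdorff_cell_boundary_null => //; rewrite prednK.
Qed.

End closed_cells.

Section open_cells.
Context {R : realType} {n : nat} (c : @cell R n n.+1).
Hypothesis wf : cell_wf c.

Lemma param_full y : param c (cell_coord wf y) = y.
Proof.
rewrite /param -[in RHS](addrNK (origin c) y) addrC; congr (_ + _).
rewrite /cell_coord; set F := projT1 _.
have EF : edges c *m F = 1%:M by exact: projT2 (cid (cell_coordinates wf)).
by rewrite -mulmxA (mulmx1C EF) mulmx1.
Qed.

Lemma open_open_cell : open (open_cell c).
Proof.
pose f := cell_coord wf.
have cf i : continuous (fun y => f y 0 i) by exact: cell_coord_continuous.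
have -> : open_cell c = f @^-1` ref_open (cshape c).
  apply/seteqP; split=> [_ [t ht <-]|y fy]; first by rewrite /= /f paramK.
  by exists (f y) => //; exact: param_full.
case: (cshape c) => /=.
  have -> : f @^-1` ref_open Simplex =
      [set y | forall i, 0 < f y 0 i] `&` [set y | forall i : unit, 0 < 1 - \sum_j f y 0 j].
    apply/seteqP; split=> y [h1 h2]; split=> //; first by move=> _; rewrite subr_gt0.
    by have := h2 tt; rewrite subr_gt0.
  apply: openI; apply: open_forall_gt0 => // _; apply: continuousBr.
    exact: continuous_cstr.
  exact: continuous_sumr.
have -> : f @^-1` ref_open Box =
    [set y | forall i, 0 < f y 0 i] `&` [set y | forall i, 0 < 1 - f y 0 i].
  apply/seteqP; split=> [y h|y [h1 h2] i].
    by split=> i; have /andP[? ?] := h i; rewrite ?subr_gt0.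
  by rewrite h1/= -subr_gt0; exact: h2.
apply: openI; apply: open_forall_gt0 => // i; apply: continuousBr => //.
exact: continuous_cstr.
Qed.

End open_cells.

(** * Raviart-Thomas fields *)

Section rt0_local.
Context {R : realType} {n k : nat} (c : @cell R n k) (u : 'rV[R]_n.+1 -> 'rV[R]_n.+1).

(** A common form for the two shapes: in the coordinates of the cell the linear part
    is diagonal, and scalar on simplices. *)
Lemma rt0_localE : rt0_local c u -> exists a b : 'rV[R]_k, forall t,
  ref_open (cshape c) t ->
  u (param c t) = (\row_j (a 0 j + b 0 j * t 0 j)) *m edges c.
Proof.
rewrite /rt0_local; case: (cshape c) => [[a [b h]]|//].
exists a, (const_mx b) => t /h ->; congr (_ *m _).
by apply/rowP => j; rewrite !mxE.
Qed.

Hypothesis wf : cell_wf c.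

Lemma rt0_local_affine : rt0_local c u -> exists A : 'rV[R]_n.+1 -> 'rV[R]_n.+1,
  (forall y, open_cell c y -> u y = A y) /\ forall j, continuous (fun y => A y 0 j).
Proof.
move=> /rt0_localE[a [b h]].
exists (fun y => (\row_j (a 0 j + b 0 j * cell_coord wf y 0 j)) *m edges c).
split=> [_ [t ht <-]|j]; first by rewrite paramK h.
rewrite (_ : (fun y => _) = fun y => \sum_i
    (a 0 i + b 0 i * cell_coord wf y 0 i) * edges c i j); last first.
  by apply/funext => y; rewrite mxE; apply: eq_bigr => i _; rewrite mxE.
apply: continuous_sumr => i; apply: continuousMr; last exact: continuous_cstr.
apply: continuousDr; first exact: continuous_cstr.
by apply: continuousMr; [exact: continuous_cstr|exact: cell_coord_continuous].
Qed.

Lemma rt0_local_bounded : rt0_local c u ->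
  exists B : R, forall y, open_cell c y -> enorm (u y) <= B.
Proof.
move=> /rt0_localE[a [b h]].
exists (\sum_i (`|a 0 i| + `|b 0 i|) * enorm (row i (edges c))).
move=> _ [t ht <-]; rewrite h// mulmx_sum_row.
have ti := ref_closed_itv (ref_open_closed ht).
elim/big_ind2 : _ => [|x a' z b' xa zb|i _]; first by rewrite enorm0.
  by rewrite (le_trans (enormD _ _))// lerD.
rewrite enormZ ler_wpM2r ?enorm_ge0// mxE (le_trans (ler_normD _ _))// lerD2l.
have /andP[t0 t1] := ti i.
by rewrite normrM ler_piMr// ger0_norm.
Qed.

End rt0_local.

(** * Finite element spaces on the fracture *)

Section fracture_mesh.
Context {R : realType} {n : nat}.
Notation pt := 'rV[R]_n.+1.
Hypothesis n0 : (0 < n)%N.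
Variables (gam : set pt) (J : finType) (G : J -> @cell R n n).
Hypothesis hG : is_partition G gam.

Let wf j : cell_wf (G j). Proof. by case: hG. Qed.

Lemma hausdorff_fracture_fin : (hausdorff n gam < +oo)%E.
Proof.
have [_ _ _ cov] := hG; apply: le_lt_trans (hausdorff_fin_cover cov) _.
by apply: lte_sum_pinfty => j _; exact: hausdorff_closed_cell.
Qed.

Lemma ae_open_cell :
  {ae Hmeasure R n.+1 n, forall x, gam x -> exists j, open_cell (G j) x}.
Proof.
pose N := \bigcup_(j in [set: J]) (closed_cell (G j) `\` open_cell (G j)).
have N0 : hausdorff n N = 0.
  apply/eqP; rewrite eq_le hausdorff_ge0 andbT.
  apply: le_trans (hausdorff_fin_cover (@subset_refl _ N)) _.
  rewrite big1// => j _; apply: hausdorff_cell_boundary_null => //.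
  by rewrite prednK.
exists N; split=> //; first exact: null_hmeasurable.
move=> x /not_implyP[gx nx]; have [_ _ _ /(_ x gx)[j _ cx]] := hG.
by exists j => //; split=> // ox; apply: nx; exists j.
Qed.

Lemma open_cell_unique i j x : open_cell (G i) x -> open_cell (G j) x -> i = j.
Proof.
move=> xi xj; apply/eqP; apply: contraT => ij.
by have [_ _ /(_ i j ij) d _] := hG; have : (open_cell (G i) `&` open_cell (G j)) x by []; rewrite d.
Qed.

Definition step_function (a : J -> R) (x : pt) : R := \sum_j a j * \1_(open_cell (G j)) x.

Lemma step_function_on a j x : open_cell (G j) x -> step_function a x = a j.
Proof.
move=> xj; rewrite /step_function (bigD1 j)//= big1 ?addr0.
  by rewrite indicE mem_set// mulr1.
move=> i ij; rewrite indicE memNset ?mulr0// => xi.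
by rewrite (open_cell_unique xi xj) eqxx in ij.
Qed.

Lemma step_function_off a x : (forall j, ~ open_cell (G j) x) -> step_function a x = 0.
Proof. by move=> xo; rewrite /step_function big1// => j _; rewrite indicE memNset ?mulr0. Qed.

Lemma step_function_P0 a : P0_space G (step_function a).
Proof.
split=> [x|j]; first exact: step_function_off.
by exists (a j) => x; exact: step_function_on.
Qed.

Lemma P0_step_function q : P0_space G q -> exists a, q = step_function a.
Proof.
move=> [q0 qc]; have [a ha] := choice qc; exists a; apply/funext => x.
have [[j xj]|nx] := pselect (exists j, open_cell (G j) x).
  by rewrite (step_function_on _ xj) (ha j).
have {}nx j : ~ open_cell (G j) x by move=> xj; apply: nx; exists j.
by rewrite q0// step_function_off.
Qed.

Lemma P0_bounded_measurable q : P0_space G q -> bounded_measurable (k := n) gam q.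
Proof.
move=> /P0_step_function[a ->]; split.
  apply: measurable_sum => j; apply: measurable_funM => //.
  by apply: measurable_indic; exact: open_cell_hmeasurable.
exists (\sum_j `|a j|) => x _; rewrite (le_trans (ler_norm_sum _ _ _))//.
apply: ler_sum => j _; rewrite normrM ler_piMr// indicE.
by case: (_ \in _); rewrite ?normr1 ?normr0.
Qed.

Lemma P0_lincomb q q' (b : R) : P0_space G q -> P0_space G q' ->
  P0_space G (fun x => q x + b * q' x).
Proof.
move=> [q0 qc] [q'0 q'c]; split=> [x xo|j]; first by rewrite q0// q'0// mulr0 addr0.
have [a ha] := qc j; have [a' ha'] := q'c j.
by exists (a + b * a') => x xj; rewrite ha// ha'.
Qed.

End fracture_mesh.

Lemma ref_open_ray {R : realType} {k : nat} (sh : Defs.shape) (t z : 'rV[R]_k) :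
  ref_open sh t -> \forall h \near (0 : R), ref_open sh (t + h *: z).
Proof.
have cl (a b : R) : h * b + a @[h --> (0 : R)] --> a.
  rewrite -[X in _ --> X]add0r -[X in _ --> X + _](mul0r b).
  by apply: cvgD; [apply: cvgM; [exact: cvg_id|exact: cvg_cst]|exact: cvg_cst].
have pos (a b : R) : 0 < a -> \forall h \near (0 : R), 0 < a + h * b.
  move=> a0; near=> h; rewrite addrC; near: h.
  exact: (cvgr_gt a (cl a b) 0 a0).
case: sh => /= [[t0 t1]|ht].
  have t1' : 0 < 1 - \sum_j t 0 j by rewrite subr_gt0.
  near=> h; split.
    move=> j; rewrite !mxE; move: j; near: h; apply: filter_forall => j.
    exact: pos.
  under eq_bigr do rewrite !mxE.
  rewrite big_split/= -mulr_sumr -subr_gt0 opprD addrA -mulrN; near: h.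
  exact: pos.
near=> h => j; rewrite !mxE; move: j; near: h; apply: filter_forall => j.
have /andP[t0 t1] := ht j.
have t1' : 0 < 1 - t 0 j by rewrite subr_gt0.
near=> h; apply/andP; split; first by near: h; exact: pos.
by rewrite -subr_gt0 opprD addrA -mulrN; near: h; exact: pos.
Unshelve. all: by end_near. Qed.

(** * The tangential divergence *)

Section tangential_divergence.
Context {R : realType} {n : nat}.
Notation pt := 'rV[R]_n.+1.
Variables (Omega : set pt) (Om : 'I_2 -> set pt) (gam : set pt).
Hypothesis hOmega : fractured_domain Omega Om gam.
Variables (Fr : pt -> 'M[R]_(n, n.+1)).
Hypothesis hFr : tangent_frame Om gam Fr.
Variable c : @cell R n n.
Hypotheses (wf : cell_wf c) (cgam : open_cell c `<=` gam).

(** The cell is flat, so that its edges and the frame span the same hyperplane,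
    the orthogonal of the normal. *)
Lemma tangent_frame_edges x : open_cell c x -> exists Y, Fr x = Y *m edges c.
Proof.
move=> cx; have gx := cgam cx; pose nu := normal (Om 0) x.
have nu0 : nu != 0.
  by rewrite -enorm_eq0 (enorm_normal hOmega)// oner_eq0.
have tang (z : 'rV[R]_n) : dot (z *m edges c) nu = 0.
  case: cx => t ht tx; apply: (normal_tangent hOmega) => //.
  have /nbhs_ballP[e /= e0 he] := ref_open_ray z ht.
  exists e => // s se; apply: cgam; exists (t + s *: z).
    by apply: he; rewrite -ball_normE/= sub0r normrN.
  by rewrite -tx /param mulmxDl -scalemxAl addrA.
have rk : \rank (kermx nu^T) = n.
  by rewrite mxrank_ker mxrank_tr rank_rV nu0 subn1.
have EK : (edges c <= kermx nu^T)%MS.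
  apply/sub_kermxP/row_matrixP => i; rewrite row_mul row0 rowE.
  by apply/rowP => j; rewrite ord1 -dotE tang mxE.
have FK : (Fr x <= kermx nu^T)%MS.
  by apply/sub_kermxP; have [/(_ x gx)[_ /(_ 0)]] := hFr.
apply/submxP; apply: submx_trans FK _.
have [_ rE] := mxrank_leqif_sup EK; rewrite -rE rk.
by case: wf => /eqP ->.
Qed.

Lemma rt0_local_derive u (a b t z : 'rV[R]_n) :
  (forall t, ref_open (cshape c) t ->
    u (param c t) = (\row_j (a 0 j + b 0 j * t 0 j)) *m edges c) ->
  ref_open (cshape c) t ->
  'D_(z *m edges c) u (param c t) = z *m diag_mx b *m edges c.
Proof.
move=> hu ht; rewrite /derive; apply: lim_near_cst => //.
have := ref_open_ray z ht => /nbhs_ballP[e /= e0 he].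
apply/nbhs_ballP; exists e => // h hh /= h0.
have -> : h *: (z *m edges c) + param c t = param c (t + h *: z).
  by rewrite /param mulmxDl -scalemxAl [RHS]addrC -addrA addrC addrA addrC.
rewrite hu; last exact: he.
rewrite hu// -mulmxBl scalemxAl; congr (_ *m _).
rewrite mul_mx_diag; apply/rowP => j; rewrite !mxE.
by field.
Qed.

(** In cell coordinates the tangential divergence is the trace of the diagonal
    linear part of the field, whichever orthonormal frame is used. *)
Lemma tdiv_constant u : rt0_local c u ->
  exists d : R, forall x, open_cell c x -> tdiv Fr u x = d.
Proof.
move=> /rt0_localE[a [b hu]]; exists (\tr (diag_mx b)) => x cx.
have [Y FY] := tangent_frame_edges cx.
have FF : Y *m (edges c *m (Fr x)^T) = 1%:M.
  by rewrite mulmxA -FY; have [/(_ x (cgam cx))[]] := hFr.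
transitivity (\tr (Y *m diag_mx b *m edges c *m (Fr x)^T)).
  rewrite /tdiv /mxtrace; apply: eq_bigr => j _.
  case: cx => t ht tx; rewrite {1}FY row_mul -tx (rt0_local_derive _ hu ht) tx.
  rewrite -!row_mul /dot [RHS]mxE; apply: eq_bigr => k _.
  by rewrite ![row _ _ _ _]mxE [(_^T)%R _ _]mxE.
by rewrite -!mulmxA mxtrace_mulC -mulmxA (mulmx1C FF) mulmx1.
Qed.

End tangential_divergence.

(** * Normal traces *)

Lemma cvg_rowP {R : realType} {m : nat} {T : Type} {F : set_system T} {FF : Filter F}
  (g : T -> 'rV[R]_m) (l : 'rV[R]_m) :
  (forall j, g x 0 j @[x --> F] --> l 0 j) -> g x @[x --> F] --> l.
Proof.
move=> gl; apply/cvg_ballP => e e0.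
have : \forall x \near F, forall j, ball (l 0 j) e (g x 0 j).
  by apply: filter_forall => j; have /cvg_ballP/(_ e e0) := gl j.
by apply: filterS => x h; split=> // i j; rewrite ord1.
Qed.

Section continuous_on_within.
Context {R : realType} {m : nat} (D : set 'rV[R]_m).

Lemma continuous_onE (f : 'rV[R]_m -> R) : continuous_on D f <->
  forall x, D x -> f y @[y --> within D (nbhs x)] --> f x.
Proof.
split=> [cf x Dx|cf x Dx e e0].
  apply/cvgrPdist_lt => e e0; have [r r0 rf] := cf x Dx e e0.
  rewrite near_withinE; apply/nbhs_enormP; exists r => // y yx Dy.
  by rewrite distrC rf.
have /cvgrPdist_lt/(_ e e0) := cf x Dx.
rewrite near_withinE => /nbhs_enormP[r r0 rf]; exists r => // y Dy yx.
by rewrite distrC rf.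
Qed.

End continuous_on_within.

Section normal_traces.
Context {R : realType} {n : nat}.
Notation pt := 'rV[R]_n.+1.
Variables (I : finType) (T : I -> @cell R n n.+1) (v : pt -> pt).
Hypotheses (wf : forall i, cell_wf (T i)).
Hypotheses (disj : forall i j, i != j -> open_cell (T i) `&` open_cell (T j) = set0).
Hypotheses (v0 : null_off_cells T v) (vloc : forall i, rt0_local (T i) v).

Lemma field_bounded : exists B : R, forall x, enorm (v x) <= B.
Proof.
have [B hB] := choice (fun i => rt0_local_bounded (vloc i)).
have B0 : 0 <= \sum_i `|B i| by apply: sumr_ge0.
exists (\sum_i `|B i|) => x.
have [[i xi]|nx] := pselect (exists i, open_cell (T i) x).
  rewrite (le_trans (hB i x xi))// (le_trans (ler_norm _))// (bigD1 i)//= lerDl.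
  by apply: sumr_ge0.
by rewrite v0 ?enorm0// => i xi; apply: nx; exists i.
Qed.

Lemma near_right_itv (P : R -> Prop) (e : R) : 0 < e ->
  (forall t, 0 < t < e -> P t) -> \forall t \near (0 : R)^'+, P t.
Proof.
move=> e0 h; near=> t; apply: h; apply/andP; split; near: t.
  exact: nbhs_right_gt.
exact: nbhs_right_lt.
Unshelve. all: by end_near. Qed.

(** By convexity a ray is eventually inside or eventually outside an open cell. *)
Lemma ray_dichotomy i (x nu : pt) :
  (\forall t \near (0 : R)^'+, open_cell (T i) (x - t *: nu)) \/
  (\forall t \near (0 : R)^'+, ~ open_cell (T i) (x - t *: nu)).
Proof.
have [[e e0 he]|ne] := pselect (exists2 e : R, 0 < e &
    forall t, 0 < t < e -> ~ open_cell (T i) (x - t *: nu)).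
  by right; exact: near_right_itv he.
left.
have inside (e : R) : 0 < e -> exists2 t, 0 < t < e & open_cell (T i) (x - t *: nu).
  move=> e0; apply: contrapT => h; apply: ne; exists e => // t te ot.
  by apply: h; exists t.
have [t1 /andP[t10 _] o1] := inside 1 ltr01.
apply: (near_right_itv t10) => t /andP[t0 tt1].
have [t2 /andP[t20 t2t] o2] := inside t t0.
have t12 : 0 < t1 - t2 by lra.
have -> : x - t *: nu = x - t2 *: nu + ((t - t2) / (t1 - t2)) *: ((t2 - t1) *: nu).
  by apply/rowP => j; rewrite !mxE; field; rewrite gt_eqF.
apply: open_cell_convex => //.
  apply/andP; split; first by rewrite divr_ge0 ?subr_ge0 ?ltW// (lt_trans t2t).
  by rewrite ler_pdivrMr// mul1r lerB// ltW.
rewrite (_ : _ + _ = x - t1 *: nu)//.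
by apply/rowP => j; rewrite !mxE; ring.
Qed.

(** Near its origin the ray lies in a cell, where the field is affine, or outside
    all of them, where it vanishes. *)
Lemma trace_cvg (x nu : pt) : cvg (dot (v (x - t *: nu)) nu @[t --> (0 : R)^'+]).
Proof.
have [[i hi]|none] := pselect (exists i,
    \forall t \near (0 : R)^'+, open_cell (T i) (x - t *: nu)).
  have [A [vA cA]] := rt0_local_affine (wf i) (vloc i).
  apply/cvg_ex; exists (dot (A x) nu).
  have lim : dot (A (x - t *: nu)) nu @[t --> (0 : R)^'+] --> dot (A x) nu.
    apply: cvg_at_right_filter; apply: cvg_sumr => j; apply: cvgM; last exact: cvg_cst.
    have cl : x - t *: nu @[t --> (0 : R)] --> x.
      rewrite (_ : (fun t => _) = fun t => x + t *: (- nu)); last first.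
        by apply/funext => t; rewrite scalerN.
      rewrite [X in _ --> X](_ : x = x + 0 *: (- nu)); last by rewrite scale0r addr0.
      exact: line_continuous.
    exact: cvg_comp cl (cA j x).
  apply: cvg_trans lim; apply: near_eq_cvg; near=> t.
  by rewrite vA//; near: t.
apply/cvg_ex; exists 0.
have zero : \forall t \near (0 : R)^'+, forall i, ~ open_cell (T i) (x - t *: nu).
  apply: filter_forall => i; have [h|//] := ray_dichotomy i x nu.
  by exfalso; apply: none; exists i.
have lim : (0 : R) @[t --> (0 : R)^'+] --> (0 : R) by exact: cvg_cst.
apply: cvg_trans lim; apply: near_eq_cvg; near=> t.
by rewrite v0 ?dot0l//; near: t.
Unshelve. all: by end_near. Qed.

Lemma normal_trace_cvg (A : set pt) x :
  dot (v (x - t *: normal A x)) (normal A x) @[t --> (0 : R)^'+] --> normal_trace A v x.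
Proof. exact: trace_cvg. Qed.

Lemma normal_trace_bounded : exists B : R, forall (A : set pt) x,
  `|normal_trace A v x| <= B.
Proof.
have [B hB] := field_bounded; exists B => A x.
apply/ler_addgt0Pr => e e0.
have /cvgrPdist_le/(_ e e0)/filter_ex[t ht] := @normal_trace_cvg A x.
rewrite -[normal_trace A v x](subrK (dot (v (x - t *: normal A x)) (normal A x))).
rewrite addrC (le_trans (ler_normD _ _))// addrC [leRHS]addrC lerD//.
rewrite (le_trans (dot_le _ _))// (le_trans _ (hB (x - t *: normal A x)))//.
by rewrite ler_piMr ?enorm_ge0// enorm_normal_le1.
Qed.

(** The trace is the limit of the values at distance [1 / (p + 1)] inside the
    domain. Each of these is continuous in [x] on the relatively open set where
    the displaced point lies in a given open cell, and zero on the rest. *)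
Lemma normal_trace_measurable k (A D : set pt) :
  measurable (D : set (hspace R n.+1 k)) ->
  (forall j, continuous_on D (fun x => normal A x 0 j)) ->
  measurable_fun (D : set (hspace R n.+1 k)) (normal_trace A v : hspace R n.+1 k -> R).
Proof.
move=> mD cN.
have cNw x j : D x -> normal A y 0 j @[y --> within D (nbhs x)] --> normal A x 0 j.
  by move=> Dx; exact: (continuous_onE _ _).1 (cN j) x Dx.
pose y_ (p : nat) x := x - p.+1%:R^-1 *: normal A x.
have cy p x : D x -> y_ p z @[z --> within D (nbhs x)] --> y_ p x.
  move=> Dx; apply: cvg_rowP => j; rewrite /y_.
  under [X in X @ _ --> _]eq_fun do rewrite !mxE.
  rewrite !mxE; apply: cvgB; last by apply: cvgM; [exact: cvg_cst|exact: cNw].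
  by apply: cvg_within_filter; exact: coord_continuous.
have [Af hA] := choice (fun i => rt0_local_affine (wf i) (vloc i)).
pose P p i := [set x | open_cell (T i) (y_ p x)].
have mP p i : measurable (D `&` P p i : set (hspace R n.+1 k)).
  apply: relatively_open_measurable => // x Dx Px.
  have : nbhs (y_ p x) (open_cell (T i)).
    by apply: open_nbhs_nbhs; split=> //; exact: open_open_cell.
  exact: cy.
pose g p x := \sum_i \1_(D `&` P p i) x * dot (Af i (y_ p x)) (normal A x).
apply: (@measurable_fun_cvg _ (hspace R n.+1 k) R D g).
  move=> p; apply: measurable_sum => i; apply: measurable_funM.
    exact: measurable_indic.
  apply: continuous_on_measurable => //; apply/continuous_onE => x Dx.
  apply: cvg_sumr => j; apply: cvgM; last exact: cNw.
  exact: cvg_comp (cy p x Dx) ((hA i).2 j (y_ p x)).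
move=> x Dx.
have gE p : g p x = dot (v (y_ p x)) (normal A x).
  rewrite /g; have [[i yi]|ny] := pselect (exists i, open_cell (T i) (y_ p x)).
    rewrite (bigD1 i)//= indicE mem_set// mul1r (hA i).1// big1 ?addr0// => j ji.
    rewrite indicE memNset ?mul0r// => -[_ yj].
    by have := disj ji => /seteqP[/(_ (y_ p x)) h _]; apply: h.
  rewrite big1 => [|i _]; last by rewrite indicE memNset ?mul0r// => -[_ yi]; apply: ny; exists i.
  by rewrite v0 ?dot0l// => i yi; apply: ny; exists i.
rewrite (_ : g ^~ x = fun p => dot (v (y_ p x)) (normal A x)); last exact/funext.
have /cvg_at_rightP/(_ (fun p => p.+1%:R^-1)) := @normal_trace_cvg A x.
by apply; split=> [p|]; [rewrite invr_gt0|exact: cvg_harmonic].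
Qed.

End normal_traces.

(** * Estimates for the test pair *)

(** In the application [X] collects the terms in the velocity, and [P], [S] and [D]
    are the squares of the norms of the multiplier, of its interface part and of
    the divergence; [m] and [sg] are the cross terms. [Q] is the value of the form
    at the test pair, [N2] and [M2] are the squared norms of the given pair and of
    the test pair, in which [Smu] and [Pmu] come from the multiplier. *)
Section algebra.
Context {R : realType}.

Lemma normr_le_amgm (x A B : R) : 0 <= A -> 0 <= B -> x ^+ 2 <= A * B -> `|x| <= (A + B) / 2.
Proof.
move=> A0 B0 xAB; have AB0 : 0 <= (A + B) / 2 by rewrite divr_ge0 ?addr_ge0.
rewrite -(@ler_pXn2r _ 2)// ?nnegrE// real_normK ?num_real//.
apply: le_trans xAB _; have := sqr_ge0 (A - B); lra.
Qed.

Variables (a X P S D m sg Smu : R).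
Hypotheses (a0 : 0 <= a) (X0 : 0 <= X) (P0 : 0 <= P) (S0 : 0 <= S) (D0 : 0 <= D).
Hypotheses (mPD : m ^+ 2 <= P * D) (sgSD : sg ^+ 2 <= 2 * a * S * D) (SP : S <= 2 * a * P).

(** The multiple of [tau] times the divergence added to the multiplier. After Young's
    inequality, the cross terms take [test_weight^2 * (a + 1/2) * D] from the term
    [test_weight * D]: with this value, at most half of it. *)
Definition test_weight : R := (2 * (1 + a))^-1.

Let Q := X + P + S + test_weight * (m + D + sg).
Let Pmu := P + 2 * test_weight * m + test_weight ^+ 2 * D.
Hypothesis Smu_le : Smu <= 2 * a * Pmu.
Hypothesis Smu_ge0 : 0 <= Smu.
Let N2 := X + D + S + P.
Let M2 := X + D + Smu + Pmu.

Let test_weight_gt0 : 0 < test_weight.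
Proof. by rewrite /test_weight invr_gt0; move: a0; lra. Qed.

Let a1_gt0 : 0 < 1 + a.
Proof. by move: a0; lra. Qed.

Let a1 : 1 + a != 0.
Proof. by rewrite gt_eqF. Qed.

Let test_weightE : test_weight * (1 + a) = 1 / 2.
Proof. by rewrite /test_weight; field; rewrite a1. Qed.

Let kappa := test_weight - test_weight ^+ 2 * (a + 1 / 2).

Let kappaE : kappa = (a + 3 / 2) / (4 * (1 + a) ^+ 2).
Proof. by rewrite /kappa /test_weight; field; rewrite a1. Qed.

Let kappa_half : kappa <= 1 / 2.
Proof.
rewrite kappaE ler_pdivrMr; last by rewrite mulr_gt0// exprn_gt0.
by move: a0; rewrite expr2; nra.
Qed.

Let dm (c : R) : 0 <= c -> `|c * m| <= (P + c ^+ 2 * D) / 2.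
Proof.
move=> c0; apply: normr_le_amgm => //; first by rewrite mulr_ge0// sqr_ge0.
by rewrite exprMn [leRHS]mulrCA ler_wpM2l ?sqr_ge0.
Qed.

Lemma test_pair_coercive : kappa * N2 <= Q.
Proof.
have h1 : `|test_weight * m| <= (P + test_weight ^+ 2 * D) / 2 by apply: dm; exact: ltW.
have h2 : `|test_weight * sg| <= (S + 2 * a * test_weight ^+ 2 * D) / 2.
  apply: normr_le_amgm => //; first by rewrite !mulr_ge0 ?(ltW test_weight_gt0).
  rewrite exprMn (_ : S * _ = test_weight ^+ 2 * (2 * a * S * D)); last by ring.
  by rewrite ler_wpM2l ?sqr_ge0.
move: h1 h2; rewrite !ler_norml => /andP[h1 _] /andP[h2 _].
have k1 : kappa * (X + S + P) <= 1 / 2 * (X + S + P) by rewrite ler_wpM2r// !addr_ge0.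
have k2 : kappa * D = test_weight * D - test_weight ^+ 2 * D / 2 - a * test_weight ^+ 2 * D by rewrite /kappa; ring.
rewrite /N2 /Q (_ : X + D + S + P = (X + S + P) + D); last by ring.
rewrite mulrDr k2; move: (kappa * _) k1 h1 h2 => Z k1 h1 h2.
by move: X0 P0 S0 k1 h1 h2; rewrite /test_weight; move: ((2 * (1 + a))^-1) => t; lra.
Qed.

Lemma test_multiplier_ge0 : 0 <= Pmu.
Proof.
have : `|test_weight * m| <= (P + test_weight ^+ 2 * D) / 2 by apply: dm; exact: ltW.
by rewrite ler_norml /Pmu => /andP[h1 _]; lra.
Qed.

Lemma test_pair_norm : M2 <= (2 + 4 * a) * N2.
Proof.
have : `|test_weight * m| <= (P + test_weight ^+ 2 * D) / 2 by apply: dm; exact: ltW.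
rewrite ler_norml => /andP[_ h1].
have s2 : (1 + 2 * a) * test_weight ^+ 2 <= 1 / 4.
  have -> : 1 / 4 = (test_weight * (1 + a)) ^+ 2 by rewrite test_weightE; field.
  by rewrite exprMn mulrC ler_wpM2l ?sqr_ge0// expr2; move: a0; nra.
have s3 : (1 + 2 * a) * test_weight ^+ 2 * D <= 1 / 4 * D by rewrite ler_wpM2r.
have pm : (1 + 2 * a) * Pmu <= (1 + 2 * a) * (2 * P + 2 * test_weight ^+ 2 * D).
  by rewrite ler_wpM2l ?addr_ge0 ?mulr_ge0// /Pmu; lra.
have [aX [aD [aS aP]]] : 0 <= a * X /\ 0 <= a * D /\ 0 <= a * S /\ 0 <= a * P.
  by rewrite !mulr_ge0.
move: X0 D0 S0 aX aD aS aP s3 pm Smu_le; rewrite /M2 /N2.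
by move: Pmu test_weight => t u; lra.
Qed.

(** If the test pair has norm zero then so has the given pair: this excludes a
    vanishing denominator. *)
Lemma test_pair_definite : M2 <= 0 -> N2 <= 0.
Proof.
have : `|2 * test_weight * m| <= (P + (2 * test_weight) ^+ 2 * D) / 2 by apply: dm; rewrite mulr_ge0// ltW.
rewrite ler_norml => /andP[h1 _] M0.
have {}M0 : X + D + Smu + Pmu <= 0 by exact: M0.
have pm0 := test_multiplier_ge0.
have [D00 [X00 pm]] : D <= 0 /\ X = 0 /\ Pmu <= 0.
  by move: M0 pm0 X0 D0 Smu_ge0; move: Pmu => t; lra.
have {}D00 : D = 0 by move: D00 D0; lra.
have P00 : P = 0 by move: pm h1 P0; rewrite /Pmu D00 !mulr0; lra.
by move: SP; rewrite /N2 D00 X00 P00 mulr0; lra.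
Qed.

(** The quotient of the test pair, without denominators. *)
Lemma quotient_bound : Num.sqrt N2 * Num.sqrt M2 <= 6 * (1 + a) ^+ 2 * Q.
Proof.
have N0 : 0 <= N2 by rewrite !addr_ge0.
have M0 : 0 <= M2.
  by apply: addr_ge0; [rewrite !addr_ge0|exact: test_multiplier_ge0].
have c0 : 0 <= 3 / 2 * (a + 3 / 2) by move: a0; lra.
apply: (@le_trans _ _ (3 / 2 * (a + 3 / 2) * N2)).
  have l0 : 0 <= Num.sqrt N2 * Num.sqrt M2 by rewrite mulr_ge0 ?sqrtr_ge0.
  have u0 : 0 <= 3 / 2 * (a + 3 / 2) * N2 by exact: mulr_ge0.
  rewrite -(@ler_pXn2r _ 2)//.
  rewrite exprMn !sqr_sqrtr// exprMn [X in _ <= _ * X]expr2 mulrCA ler_wpM2l//.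
  by apply: le_trans test_pair_norm _; rewrite ler_wpM2r// expr2; move: a0; nra.
have -> : 3 / 2 * (a + 3 / 2) = 6 * (1 + a) ^+ 2 * kappa.
  by rewrite kappaE; field; rewrite a1.
by rewrite -[_ * kappa * N2]mulrA; apply: ler_wpM2l; [rewrite mulr_ge0 ?sqr_ge0|exact: test_pair_coercive].
Qed.

End algebra.

(** * Integrals of vector fields *)

Section vector_integrals.
Context {R : realType} {m k p : nat} (D : set 'rV[R]_m).
Hypothesis mD : measurable (D : set (hspace R m k)).
Implicit Types u v : 'rV[R]_m -> 'rV[R]_p.

Lemma l2vdot_ge0 u : 0 <= l2vdot k D u u.
Proof. by apply: Rintegral_ge0 => x _; exact: dot_ge0. Qed.

Lemma l2vnorm_sqr u : l2vnorm k D u ^+ 2 = l2vdot k D u u.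
Proof. by rewrite sqr_sqrtr// l2vdot_ge0. Qed.

Lemma in_L2_integrable u : (forall j, in_L2 k D (fun x => u x 0 j)) ->
  (Hmeasure R m k).-integrable D (EFin \o (fun x => dot (u x) (u x))).
Proof.
move=> uL2; rewrite (_ : EFin \o _ = fun x => (\sum_(j < p) (u x 0 j ^+ 2)%:E)%E).
  by apply: integrable_sum => // j _; have [] := uL2 j.
by apply/funext => x /=; rewrite /dot sumEFin; congr (_%:E); apply: eq_bigr => j _; rewrite expr2.
Qed.

Lemma l2vdotZ u (a : R) : (forall j, in_L2 k D (fun x => u x 0 j)) ->
  l2vdot k D (fun x => a *: u x) (fun x => a *: u x) = a ^+ 2 * l2vdot k D u u.
Proof.
move=> /in_L2_integrable uL2; rewrite /l2vdot -RintegralZl//.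
by apply: eq_Rintegral => x _; rewrite dotZl dotZr mulrA expr2.
Qed.

(** The integrand lies almost everywhere between two integrable functions, so that
    its integral is finite and can be compared. *)
Lemma conductivity_coercive (K : 'rV[R]_m -> 'M[R]_p) (E : set 'rV[R]_m) (c C : R) u :
  0 < c -> D `<=` E -> conductivity_tensor k E K c C ->
  (forall j, in_L2 k D (fun x => u x 0 j)) ->
  c * l2vdot k D u u <= l2vdot k D (fun x => mulmv (invmx (K x)) (u x)) u.
Proof.
move=> c0 DE [_ [N [mN N0 hN]]] uL2.
have iu := in_L2_integrable uL2.
pose f x := dot (mulmv (invmx (K x)) (u x)) (u x).
have bounds x : ~ N x -> D x ->
    c * dot (u x) (u x) <= f x /\ f x <= C * dot (u x) (u x).
  move=> nN Dx.
  have : ~ ~ (E x -> K x \in unitmx /\ forall z : 'rV[R]_p,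
     c * enorm z ^+ 2 <= dot z (mulmv (invmx (K x)) z) /\
     enorm (mulmv (invmx (K x)) z) <= C * enorm z) by move=> /hN.
  move=> /contrapT/(_ (DE x Dx))[_ /(_ (u x))[h1 h2]].
  rewrite /f dotC -!enorm_sqr; split=> //.
  apply: le_trans (le_trans (ler_norm _) (dot_le _ _)) _.
  by rewrite expr2 mulrCA ler_wpM2l ?enorm_ge0.
have lo : {ae Hmeasure R m k, forall x, D x -> (c * dot (u x) (u x))%:E <= (f x)%:E}%E.
  by exists N; split=> // x h; apply: contrapT => nN; apply: h => Dx; have [] := bounds x nN Dx.
have hi : {ae Hmeasure R m k, forall x, D x -> (f x)%:E <= (C * dot (u x) (u x))%:E}%E.
  by exists N; split=> // x h; apply: contrapT => nN; apply: h => Dx; have [] := bounds x nN Dx.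
have iZ (b : R) : (Hmeasure R m k).-integrable D (fun x => (b * dot (u x) (u x))%:E).
  exact: integrableZl iu.
rewrite /l2vdot -RintegralZl//; apply: ae_le_Rintegral => //.
- exact: integrable_fin_num (iZ c).
- rewrite fin_numElt; apply/andP; split.
    apply: lt_le_trans (ae_le_integral lo).
    by have := integrable_fin_num mD (iZ c); rewrite fin_numElt => /andP[].
  apply: le_lt_trans (ae_le_integral hi) _.
  by have := integrable_fin_num mD (iZ C); rewrite fin_numElt => /andP[].
Qed.

End vector_integrals.

(** * The inf-sup bound *)

Lemma inv_sqrt_dot {R : realType} {p : nat} (A B : 'M[R]_p) (z : 'rV[R]_p) :
  is_inv_sqrt A B -> dot (mulmv (invmx A) z) z = dot (mulmv B z) (mulmv B z).
Proof.
move=> [Bsym _ BB]; rewrite /mulmv -BB trmx_mul Bsym !dotE trmx_mul Bsym.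
by rewrite !mulmxA.
Qed.

Lemma ae_l2dot_congr {R : realType} {m k : nat} (D : set 'rV[R]_m) (f f' g g' : 'rV[R]_m -> R) :
  {ae Hmeasure R m k, forall x, D x -> f x = f' x} ->
  {ae Hmeasure R m k, forall x, D x -> g x = g' x} ->
  l2dot k D f g = l2dot k D f' g'.
Proof.
by move=> ff gg; rewrite (l2dot_ae_eql g ff) l2dotC (l2dot_ae_eql f' gg) l2dotC.
Qed.

Lemma sqr_sum_ord2 {R : realFieldType} (x : 'I_2 -> R) :
  (\sum_i x i) ^+ 2 <= 2 * \sum_i x i ^+ 2.
Proof.
rewrite !big_ord_recl !big_ord0 !addr0.
by move: (x _) (x _) => y z; have := sqr_ge0 (y - z); lra.
Qed.

Lemma l2dotZZ {R : realType} {m k : nat} (D : set 'rV[R]_m) :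
  measurable (D : set (hspace R m k)) -> (hausdorff k D < +oo)%E ->
  forall (c : R) f, bounded_measurable (k := k) D f ->
  l2dot k D (fun x => c * f x) (fun x => c * f x) = c ^+ 2 * l2dot k D f f.
Proof.
move=> mD Dfin c f bf; have bcf := bounded_measurableZ c bf.
rewrite (l2dotZr mD Dfin c bcf bf) l2dotC (l2dotZr mD Dfin c bf bf).
by rewrite mulrA expr2.
Qed.

Lemma nonneg_sum4_le0 {R : realFieldType} (x y z t : R) :
  0 <= x -> 0 <= y -> 0 <= z -> 0 <= t -> x + y + z + t <= 0 ->
  [/\ x = 0, y = 0, z = 0 & t = 0].
Proof. by move=> *; split; lra. Qed.

Section fracture_inf_sup.
Context {R : realType} {n : nat}.
Notation pt := 'rV[R]_n.+1.
Hypothesis n0 : (0 < n)%N.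
Variables (Omega : set pt) (Om : 'I_2 -> set pt) (gam : set pt).
Hypothesis hOmega : fractured_domain Omega Om gam.
Variables (Fr : pt -> 'M[R]_(n, n.+1)) (Kg Kgmh : pt -> 'M[R]_n).
Hypothesis hFr : tangent_frame Om gam Fr.
Hypothesis hKgmh : {ae Hmeasure R n.+1 n, forall x, gam x -> is_inv_sqrt (Kg x) (Kgmh x)}.
Variables (tau Lg : R).
Hypotheses (tau_gt0 : 0 < tau) (Lg_gt0 : 0 < Lg).
Variables (J : finType) (G : J -> @cell R n n).
Hypothesis hG : is_partition G gam.

Let Vg := RT0_space G gam Omega.
Let Mg := P0_space G.

Let mgam : measurable (gam : set (hspace R n.+1 n)). Proof. exact: gam_hmeasurable hOmega n. Qed.
Let gfin : (hausdorff n gam < +oo)%E. Proof. exact: hausdorff_fracture_fin hG. Qed.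
Let bm q : Mg q -> bounded_measurable (k := n) gam q.
Proof. exact: (P0_bounded_measurable n0 hG). Qed.

Lemma a_frac_sqr u :
  l2vnorm n gam (fun x => mulmv (Kgmh x) (tcoord Fr u x)) ^+ 2 = a_frac gam Fr Kg u u.
Proof.
rewrite l2vnorm_sqr; apply: ae_eq_Rintegral.
case: hKgmh => N [mN N0 hN]; exists N; split=> // x nx; apply: hN.
by apply: contra_not nx => h /h/inv_sqrt_dot ->.
Qed.

(** This is what allows the divergence in the test multiplier; the points of the
    fracture outside the open cells form a null set. *)
Lemma tdiv_P0 u : Vg u ->
  exists2 d, Mg d & {ae Hmeasure R n.+1 n, forall x, gam x -> tdiv Fr u x = d x}.
Proof.
move=> [_ uloc _]; have [wf sub _ _] := hG.
have [a ha] := choice (fun j => tdiv_constant hOmega hFr (wf j) (sub j) (uloc j)).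
exists (step_function G a); first exact: step_function_P0 hG a.
have [N [mN N0 hN]] := ae_open_cell n0 hG.
exists N; split=> // x nx; apply: hN; apply: contra_not nx => h gx.
have [j xj] := h gx.
by rewrite (ha j _ xj) (step_function_on hG a xj).
Qed.

Lemma Vg_L2 u : Vg u -> forall j, in_L2 n gam (fun x => u x 0 j).
Proof. by case=> _ _ []. Qed.

Section local_solver.
Variables (us : 'I_2 -> (pt -> R) -> pt -> pt) (at_ : R).
Hypothesis at_ge0 : 0 <= at_.
Notation s := (s_frac Om gam us).
Notation tr i lam := (normal_trace (Om i) (us i lam)).
Hypothesis btr : forall i lam, Mg lam -> bounded_measurable (k := n) gam (tr i lam).
Hypothesis s_ge0 : forall lam, Mg lam -> 0 <= s lam lam.
Hypothesis trace_energy : forall lam, Mg lam ->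
  \sum_(i < 2) l2dot n gam (tr i lam) (tr i lam) <= at_ * s lam lam.

Lemma s_frac_lincomb lam mu mu' b : Mg lam -> Mg mu -> Mg mu' ->
  s lam (fun x => mu x + b * mu' x) = s lam mu + b * s lam mu'.
Proof.
move=> hl hm hm'; rewrite /s_frac mulrN -opprD mulr_sumr -big_split/=; congr (- _).
apply: eq_bigr => i _.
have bt := btr i hl; have bmu := bm hm; have bmu' := bm hm'.
rewrite (l2dotDr mgam gfin bt bmu (bounded_measurableZ b bmu')).
by rewrite (l2dotZr mgam gfin b bt bmu').
Qed.

(** The form depends on [lam] through the fluxes only, which the energy controls. *)
Lemma s_frac_continuous lam mu : Mg lam -> Mg mu ->
  s lam mu ^+ 2 <= 2 * at_ * s lam lam * l2dot n gam mu mu.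
Proof.
move=> hl hm; rewrite /s_frac sqrrN.
have cs i : l2dot n gam (tr i lam) mu ^+ 2 <=
    l2dot n gam (tr i lam) (tr i lam) * l2dot n gam mu mu.
  by apply: l2dot_cauchy_schwarz => //; [exact: btr|exact: bm].
apply: (@le_trans _ _ (2 * \sum_(i < 2) l2dot n gam (tr i lam) mu ^+ 2)).
  exact: sqr_sum_ord2.
rewrite -!mulrA ler_pM2l// mulrA; apply: (@le_trans _ _
  ((\sum_(i < 2) l2dot n gam (tr i lam) (tr i lam)) * l2dot n gam mu mu)).
  by rewrite mulr_suml; apply: ler_sum => i _; exact: cs.
by rewrite ler_wpM2r ?l2dot_ge0// trace_energy.
Qed.

(** One factor [s (lam, lam)] cancels in the continuity estimate. *)
Lemma s_frac_le lam : Mg lam -> s lam lam <= 2 * at_ * l2dot n gam lam lam.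
Proof.
move=> hl; have := s_frac_continuous hl hl; have := s_ge0 hl.
rewrite le_eqVlt => /predU1P[<- _|s0].
  by rewrite !mulr_ge0 ?l2dot_ge0.
rewrite expr2 (_ : 2 * at_ * _ * _ = s lam lam * (2 * at_ * l2dot n gam lam lam)).
  by rewrite ler_pM2l.
by ring.
Qed.

Notation star := (star_norm Om gam Fr Kgmh tau Lg us).

Lemma star_norm_sqrE u d mu : Vg u -> Mg d -> Mg mu ->
  {ae Hmeasure R n.+1 n, forall x, gam x -> tdiv Fr u x = d x} ->
  star u mu = Num.sqrt (a_frac gam Fr Kg u u + Lg * l2vdot n gam u u
    + tau * l2dot n gam d d + s mu mu + tau^-1 * l2dot n gam mu mu).
Proof.
move=> hu hd hm ud; rewrite /star_norm a_frac_sqr; congr (Num.sqrt (_ + _ + _ + _ + _)).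
- rewrite l2vnorm_sqr (l2vdotZ mgam _ (Vg_L2 hu)).
  by rewrite sqr_sqrtr ?(ltW Lg_gt0).
- have ud' : {ae Hmeasure R n.+1 n, forall x, gam x ->
      Num.sqrt tau * tdiv Fr u x = Num.sqrt tau * d x}.
    case: ud => N [mN N0 hN]; exists N; split=> // x nx; apply: hN.
    by apply: contra_not nx => h /h ->.
  rewrite l2norm_sqr (ae_l2dot_congr ud' ud') (l2dotZZ mgam gfin _ (bm hd)).
  by rewrite sqr_sqrtr ?(ltW tau_gt0).
- by rewrite /s_norm sqr_sqrtr ?(s_ge0 hm).
- rewrite l2norm_sqr (l2dotZZ mgam gfin _ (bm hm)).
  by rewrite exprVn sqr_sqrtr ?(ltW tau_gt0).
Qed.

Lemma star_norm0 : star (cst 0) (cst 0) = 0.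
Proof.
rewrite /star_norm.
have vd0 p (f : pt -> 'rV[R]_p) : (forall x, f x = 0) -> l2vnorm n gam f = 0.
  move=> f0; rewrite /l2vnorm /l2vdot (_ : (fun x => _) = cst 0) ?Rintegral_cst//.
    by rewrite mul0r sqrtr0.
  by apply/funext => x; rewrite f0 dot0l.
have d0 f g : (forall x, g x = 0) -> l2dot n gam f g = 0.
  move=> g0; rewrite /l2dot (_ : (fun x => _) = cst 0) ?Rintegral_cst// ?mul0r//.
  by apply/funext => x; rewrite g0 mulr0.
rewrite vd0; last by move=> x; rewrite /tcoord/= /mulmv !mul0mx.
rewrite vd0; last by move=> x; rewrite scaler0.
rewrite /l2norm !d0.
- rewrite /s_norm /s_frac big1 => [|i _]; last exact: d0.
  by rewrite oppr0 sqrtr0 expr0n !addr0 sqrtr0.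
- by move=> x; rewrite mulr0.
- move=> x; rewrite /tdiv big1 ?mulr0// => j _.
  by rewrite derive_cst dot0l.
Qed.

Lemma Vg0 : Vg (cst 0).
Proof.
have c0 : in_L2 n gam (cst 0 : pt -> R).
  split; first exact: measurable_cst.
  rewrite (_ : (fun x => _) = cst 0%E); first exact: integrable0.
  by apply/funext => x; rewrite /cst expr0n.
split=> //.
- move=> j; rewrite /rt0_local; case: (cshape (G j)).
    by exists 0, 0 => t _; rewrite scale0r addr0 mul0mx.
  exists 0, 0 => t _; rewrite (_ : \row_j _ = 0) ?mul0mx//.
  by apply/rowP => i; rewrite !mxE mul0r addr0.
- split=> [j|]; first by rewrite (_ : (fun x => _) = cst 0)//; apply/funext => x; rewrite mxE.
  exists (cst 0) => // phi _; rewrite /l2vdot /l2dot.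
  rewrite (_ : (fun x => dot _ _) = cst 0); last by apply/funext => x; rewrite dot0l.
  rewrite (_ : (fun x => cst 0 x * _) = cst 0); last by apply/funext => x; rewrite mul0r.
  by rewrite Rintegral_cst// mul0r oppr0.
Qed.

(** Testing with the solution itself controls everything but the divergence, and
    the divergence is recovered by adding to the multiplier a small multiple of
    [tau] times the divergence. *)
Lemma inf_sup_bound u lam : Vg u -> Mg lam ->
  (((6 * (1 + tau * at_) ^+ 2)^-1 * star u lam)%:E <=
   inf_sup_quotient Om gam Fr Kg Kgmh tau Lg us Vg Mg u lam)%E.
Proof.
move=> hu hl; have [d hd ud] := tdiv_P0 hu.
have bl := bm hl; have bd := bm hd.
pose a := tau * at_; have a0 : 0 <= a by rewrite mulr_ge0// ltW.
have tau0 : tau != 0 by rewrite gt_eqF.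
pose b := test_weight a * tau; pose mu x := lam x + b * d x.
have hmu : Mg mu by exact: P0_lincomb.
have bmu := bm hmu; have bbd := bounded_measurableZ b bd.
pose X := a_frac gam Fr Kg u u + Lg * l2vdot n gam u u.
pose P := tau^-1 * l2dot n gam lam lam; pose S := s lam lam.
pose D := tau * l2dot n gam d d; pose m := l2dot n gam lam d; pose sg := tau * s lam d.
have X0 : 0 <= X.
  rewrite addr_ge0//; first by rewrite -a_frac_sqr sqr_ge0.
  by rewrite mulr_ge0 ?l2vdot_ge0// ltW.
have P_ge0 : 0 <= P by rewrite mulr_ge0 ?l2dot_ge0// invr_ge0 ltW.
have D_ge0 : 0 <= D by rewrite mulr_ge0 ?l2dot_ge0// ltW.
have S_ge0 : 0 <= S by exact: s_ge0.
have mPD : m ^+ 2 <= P * D.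
  rewrite /P /D mulrACA (mulVf tau0) mul1r.
  exact: (l2dot_cauchy_schwarz mgam gfin bl bd).
have sgSD : sg ^+ 2 <= 2 * a * S * D.
  rewrite /sg exprMn (_ : 2 * a * S * D = tau ^+ 2 * (2 * at_ * S * l2dot n gam d d)).
    by rewrite ler_wpM2l ?sqr_ge0 ?(s_frac_continuous hl hd).
  by rewrite /a /D; ring.
have SP : S <= 2 * a * P.
  rewrite (_ : 2 * a * P = 2 * at_ * l2dot n gam lam lam); first exact: (s_frac_le hl).
  by rewrite /a /P; field.
have dlmu f : bounded_measurable (k := n) gam f ->
    l2dot n gam f mu = l2dot n gam f lam + b * l2dot n gam f d.
  by move=> bf; rewrite l2dotDr// l2dotZr.
have PmuE : tau^-1 * l2dot n gam mu mu = P + 2 * test_weight a * m + test_weight a ^+ 2 * D.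
  rewrite (dlmu mu bmu) (l2dotC _ mu lam) (l2dotC _ mu d) (dlmu lam bl) (dlmu d bd).
  rewrite (l2dotC _ d lam).
  by rewrite /P /m /D /b; field.
have Smu_le : s mu mu <= 2 * a * (P + 2 * test_weight a * m + test_weight a ^+ 2 * D).
  rewrite -PmuE (_ : 2 * a * _ = 2 * at_ * l2dot n gam mu mu); first exact: (s_frac_le hmu).
  by rewrite /a; field.
have QE : A_frac gam Fr Kg tau Lg u lam u mu + s lam mu =
    X + P + S + test_weight a * (m + D + sg).
  rewrite /A_frac /b_frac (l2dot_ae_eql mu ud) (l2dot_ae_eql lam ud).
  rewrite (s_frac_lincomb b hl hl hd) (dlmu lam bl) (dlmu d bd) (l2dotC _ d lam).
  by rewrite /X /P /S /D /m /sg /b; field.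
have starl : star u lam = Num.sqrt (X + D + S + P) by exact: (star_norm_sqrE hu hd hl ud).
have starmu : star u mu = Num.sqrt (X + D + s mu mu + (P + 2 * test_weight a * m + test_weight a ^+ 2 * D)).
  by rewrite -PmuE; exact: (star_norm_sqrE hu hd hmu ud).
have bound := quotient_bound a0 X0 P_ge0 S_ge0 D_ge0 mPD sgSD Smu_le (s_ge0 hmu).
rewrite -starl -starmu in bound.
have c0 : 0 < 6 * (1 + a) ^+ 2 by rewrite mulr_gt0// exprn_gt0// ltr_wpDr.
have [Nle0|Npos] := leP (X + D + S + P) 0.
  have [XZ DZ SZ PZ] := nonneg_sum4_le0 X0 D_ge0 S_ge0 P_ge0 Nle0.
  have -> : star u lam = 0.
    by rewrite starl XZ DZ SZ PZ !addr0 sqrtr0.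
  (* the pair may be zero, so the supremum is bounded below by another quotient,
     which is 0: that of the indicator function of an element *)
  rewrite mulr0; have [x gx] := fd_nonempty hOmega.
  have [wf _ _ /(_ x gx)[j _ _]] := hG.
  pose w := step_function G (fun i => (i == j)%:R).
  have hw : Mg w by exact: step_function_P0 hG _.
  have bw := bm hw.
  apply: ereal_sup_ubound; exists (cst 0, w).
    split=> //=; first exact: Vg0.
    move=> [_ w0]; have [y yj] := open_cell_nonempty (G j).
    have : w y = 0 by rewrite w0.
    by rewrite /w (step_function_on hG _ yj) eqxx => /eqP; rewrite oner_eq0.
  have sq0 (z A B : R) : z ^+ 2 <= A * B -> A = 0 -> z = 0.
    by move=> h A0; apply/eqP; rewrite -sqrf_eq0 eq_le sqr_ge0 andbT (le_trans h)// A0 mul0r.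
  have lw : l2dot n gam lam w = 0.
    apply: (sq0 _ _ _ (l2dot_cauchy_schwarz mgam gfin bl bw)).
    by apply/eqP; move/eqP: PZ; rewrite mulf_eq0 invr_eq0 (negbTE tau0).
  have dw : l2dot n gam d w = 0.
    apply: (sq0 _ _ _ (l2dot_cauchy_schwarz mgam gfin bd bw)).
    by apply/eqP; move/eqP: DZ; rewrite mulf_eq0 (negbTE tau0).
  have sw : s lam w = 0.
    by apply: (sq0 _ _ _ (s_frac_continuous hl hw)); rewrite -/S SZ mulr0.
  have z1 : a_frac gam Fr Kg u (cst 0) = 0.
    rewrite /a_frac /l2vdot (_ : (fun x => dot _ _) = cst 0) ?Rintegral_cst ?mul0r//.
    by apply/funext => y; rewrite /tcoord mul0mx dotC dot0l.
  have z2 : l2vdot n gam u (cst 0) = 0.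
    rewrite /l2vdot (_ : (fun x => dot _ _) = cst 0) ?Rintegral_cst ?mul0r//.
    by apply/funext => y; rewrite dotC dot0l.
  have z3 : b_frac gam Fr (cst 0) lam = 0.
    rewrite /b_frac /l2dot (_ : (fun x => _) = cst 0) ?Rintegral_cst ?mul0r//.
    by apply/funext => y; rewrite /tdiv big1 ?mul0r// => i _; rewrite derive_cst dot0l.
  rewrite /= /A_frac z1 z2 lw z3 /b_frac (l2dot_ae_eql w ud) dw sw.
  by rewrite !mulr0 subr0 !addr0 mul0r.
have starl0 : 0 < star u lam by rewrite starl sqrtr_gt0.
have starmu0 : 0 < star u mu.
  rewrite starmu sqrtr_gt0 ltNge; apply/negP => M0.
  have := test_pair_definite a0 X0 P_ge0 D_ge0 mPD SP (s_ge0 hmu) M0.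
  by rewrite leNgt Npos.
apply: (@le_trans _ _ ((A_frac gam Fr Kg tau Lg u lam u mu + s lam mu) / star u mu)%:E).
  by rewrite lee_fin (ler_pdivlMr _ _ starmu0) -mulrA (ler_pdivrMl _ _ c0) QE.
apply: ereal_sup_ubound; exists (u, mu) => //; split=> //= -[u0 mu0].
by move: starmu0; rewrite u0 mu0 star_norm0 ltxx.
Qed.

End local_solver.
End fracture_inf_sup.

(** * Energy of the local problems *)

Section local_energy.
Context {R : realType} {n : nat}.
Notation pt := 'rV[R]_n.+1.
Variables (Omega : set pt) (Om : 'I_2 -> set pt) (gam : set pt).
Hypothesis hOmega : fractured_domain Omega Om gam.
Variables (K : pt -> 'M[R]_n.+1) (cK CK : R).
Hypothesis cK_gt0 : 0 < cK.
Hypothesis hK : conductivity_tensor n.+1 (Om 0 `|` Om 1) K cK CK.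
Variables (tau : R).
Hypothesis tau_gt0 : 0 < tau.

(** Each local problem is tested with its own solution. *)
Lemma local_solution_energy (beta : R) V M i lam u p :
  local_solution Om gam K tau beta V M i lam u p ->
  - l2dot n gam lam (normal_trace (Om i) u) =
  l2vdot n.+1 (Om i) (fun x => mulmv (invmx (K x)) (u x)) u +
  beta * l2dot n gam (normal_trace (Om i) u) (normal_trace (Om i) u) +
  tau^-1 * l2dot n.+1 (Om i) p p.
Proof.
move=> [Vu Mp h1 h2]; rewrite -(h1 u Vu) /a_bulk.
have := h2 p Mp; rewrite /c_bulk => /eqP; rewrite addr_eq0 => /eqP ->.
by field; rewrite gt_eqF.
Qed.

Lemma bulk_coercive i (u : pt -> pt) : (forall j, in_L2 n.+1 (Om i) (fun x => u x 0 j)) ->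
  cK * l2vdot n.+1 (Om i) u u <=
  l2vdot n.+1 (Om i) (fun x => mulmv (invmx (K x)) (u x)) u.
Proof.
have mO : measurable (Om i : set (hspace R n.+1 n.+1)).
  exact/open_hmeasurable/(open_Om hOmega).
apply: (conductivity_coercive mO cK_gt0 _ hK).
by case: (ord2P i) => -> x Ox; [left|right].
Qed.

Section traces.
Variables (i : 'I_2) (I : finType) (T : I -> @cell R n n.+1).
Hypothesis hT : is_partition T (Om i).

(** The frontier lies in the closed cells but meets no open cell, so it is made of
    faces. *)
Lemma hausdorff_frontier_fin : (hausdorff n (frontier (Om i)) < +oo)%E.
Proof.
have [wf sub _ cov] := hT.
apply: (@le_lt_trans _ _ (\sum_c hausdorff n (closed_cell (T c) `\` open_cell (T c)))%E).
  apply: hausdorff_fin_cover => x [clx nox].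
  have nOm : ~ Om i x.
    move=> Ox; apply: nox; apply: open_nbhs_nbhs; split=> //.
    exact: (open_Om hOmega).
  have [c xc] : exists c, closed_cell (T c) x.
    apply: contrapT => nc.
    have : nbhs x [set y | forall c, ~ closed_cell (T c) y].
      apply: (@filter_forall _ _ _ (nbhs x)) => c.
      apply: (@open_nbhs_nbhs _ x (~` closed_cell (T c))); split.
        by apply: closed_openC; exact: closed_closed_cell.
      by move=> xc; apply: nc; exists c.
    by move=> /clx[y [/cov[c _ yc]]] /(_ c).
  by exists c => //; split=> // /sub.
by apply: lte_sum_pinfty => c _; exact: hausdorff_cell_boundary_fin.
Qed.

Variable v : pt -> pt.
Hypothesis hv : RT0_space T (Om i) (Om i) v.

Lemma trace_bounded_measurable :
  bounded_measurable (k := n) gam (normal_trace (Om i) v).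
Proof.
have [wf _ disj _] := hT; have [v0 vloc _] := hv; split.
  apply: (normal_trace_measurable wf disj v0 vloc); first exact: gam_hmeasurable hOmega n.
  by move=> j; exact: normal_continuous_on hOmega i j.
have [B hB] := normal_trace_bounded wf v0 vloc.
by exists B => x _; exact: hB.
Qed.

(** Finiteness of the integral over the frontier matters: the real-valued integral
    of a function of infinite integral is 0. *)
Lemma trace_frontier :
  l2dot n gam (normal_trace (Om i) v) (normal_trace (Om i) v) <=
  l2norm n (frontier (Om i)) (normal_trace (Om i) v) ^+ 2.
Proof.
have [wf _ _ _] := hT; have [v0 vloc _] := hv.
rewrite l2norm_sqr; apply: ge0_subset_Rintegral.
- exact: gam_frontier hOmega i.
- by move=> x; rewrite -expr2 sqr_ge0.
- have [B hB] := normal_trace_bounded wf v0 vloc.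
  have mF : measurable (frontier (Om i) : set (hspace R n.+1 n)).
    by apply: measurableD; [exact/closed_hmeasurable/closed_closure|
                            exact/open_hmeasurable/open_interior].
  apply: (@le_lt_trans _ _ (\int[Hmeasure R n.+1 n]_(x in frontier (Om i)) (B ^+ 2)%:E)%E).
    apply: ae_le_integral; apply: aeW => x _; rewrite lee_fin -expr2.
    rewrite -real_normK ?num_real// ler_pXn2r// ?nnegrE//.
    by rewrite (le_trans _ (hB (Om i) x)).
  rewrite integral_cst//; apply: lte_mul_pinfty; first by rewrite lee_fin sqr_ge0.
    by [].
  exact: hausdorff_frontier_fin.
Qed.

End traces.
End local_energy.

(** * Robin coupling and continuous pressure *)

(* The dimension of the ambient space is d = n + 1. *)
Theorem theorem5p7 (R : realType) (n : nat) (hd : n.+1 = 2%N \/ n.+1 = 3%N)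
  (Omega : set 'rV[R]_n.+1) (Om : 'I_2 -> set 'rV[R]_n.+1)
  (gam : set 'rV[R]_n.+1)
  (hOmega : fractured_domain Omega Om gam)
  (K : 'rV[R]_n.+1 -> 'M[R]_n.+1) (cK CK : R) (cK_gt0 : 0 < cK)
  (hK : conductivity_tensor n.+1 (Om 0 `|` Om 1) K cK CK)
  (Fr : 'rV[R]_n.+1 -> 'M[R]_(n, n.+1)) (hFr : tangent_frame Om gam Fr)
  (Kg : 'rV[R]_n.+1 -> 'M[R]_n) (cKg CKg : R) (cKg_gt0 : 0 < cKg)
  (hKg : conductivity_tensor n gam Kg cKg CKg)
  (Kgmh : 'rV[R]_n.+1 -> 'M[R]_n)
  (hKgmh : {ae Hmeasure R n.+1 n,
              forall x, gam x -> is_inv_sqrt (Kg x) (Kgmh x)})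
  (alpha tau Lg : R) (alpha_gt0 : 0 < alpha) (tau_gt0 : 0 < tau)
  (Lg_gt0 : 0 < Lg)
  (I : 'I_2 -> finType) (T : forall i, I i -> @cell R n n.+1)
  (J : finType) (G : J -> @cell R n n)
  (hT : forall i, is_partition (@T i) (Om i))
  (hTconf : conforming (fun c : {i : 'I_2 & I i} => T (tag c) (tagged c)))
  (hG : is_partition G gam)
  (hTG : coarsens_trace (fun c : {i : 'I_2 & I i} => T (tag c) (tagged c)) G gam)
  (h : R) (hh : h = mesh_size T G)
  (V : 'I_2 -> set ('rV[R]_n.+1 -> 'rV[R]_n.+1))
  (hV : V = fun i => RT0_space (@T i) (Om i) (Om i))
  (M : 'I_2 -> set ('rV[R]_n.+1 -> R)) (hM : M = fun i => P0_space (@T i))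
  (Vg : set ('rV[R]_n.+1 -> 'rV[R]_n.+1)) (hVg : Vg = RT0_space G gam Omega)
  (Mg : set ('rV[R]_n.+1 -> R)) (hMg : Mg = P0_space G)
  (CQ : R)
  (hQ : forall (lam : 'rV[R]_n.+1 -> R) (q : 'I_2 -> 'rV[R]_n.+1 -> R),
     Mg lam -> (forall i, is_normal_projection Om gam V i lam (q i)) ->
     l2norm n gam lam <= CQ * (l2norm n gam (q 0) + l2norm n gam (q 1)))
  (CdTr : R) (CdTr_gt0 : 0 < CdTr)
  (hdTr : forall i v, V i v ->
     l2norm n (frontier (Om i)) (normal_trace (Om i) v) <=
     CdTr * (Num.sqrt h)^-1 * l2vnorm n.+1 (Om i) v) :
  (forall (us : 'I_2 -> ('rV[R]_n.+1 -> R) -> 'rV[R]_n.+1 -> 'rV[R]_n.+1)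
          (ps : 'I_2 -> ('rV[R]_n.+1 -> R) -> 'rV[R]_n.+1 -> R),
     (forall i lam, Mg lam ->
        local_solution Om gam K tau alpha^-1 V M i lam (us i lam) (ps i lam)) ->
     forall u lam, Vg u -> Mg lam ->
       ((6 * (1 + tau * alpha) ^+ 2)^-1
          * star_norm Om gam Fr Kgmh tau Lg us u lam)%:E
       <= inf_sup_quotient Om gam Fr Kg Kgmh tau Lg us Vg Mg u lam)%E
  /\
  (forall (us : 'I_2 -> ('rV[R]_n.+1 -> R) -> 'rV[R]_n.+1 -> 'rV[R]_n.+1)
          (ps : 'I_2 -> ('rV[R]_n.+1 -> R) -> 'rV[R]_n.+1 -> R),
     (forall i lam, Mg lam ->
        local_solution Om gam K tau 0 V M i lam (us i lam) (ps i lam)) ->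
     forall u lam, Vg u -> Mg lam ->
       ((6 * (1 + CdTr ^+ 2 * cK^-1 * (tau / h)) ^+ 2)^-1
          * star_norm Om gam Fr Kgmh tau Lg us u lam)%:E
       <= inf_sup_quotient Om gam Fr Kg Kgmh tau Lg us Vg Mg u lam)%E.
Proof.
have n0 : (0 < n)%N by case: hd => -[->].
have h0 : 0 <= h by rewrite hh /mesh_size !le_max bigmax_idl le_max lexx.
have Vtrace i v : V i v -> bounded_measurable (k := n) gam (normal_trace (Om i) v).
  by rewrite hV => hv; exact: (trace_bounded_measurable hOmega (hT i) hv).
have VL2 i v : V i v -> forall j, in_L2 n.+1 (Om i) (fun x => v x 0 j).
  by rewrite hV => -[_ _ []].
have coer i v : V i v -> cK * l2vdot n.+1 (Om i) v v <=
    l2vdot n.+1 (Om i) (fun x => mulmv (invmx (K x)) (v x)) v.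
  by move=> /VL2; exact: (bulk_coercive hOmega cK_gt0 hK).
have energy_ge0 i v : V i v ->
    0 <= l2vdot n.+1 (Om i) (fun x => mulmv (invmx (K x)) (v x)) v.
  by move=> /coer; apply: le_trans; rewrite mulr_ge0 ?l2vdot_ge0// ltW.
have sE us lam : s_frac Om gam us lam lam =
    \sum_(i < 2) - l2dot n gam lam (normal_trace (Om i) (us i lam)).
  by rewrite /s_frac sumrN; congr (- _); apply: eq_bigr => i _; rewrite l2dotC.
have p_ge0 i (p : 'rV[R]_n.+1 -> R) : 0 <= tau^-1 * l2dot n.+1 (Om i) p p.
  by rewrite mulr_ge0 ?l2dot_ge0// invr_ge0 ltW.
have tr_ge0 i v : 0 <= l2dot n gam (normal_trace (Om i) v) (normal_trace (Om i) v).
  exact: l2dot_ge0.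
split=> us ps hus u lam hu hl.
- (* the flux term is part of the energy *)
  have main i mu : Mg mu -> l2dot n gam (normal_trace (Om i) (us i mu)) (normal_trace (Om i) (us i mu)) <=
      alpha * - l2dot n gam mu (normal_trace (Om i) (us i mu)).
    move=> hm; have sol := hus i mu hm; have [Vu _ _ _] := sol.
    rewrite (local_solution_energy tau_gt0 sol) -ler_pdivrMl//.
    have := energy_ge0 i _ Vu; have := p_ge0 i (ps i mu); lra.
  rewrite hVg hMg in hu hl *; rewrite hMg in main hus.
  apply: (@inf_sup_bound R n n0 Omega Om gam hOmega Fr Kg Kgmh hFr hKgmh tau Lg tau_gt0
    Lg_gt0 J G hG us alpha) => //.
  + exact: ltW.
  + by move=> i mu hm; apply: Vtrace; have [] := hus i mu hm.
  + move=> mu hm; rewrite sE; apply: sumr_ge0 => i _; rewrite -(pmulr_rge0 _ alpha_gt0).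
    exact: le_trans (tr_ge0 _ _) (main i mu hm).
  + by move=> mu hm; rewrite sE mulr_sumr; apply: ler_sum => i _; exact: main.
- (* the flux is bounded by the field, through the discrete trace inequality, and
     the field by the coercive part of the energy *)
  pose at_ := CdTr ^+ 2 * cK^-1 * h^-1.
  have main i mu : Mg mu ->
      0 <= - l2dot n gam mu (normal_trace (Om i) (us i mu)) /\
      l2dot n gam (normal_trace (Om i) (us i mu)) (normal_trace (Om i) (us i mu)) <=
      at_ * - l2dot n gam mu (normal_trace (Om i) (us i mu)).
    move=> hm; have sol := hus i mu hm; have [Vu _ _ _] := sol.
    have [A0 A1] := (energy_ge0 i _ Vu, coer i _ Vu).
    have low : l2vdot n.+1 (Om i) (fun x => mulmv (invmx (K x)) (us i mu x)) (us i mu) <=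
        - l2dot n gam mu (normal_trace (Om i) (us i mu)).
      by rewrite (local_solution_energy tau_gt0 sol); have := p_ge0 i (ps i mu); lra.
    split; first exact: le_trans low.
    have Vu' := Vu; rewrite hV in Vu'.
    apply: le_trans (trace_frontier hOmega (hT i) Vu') _.
    apply: (@le_trans _ _ ((CdTr * (Num.sqrt h)^-1 * l2vnorm n.+1 (Om i) (us i mu)) ^+ 2)).
      rewrite ler_pXn2r// ?nnegrE ?sqrtr_ge0//; first exact: hdTr.
      by rewrite !mulr_ge0 ?invr_ge0 ?sqrtr_ge0// ltW.
    rewrite !exprMn l2vnorm_sqr exprVn sqr_sqrtr//.
    rewrite /at_ (_ : CdTr ^+ 2 * cK^-1 * h^-1 = CdTr ^+ 2 * h^-1 * cK^-1); last by ring.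
    rewrite -[_ * cK^-1 * _]mulrA ler_wpM2l//.
      by rewrite mulr_ge0 ?sqr_ge0// invr_ge0.
    by rewrite ler_pdivlMl//; exact: le_trans low.
  have -> : CdTr ^+ 2 * cK^-1 * (tau / h) = tau * at_ by rewrite /at_; ring.
  rewrite hVg hMg in hu hl *; rewrite hMg in main hus.
  apply: (@inf_sup_bound R n n0 Omega Om gam hOmega Fr Kg Kgmh hFr hKgmh tau Lg tau_gt0
    Lg_gt0 J G hG us at_) => //.
  + by rewrite /at_ !mulr_ge0 ?sqr_ge0 ?invr_ge0// ltW.
  + by move=> i mu hm; apply: Vtrace; have [] := hus i mu hm.
  + by move=> mu hm; rewrite sE; apply: sumr_ge0 => i _; have [] := main i mu hm.
  + by move=> mu hm; rewrite sE mulr_sumr; apply: ler_sum => i _; have [] := main i mu hm.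
Qed.
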